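(* Consider the discrete problem: find $(u_h,p_h)\in V_h\times W_h$ such that $$a(u_h,v_h)-b(v_h,p_h)=0\ \ \forall v_h\in V_h,\qquad b(u_h,w_h)=(f,w_h)_\Omega\ \ \forall w_h\in W_h,$$ with $f\in L^2(\Omega)$. With $\mathcal R_h=\mathcal R_h^\flat$ it admits a unique solution $(u_h,p_h)\in V_h^\flat\times W_h$. If the flat mortar condition holds, then with $\mathcal R_h=\mathcal R_h^\sharp$ it has a unique solution $(u_h,p_h)\in V_h^\sharp\times W_h$. In both cases the solution satisfies $$\|u_h\|_V+\|p_h\|_W\lesssim\|f\|_\Omega.$$ Moreover, if the flat mortar condition holds in the case $\mathcal R_h=\mathcal R_h^\flat$, respectively if the sharp mortar condition holds in the case $\mathcal R_h=\mathcal R_h^\sharp$, then the mortar solution $\lambda_h\in\Lambda_h$ (i.e. the $\lambda_h$ with $u_h=u_h^0+\mathcal R_h\lambda_h$, $u_h^0\in V_h^0$) is unique and satisfies $$\|\lambda_h\|_\Lambda\lesssim h^{-1/2}\|u_h\|_V.$$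
   Context: **Domain decomposition.** $\Omega\subset\mathbb R^n$, $n\in\{2,3\}$, is a bounded polygonal domain, split into a fixed finite family of disjoint polygonal subdomains $\Omega_i$, $i\in I_\Omega$, with outward unit normals $\nu_i$. $\Gamma_{ij}=\partial\Omega_i\cap\partial\Omega_j$ are the $(n-1)$-dimensional Lipschitz interfaces; $\Gamma=\bigcup_{i<j}\Gamma_{ij}$, $\Gamma_i=\Gamma\cap\partial\Omega_i$, $I_{int}=\{i:\partial\Omega_i\subseteq\Gamma\}$. $\Lambda=L^2(\Gamma)$ with $\|\cdot\|_\Lambda=\|\cdot\|_\Gamma$; for $\lambda\in\Lambda$, $\lambda_i:=\lambda$ and $\lambda_j:=-\lambda$ on $\Gamma_{ij}$, $i<j$. $(\cdot,\cdot)_G$ and $\|\cdot\|_G$ are the $L^2(G)$ inner product and norm, $\|v\|_{\mathrm{div},G}^2=\|v\|_G^2+\|\nabla\cdot v\|_G^2$. $\|v\|_V=\sum_i\|v|_{\Omega_i}\|_{\mathrm{div},\Omega_i}$, $\|w\|_W=\|w\|_\Omega$. $K$ is a symmetric tensor field with $k_{min}|\xi|^2\le\xi^TK(x)\xi\le k_{max}|\xi|^2$, $0<k_{min}<k_{max}<\infty$. **Discrete spaces.** For each $i$, $\Omega_{h,i}$ is a shape-regular affine mesh of $\Omega_i$ of typical mesh size $h$ (meshes may be non-matching on $\Gamma_{ij}$); $V_{h,i}\times W_{h,i}\subset H(\mathrm{div},\Omega_i)\times L^2(\Omega_i)$ is a standard stable mixed pair (e.g. Raviart–Thomas or Brezzi–Douglas–Marini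 with discontinuous polynomials): $\nabla\cdot V_{h,i}=W_{h,i}$, and for every $w\in W_{h,i}$ there is $0\ne v\in V_{h,i}$ with $(\nabla\cdot v,w)_{\Omega_i}\gtrsim\|v\|_{\mathrm{div},\Omega_i}\|w\|_{\Omega_i}$. Let $V_{h,i}^0=\{v\in V_{h,i}:\nu_i\cdot v|_{\Gamma_i}=0\}$, $V_h^0=\bigoplus_iV_{h,i}^0$; $S_{H,i}=\mathbb R$ (constants) if $i\in I_{int}$ and $\{0\}$ otherwise. The inf-sup condition also holds for $V^0_{h,i}\times(W_{h,i}\cap S_{H,i}^\perp)$. Let $V_{h,i}^\Gamma=(\nu_i\cdot V_{h,i})|_{\Gamma_i}$, $V_h^\Gamma=\bigoplus_iV_{h,i}^\Gamma$; $V_{h,i}^\Gamma$ is the direct sum of its restrictions to the $\Gamma_{ij}\subset\Gamma_i$, each containing constants. The discrete trace inequality $\|\nu_i\cdot v\|_{\Gamma_i}\lesssim h^{-1/2}\|v\|_{\Omega_i}$ holds for $v\in V_{h,i}$. $\Lambda_h=\bigoplus_{i<j}\Lambda_{h,ij}$, where $\Lambda_{h,ij}\subset L^2(\Gamma_{ij})$ is a space of continuous or discontinuous piecewise polynomials (containing constants) on a shape-regular affine mesh of $\Gamma_{ij}$. $W_h=\bigoplus_iW_{h,i}$. **Projections and mortar conditions.** $\mathcal Q_{h,i}^\flat\lambda$ is the $L^2(\Gamma_i)$-projection of $\lambda_i$ onto $V^\Gamma_{h,i}$. $V_{h,c}^\Gamma=\{\xi\in V_h^\Gamma:\sum_i(\xi_i,\mu_h)_{\Gamma_i}=0\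 \forall\mu_h\in\Lambda_h\}$, and $\mathcal Q_h^\sharp\lambda=(\mathcal Q_{h,i}^\sharp\lambda)_i$ is the $L^2$-projection of $(\lambda_i)_i\in\bigoplus_iL^2(\Gamma_i)$ onto $V_{h,c}^\Gamma$. The *flat* (resp. *sharp* ) *mortar condition* is: $\|\mu_h\|_{\Gamma_{ij}}\lesssim\|\mathcal Q_{h,i}\mu_h\|_{\Gamma_{ij}}+\|\mathcal Q_{h,j}\mu_h\|_{\Gamma_{ij}}$ for all $\mu_h\in\Lambda_h$ and all $\Gamma_{ij}$, with $\mathcal Q_{h,i}=\mathcal Q_{h,i}^\flat$ (resp. $\mathcal Q_{h,i}^\sharp$). **Extensions.** For $\bullet\in\{\flat,\sharp\}$ and $\lambda\in\Lambda$, $(\mathcal R_{h,i}^\bullet\lambda,p_{h,i}^\lambda,r_i)\in V_{h,i}\times W_{h,i}\times S_{H,i}$ is the solution of: $(K^{-1}\mathcal R^\bullet_{h,i}\lambda,v^0)_{\Omega_i}-(\nabla\cdot v^0,p_{h,i}^\lambda)_{\Omega_i}=0$ for all $v^0\in V_{h,i}^0$; $(\nabla\cdot\mathcal R^\bullet_{h,i}\lambda,w)_{\Omega_i}-(r_i,w)_{\Omega_i}=0$ for all $w\in W_{h,i}$; $(p_{h,i}^\lambda,s)_{\Omega_i}=0$ for all $s\in S_{H,i}$; $\nu_i\cdot\mathcal R^\bullet_{h,i}\lambda=\mathcal Q^\bullet_{h,i}\lambda$ on $\Gamma_i$. $\mathcal R_h^\bullet=\bigoplus_i\mathcal R^\bullet_{h,i}$,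 $V_h^\bullet=V_h^0\oplus\mathcal R_h^\bullet\Lambda_h$; $V_h$ denotes $V_h^\flat$ or $V_h^\sharp$ according to the choice of $\mathcal R_h$. **Forms.** $a(u,v)=(K^{-1}u,v)_\Omega$, $b(u,w)=\sum_i(\nabla\cdot u|_{\Omega_i},w|_{\Omega_i})_{\Omega_i}$. $a\lesssim b$ means $a\le Cb$ with $C>0$ independent of the mesh size.
   Formalization: ''Standard stable mixed pair'' is read to include constants in W_{h,i} and the canonical commuting interpolation, bounded on H(div)∩L^s (s>2), as for RT and BDM; with the listed conditions alone the uniform stability bound fails. *)

(* Defs.v *)
From HB Require Import structures.
From mathcomp Require Import all_boot all_order all_algebra.
From mathcomp Require Import all_classical all_reals all_analysis.
Import Order.TTheory GRing.Theory Num.Theory.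
Import numFieldNormedType.Exports.

Set Implicit Arguments.
Unset Strict Implicit.
Unset Printing Implicit Defensive.

Local Open Scope classical_set_scope.
Local Open Scope ring_scope.

Section Euclidean.
Context {R : realType} {n : nat}.
Implicit Types (x y a b : 'rV[R]_n) (S : set 'rV[R]_n).

Definition dotp x y : R := \sum_k x 0 k * y 0 k.
(* The norm that the library puts on ['rV[R]_n] is the sup norm. *)
Definition enorm x : R := Num.sqrt (dotp x x).

Definition diam S : \bar R :=
  ereal_sup [set (enorm (z.1 - z.2))%:E | z in S `*` S].

Definition boundary S : set 'rV[R]_n := closure S `\` interior S.

Definition box a b : set 'rV[R]_n := [set x | forall k, a 0 k <= x 0 k <= b 0 k].

End Euclidean.

Section Measures.
Context (R : realType) (n : nat).
Local Notation E := 'rV[R]_n.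
Local Notation Borel := (g_sigma_algebraType (@open E)).
Local Open Scope ereal_scope.

(* Volume of the smallest box around [S]; [mu_ext] below turns it into the
   Lebesgue outer measure (infimum over countable covers by Borel sets). *)
Definition box_gauge (S : set Borel) : \bar R :=
  if `[< S = set0 >] then 0 else
  ereal_inf [set (\prod_k (ab.2 0%R k - ab.1 0%R k))%R%:E |
    ab in [set ab : E * E |
            (forall k, ab.1 0 k <= ab.2 0 k)%R /\ S `<=` box ab.1 ab.2]].

Definition lebesgue_outer : set Borel -> \bar R := mu_ext box_gauge.

(* Volume of the unit ball of R^s. *)
Fixpoint ball_volume (s : nat) : R :=
  match s with
  | 0 => 1
  | 1 => 2
  | s'.+2 => 2 * pi / s'.+2%:R * ball_volume s'
  end%R.

(* Covers by sets of diameter at most [delta], normalized so that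
   s-dimensional Hausdorff measure is Lebesgue measure on R^s. *)
Definition hausdorff_gauge (s : nat) (delta : R) (S : set Borel) : \bar R :=
  if `[< S = set0 >] then 0 else
  if (diam S <= delta%:E) then
    (ball_volume s * (fine (diam S) / 2) ^+ s)%R%:E
  else +oo.

Definition hausdorff_outer (s : nat) (A : set Borel) : \bar R :=
  ereal_sup [set mu_ext (hausdorff_gauge s delta) A |
    delta in [set delta : R | (0 < delta)%R]].

Lemma box_gauge0 : box_gauge set0 = 0.
Proof. by rewrite /box_gauge; case: asboolP. Qed.

Lemma box_gauge_ge0 S : 0 <= box_gauge S.
Proof.
rewrite /box_gauge; case: asboolP => // _.
apply: le_ereal_inf_tmp => _ /= [[a b] /= [ab _] <-].
by rewrite lee_fin; apply: prodr_ge0 => k _; rewrite subr_ge0.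
Qed.

HB.instance Definition _ := isOuterMeasure.Build R Borel lebesgue_outer
  (mu_ext0 box_gauge0 box_gauge_ge0) (mu_ext_ge0 box_gauge_ge0)
  (le_mu_ext box_gauge) (mu_ext_sigma_subadditive box_gauge_ge0).

Lemma ball_volume_ge0 s : (0 <= ball_volume s)%R.
Proof.
suff: (0 <= ball_volume s)%R && (0 <= ball_volume s.+1)%R by case/andP.
elim: s => [|s /andP[IH IH1]]; first by rewrite /= ler01 ler0n.
rewrite IH1/=; apply: mulr_ge0 => //; apply: divr_ge0 => //.
by apply: mulr_ge0 => //; exact: pi_ge0.
Qed.

Lemma hausdorff_gauge0 s delta : hausdorff_gauge s delta set0 = 0.
Proof. by rewrite /hausdorff_gauge; case: asboolP. Qed.

Lemma hausdorff_gauge_ge0 s delta S : 0 <= hausdorff_gauge s delta S.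
Proof.
rewrite /hausdorff_gauge; case: asboolP => // S0; case: ifP => // _.
have [x Sx] : S !=set0 by apply/set0P/eqP.
rewrite lee_fin mulr_ge0 ?ball_volume_ge0// exprn_ge0// divr_ge0// fine_ge0//.
apply: le_ereal_sup_tmp; exists 0 => //; exists (x, x) => //.
by rewrite /= subrr /enorm /dotp big1 ?sqrtr0// => k _; rewrite !mxE mul0r.
Qed.

Lemma hausdorff_outer0 s : hausdorff_outer s set0 = 0.
Proof.
apply/eqP; rewrite eq_le; apply/andP; split.
  apply: ge_ereal_sup => _ [delta /= d0 <-].
  rewrite mu_ext0//; [exact: hausdorff_gauge0|exact: hausdorff_gauge_ge0].
apply: le_ereal_sup_tmp; exists 0 => //; exists 1%R => //=.
by rewrite mu_ext0//; [exact: hausdorff_gauge0|exact: hausdorff_gauge_ge0].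
Qed.

Lemma hausdorff_outer_ge0 s A : 0 <= hausdorff_outer s A.
Proof.
apply: le_ereal_sup_tmp; exists (mu_ext (hausdorff_gauge s 1%R) A).
  by exists 1%R => /=.
by apply: mu_ext_ge0 => S; exact: hausdorff_gauge_ge0.
Qed.

Lemma le_hausdorff_outer s :
  {homo hausdorff_outer s : A B / A `<=` B >-> A <= B}.
Proof.
move=> A B AB; apply: ge_ereal_sup => _ [delta /= d0 <-].
apply: le_ereal_sup_tmp; exists (mu_ext (hausdorff_gauge s delta) B).
  by exists delta.
exact: le_mu_ext.
Qed.

Lemma hausdorff_outer_sigma_subadditive s :
  sigma_subadditive (hausdorff_outer s).
Proof.
move=> F; apply: ge_ereal_sup => _ [delta /= d0 <-].
apply: (le_trans (mu_ext_sigma_subadditive _ _)).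
  by move=> S; exact: hausdorff_gauge_ge0.
apply: lee_nneseries => k _.
  by move=> *; apply: mu_ext_ge0 => S; exact: hausdorff_gauge_ge0.
by apply: le_ereal_sup_tmp; exists (mu_ext (hausdorff_gauge s delta) (F k)) => //;
  exists delta.
Qed.

HB.instance Definition _ s := isOuterMeasure.Build R Borel (hausdorff_outer s)
  (hausdorff_outer0 s) (hausdorff_outer_ge0 s) (@le_hausdorff_outer s)
  (@hausdorff_outer_sigma_subadditive s).

Definition lebesgue_outer_measure : {outer_measure set Borel -> \bar R} :=
  lebesgue_outer.
Definition hausdorff_outer_measure s : {outer_measure set Borel -> \bar R} :=
  hausdorff_outer s.

(* Lebesgue measure and surface measure, on the sets that are measurable in
   the sense of Caratheodory. *)
Definition vol :
    {measure set (caratheodory_type lebesgue_outer_measure) -> \bar R} :=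
  lebesgue_outer_measure.
Definition area :
    {measure set (caratheodory_type (hausdorff_outer_measure n.-1)) -> \bar R} :=
  hausdorff_outer_measure n.-1.

End Measures.

Section L2.
Context d (T : measurableType d) (R : realType).
Variables (mu : {measure set T -> \bar R}) (D : set T).

Definition L2 (f : T -> R) :=
  measurable_fun D f /\ mu.-integrable D (EFin \o (fun x => f x ^+ 2)).

Definition ip (f g : T -> R) : R := \int[mu]_(x in D) (f x * g x).

Definition nrm (f : T -> R) : R := Num.sqrt (ip f f).

End L2.

Section VectorL2.
Context {R : realType} {n : nat}.
Local Notation E := 'rV[R]_n.
Variable D : set E.

Definition vL2 (u : E -> E) := forall k, L2 (vol R n) D (fun x => u x 0 k).

Definition vip (u v : E -> E) : R := \int[vol R n]_(x in D) dotp (u x) (v x).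

Definition vnrm (u : E -> E) : R := Num.sqrt (vip u u).

Definition Lp_integrable (p : R) (u : E -> E) :=
  (vol R n).-integrable D (EFin \o (fun x => enorm (u x) `^ p)).

Definition Lp_norm (p : R) (u : E -> E) : R :=
  (\int[vol R n]_(x in D) (enorm (u x) `^ p)) `^ p^-1.

End VectorL2.

Section Meshes.
Context {R : realType} {n : nat}.
Local Notation E := 'rV[R]_n.

(* The image of the unit simplex or of the unit cube of R^d under
   [xi |-> org + xi *m mx]. *)
Record affine_element d := AffineElement {
  is_cube : bool;
  org : E;
  mx : 'M[R]_(d, n) }.

Definition reference d (cube : bool) : set 'rV[R]_d :=
  [set xi | (forall k, 0 <= xi 0 k <= 1) /\ (cube \/ \sum_k xi 0 k <= 1)].

Definition reference_interior d (cube : bool) : set 'rV[R]_d :=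
  [set xi | (forall k, 0 < xi 0 k < 1) /\ (cube \/ \sum_k xi 0 k < 1)].

Definition element_set d (t : affine_element d) : set E :=
  [set org t + xi *m mx t | xi in reference (is_cube t)].

Definition element_interior d (t : affine_element d) : set E :=
  [set org t + xi *m mx t | xi in reference_interior (is_cube t)].

Record mesh d := Mesh {
  mesh_size : nat;
  element : 'I_mesh_size -> affine_element d }.
Arguments element {d} m t.

Definition mesh_set d (M : mesh d) : set E :=
  \bigcup_t element_set (element M t).

(* The set [G] need only be covered up to a null set, because the
   intersection of two polygonal boundaries may have isolated
   lower-dimensional pieces. *)
Definition is_mesh_of d (M : mesh d) (mu : set E -> \bar R) (G : set E) :=
  [/\ forall t, row_free (mx (element M t)),
      forall t t', t != t' ->
        element_interior (element M t) `&` element_interior (element M t') = set0,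
      mesh_set M `<=` G & mu (G `\` mesh_set M) = 0%E].

(* Each Jacobian has condition number at most [c]. *)
Definition shape_regular (c : R) d (M : mesh d) :=
  forall t (xi eta : 'rV[R]_d),
    enorm (xi *m mx (element M t)) * enorm eta <=
    c * (enorm xi * enorm (eta *m mx (element M t))).

Definition has_mesh_size (c h : R) d (M : mesh d) :=
  (forall t, diam (element_set (element M t)) <= (c * h)%:E)%E /\
  (exists t, h%:E <= c%:E * diam (element_set (element M t)))%E.

Definition polygonal (A : set E) :=
  [/\ open A, interior (closure A) = A &
      exists M : mesh n,
        (forall t, ~~ is_cube (element M t) /\ row_free (mx (element M t))) /\
        closure A = mesh_set M].

Inductive polynomial_fun : (E -> R) -> Prop :=
| polynomial_cst c : polynomial_fun (fun=> c)
| polynomial_coord k : polynomial_fun (fun x => x 0 k)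
| polynomial_add p q :
    polynomial_fun p -> polynomial_fun q -> polynomial_fun (fun x => p x + q x)
| polynomial_mul p q :
    polynomial_fun p -> polynomial_fun q -> polynomial_fun (fun x => p x * q x).

Definition piecewise_polynomial d (M : mesh d) (mu : set E -> \bar R)
    (f : E -> R) :=
  forall t, exists2 q, polynomial_fun q &
    mu (element_set (element M t) `&` [set x | f x != q x]) = 0%E.

End Meshes.
Arguments element {R n d} m t.

Section Geometry.
Context {R : realType} {n : nat}.
Local Notation E := 'rV[R]_n.

(* [A] coincides near [x] with the half-space opposite to [nu]; this is the
   case at almost every boundary point of a polygonal domain. *)
Definition outward_normal (A : set E) (x nu : E) :=
  enorm nu = 1 /\
  exists2 r : R, 0 < r &
    forall y, enorm (y - x) < r -> (A y <-> dotp nu (y - x) < 0).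

Record decomposition (N : nat) := Decomposition {
  dom : set E;
  sub : 'I_N -> set E;
  normal : 'I_N -> E -> E;
  dom_connected : dom !=set0 /\ connected dom;
  dom_bounded : bounded_set dom;
  dom_polygonal : polygonal dom;
  sub_connected : forall i, sub i !=set0 /\ connected (sub i);
  sub_polygonal : forall i, polygonal (sub i);
  sub_dom : forall i, sub i `<=` dom;
  sub_disjoint : forall i j, i != j -> sub i `&` sub j = set0;
  sub_cover : dom `<=` \bigcup_i closure (sub i);
  normal_outward : forall i,
    {ae area R n, forall x, boundary (sub i) x ->
      outward_normal (sub i) x (normal i x)} }.

Definition tensor_field (A : set E) (K : E -> 'M[R]_n) (kmin kmax : R) :=
  [/\ 0 < kmin, kmin < kmax,
      forall k l, measurable_fun
        (A : set (caratheodory_type (lebesgue_outer_measure R n)))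
        (fun x : caratheodory_type (lebesgue_outer_measure R n) => K x k l),
      forall x, A x -> (K x)^T = K x &
      forall x xi, A x ->
        kmin * enorm xi ^+ 2 <= dotp (xi *m K x) xi <= kmax * enorm xi ^+ 2].

Definition grad (phi : E -> R) (x : E) : E := \row_k 'D_(delta_mx 0 k) phi x.

Definition C1 (phi : E -> R) :=
  (forall x, differentiable phi x) /\
  (forall k, continuous (fun x => grad phi x 0 k)).

End Geometry.

Section Interfaces.
Context {R : realType} {n N : nat} (D : @decomposition R n N).
Local Notation E := 'rV[R]_n.
Implicit Types (i j : 'I_N).

Definition gamma i j : set E := boundary (sub D i) `&` boundary (sub D j).

(* [gamma i j] is (n-1)-dimensional, rather than lower-dimensional or empty. *)
Definition interface i j := i != j /\ (0 < area R n (gamma i j))%E.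

Definition Gamma : set E :=
  [set x | exists i j, [/\ (i < j)%N, interface i j & gamma i j x]].

Definition Gamma_ i : set E := Gamma `&` boundary (sub D i).

Definition is_interior i := boundary (sub D i) `<=` Gamma.

(* On the points common to several interfaces, which form a null set, the
   choice of the sign is immaterial. *)
Definition sided i (lam : E -> R) (x : E) : R :=
  if `[< exists j, [/\ (i < j)%N, interface i j & gamma i j x] >]
  then lam x else - lam x.

(* A field in H(div) together with its divergence and its normal trace. *)
Definition hfield : Type := ((E -> E) * (E -> R) * (E -> R))%type.
Definition fld (v : hfield) : E -> E := v.1.1.
Definition dvg (v : hfield) : E -> R := v.1.2.
Definition trc (v : hfield) : E -> R := v.2.

(* Test functions supported in [sub D i] make [dvg v] the weak divergence of
   [fld v]; the others make [trc v] its normal trace on [Gamma_ i]. *)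
Definition in_Hdiv i (v : hfield) :=
  [/\ vL2 (sub D i) (fld v), L2 (vol R n) (sub D i) (dvg v),
      L2 (area R n) (Gamma_ i) (trc v) &
      forall phi, C1 phi ->
        (forall x, boundary (sub D i) x -> ~ Gamma x -> phi x = 0) ->
        \int[vol R n]_(x in sub D i) (dotp (fld v x) (grad phi x) + dvg v x * phi x)
        = \int[area R n]_(x in Gamma_ i) (trc v x * phi x)].

Definition div_norm i (v : hfield) : R :=
  Num.sqrt (vnrm (sub D i) (fld v) ^+ 2 + nrm (vol R n) (sub D i) (dvg v) ^+ 2).

End Interfaces.

Definition finite_dim_subspace (R : realType) (V : lmodType R) (S : set V) :=
  exists m (e : 'I_m -> V), S = [set \sum_k c k *: e k | c in [set: 'I_m -> R]].

Inductive flavour := flat | sharp.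

Section Discretization.
Context {R : realType} {n N : nat} (D : @decomposition R n N).
Local Notation E := 'rV[R]_n.
Local Notation hfield := (@hfield R n).
Implicit Types (i j : 'I_N).

Local Notation "( f , g )_[ i ]" := (ip (vol R n) (sub D i) f g).
Local Notation "( f , g )_Gamma[ i ]" := (ip (area R n) (Gamma_ D i) f g).

Record discretization := Discretization {
  vmesh : 'I_N -> @mesh R n n;
  imesh : 'I_N -> 'I_N -> @mesh R n n.-1;
  Vh : 'I_N -> set hfield;
  Wh : 'I_N -> set (E -> R);
  Lh : 'I_N -> 'I_N -> set (E -> R) }.

Implicit Types (T : discretization).

Definition V0 T i : set hfield :=
  [set v | Vh T i v /\ {ae area R n, forall x, Gamma_ D i x -> trc v x = 0}].

Definition VGamma T i : set (E -> R) := [set trc v | v in Vh T i].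

Definition SH i : set R := [set r | ~ is_interior D i -> r = 0].

(* The constants hidden in the mesh-independent bounds are all at most [c],
   and [h] is the mesh size. *)
Record admissible (c s h : R) T : Prop := {
  adm_vmesh : forall i, is_mesh_of (vmesh T i) (vol R n) (closure (sub D i));
  adm_vmesh_regular : forall i, shape_regular c (vmesh T i);
  adm_vmesh_size : forall i, has_mesh_size c h (vmesh T i);
  adm_imesh : forall i j, (i < j)%N -> interface D i j ->
    is_mesh_of (imesh T i j) (area R n) (gamma D i j);
  adm_imesh_regular : forall i j, (i < j)%N -> interface D i j ->
    shape_regular c (imesh T i j);
  adm_V : forall i, finite_dim_subspace (Vh T i);
  adm_V_Hdiv : forall i v, Vh T i v -> in_Hdiv D i v;
  adm_V_poly : forall i v k, Vh T i v ->
    piecewise_polynomial (vmesh T i) (vol R n) (fun x => fld v x 0 k);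
  adm_W : forall i, finite_dim_subspace (Wh T i);
  adm_W_L2 : forall i w, Wh T i w -> L2 (vol R n) (sub D i) w;
  adm_W_poly : forall i w, Wh T i w ->
    piecewise_polynomial (vmesh T i) (vol R n) w;
  adm_W_cst : forall i, exists2 w, Wh T i w &
    {ae vol R n, forall x, sub D i x -> w x = 1};
  adm_div : forall i v, Vh T i v -> exists2 w, Wh T i w &
    {ae vol R n, forall x, sub D i x -> dvg v x = w x};
  adm_div_onto : forall i w, Wh T i w -> exists2 v, Vh T i v &
    {ae vol R n, forall x, sub D i x -> dvg v x = w x};
  adm_infsup : forall i w, Wh T i w -> nrm (vol R n) (sub D i) w != 0 ->
    exists v, [/\ Vh T i v, div_norm D i v != 0 &
      div_norm D i v * nrm (vol R n) (sub D i) w <= c * (dvg v, w)_[i]];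
  adm_infsup0 : forall i w, Wh T i w ->
    (forall r, SH i r -> (w, cst r)_[i] = 0) ->
    nrm (vol R n) (sub D i) w != 0 ->
    exists v, [/\ V0 T i v, div_norm D i v != 0 &
      div_norm D i v * nrm (vol R n) (sub D i) w <= c * (dvg v, w)_[i]];
  adm_trace_split : forall i j xi, interface D i j -> VGamma T i xi ->
    exists2 eta, VGamma T i eta &
      {ae area R n, forall x, Gamma_ D i x ->
        (gamma D i j x -> eta x = xi x) /\ (~ gamma D i j x -> eta x = 0)};
  adm_trace_cst : forall i j, interface D i j ->
    exists2 eta, VGamma T i eta &
      {ae area R n, forall x, gamma D i j x -> eta x = 1};
  adm_trace_ineq : forall i v, Vh T i v ->
    nrm (area R n) (Gamma_ D i) (trc v) <=
      c * (Num.sqrt h)^-1 * vnrm (sub D i) (fld v);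
  (* The canonical interpolation operator that comes with Raviart-Thomas,
     Brezzi-Douglas-Marini and the other classical pairs, on H(div) and L^s,
     s > 2.  The inf-sup conditions alone do not bound the extension of an
     interface flux uniformly in the mesh size. *)
  adm_interpolation : forall i v, in_Hdiv D i v -> Lp_integrable (sub D i) s (fld v) ->
    exists2 vh, Vh T i vh &
      [/\ forall w, Wh T i w -> (dvg vh, w)_[i] = (dvg v, w)_[i],
          forall xi, VGamma T i xi ->
            (trc vh, xi)_Gamma[i] = (trc v, xi)_Gamma[i] &
          vnrm (sub D i) (fld vh) <=
            c * (Lp_norm (sub D i) s (fld v) + nrm (vol R n) (sub D i) (dvg v))];
  adm_L : forall i j, (i < j)%N -> interface D i j ->
    finite_dim_subspace (Lh T i j);
  adm_L_L2 : forall i j mu, (i < j)%N -> interface D i j -> Lh T i j mu ->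
    L2 (area R n) (gamma D i j) mu;
  adm_L_poly : forall i j mu, (i < j)%N -> interface D i j -> Lh T i j mu ->
    piecewise_polynomial (imesh T i j) (area R n) mu;
  adm_L_cst : forall i j, (i < j)%N -> interface D i j ->
    exists2 mu, Lh T i j mu & {ae area R n, forall x, gamma D i j x -> mu x = 1} }.

Definition Lambda_h T : set (E -> R) :=
  [set mu | forall i j, (i < j)%N -> interface D i j ->
    exists2 nu, Lh T i j nu &
      {ae area R n, forall x, gamma D i j x -> mu x = nu x}].

Definition VGamma_c T : set ('I_N -> E -> R) :=
  [set xi | (forall i, VGamma T i (xi i)) /\
    forall mu, Lambda_h T mu -> \sum_i (xi i, mu)_Gamma[i] = 0].

Definition is_projection (b : flavour) T (lam : E -> R) (xi : 'I_N -> E -> R) :=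
  match b with
  | flat => forall i, VGamma T i (xi i) /\
      forall eta, VGamma T i eta ->
        (xi i, eta)_Gamma[i] = (sided D i lam, eta)_Gamma[i]
  | sharp => VGamma_c T xi /\
      forall eta, VGamma_c T eta ->
        \sum_i (xi i, eta i)_Gamma[i] = \sum_i (sided D i lam, eta i)_Gamma[i]
  end.

Definition mortar_condition (b : flavour) (c : R) T :=
  forall mu xi, Lambda_h T mu -> is_projection b T mu xi ->
  forall i j, (i < j)%N -> interface D i j ->
    nrm (area R n) (gamma D i j) mu <=
      c * (nrm (area R n) (gamma D i j) (xi i) + nrm (area R n) (gamma D i j) (xi j)).

Variable K : E -> 'M[R]_n.

Definition Kinv (u : E -> E) : E -> E := fun x => u x *m invmx (K x).

Definition is_extension (b : flavour) T (lam : E -> R) (Rl : 'I_N -> hfield) :=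
  exists2 xi, is_projection b T lam xi &
  forall i, exists p r, [/\ Vh T i (Rl i), Wh T i p, SH i r &
    [/\ forall v, V0 T i v ->
          vip (sub D i) (Kinv (fld (Rl i))) (fld v) - (dvg v, p)_[i] = 0,
        forall w, Wh T i w -> (dvg (Rl i), w)_[i] - (cst r, w)_[i] = 0,
        forall q, SH i q -> (p, cst q)_[i] = 0 &
        {ae area R n, forall x, Gamma_ D i x -> trc (Rl i) x = xi i x}]].

(* [lam] is a mortar variable of [u]: [u] is the sum of an element of V_h^0
   and of an extension of [lam]. *)
Definition mortar_of (b : flavour) T (u : 'I_N -> hfield) (lam : E -> R) :=
  Lambda_h T lam /\
  exists u0 Rl, [/\ forall i, V0 T i (u0 i), is_extension b T lam Rl &
    forall i, u i = u0 i + Rl i].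

Definition Vspace (b : flavour) T : set ('I_N -> hfield) :=
  [set u | exists lam, mortar_of b T u lam].

Definition Wspace T : set ('I_N -> E -> R) := [set w | forall i, Wh T i (w i)].

Definition form_a (u v : 'I_N -> hfield) : R :=
  \sum_i vip (sub D i) (Kinv (fld (u i))) (fld (v i)).

Definition form_b (u : 'I_N -> hfield) (w : 'I_N -> E -> R) : R :=
  \sum_i (dvg (u i), w i)_[i].

Definition normV (u : 'I_N -> hfield) : R := \sum_i div_norm D i (u i).

Definition normW (w : 'I_N -> E -> R) : R :=
  Num.sqrt (\sum_i nrm (vol R n) (sub D i) (w i) ^+ 2).

Definition solution (b : flavour) T (f : E -> R) u p :=
  [/\ Vspace b T u, Wspace T p,
      forall v, Vspace b T v -> form_a u v - form_b v p = 0 &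
      forall w, Wspace T w -> form_b u w = \sum_i (f, w i)_[i]].

(* Functions that agree almost everywhere are identified. *)
Definition well_posed (b : flavour) T (f : E -> R) :=
  (exists u p, solution b T f u p) /\
  (forall u p u' p', solution b T f u p -> solution b T f u' p' ->
    normV (fun i => u i - u' i) = 0 /\ normW (fun i => p i - p' i) = 0).

Definition norm_Lambda (lam : E -> R) : R := nrm (area R n) (Gamma D) lam.

End Discretization.

(* Main.v *)
Require Import Defs.
From mathcomp Require Import all_boot all_order all_algebra.
From mathcomp Require Import all_classical all_reals all_analysis.
From mathcomp Require Import measurable_realfun.
From mathcomp Require Import ring lra.
Import Order.TTheory GRing.Theory Num.Theory.
Import numFieldNormedType.Exports.

(** Writing [V_h] as the fields of the broken space whose normal traces are the
    projection of some mortar function, existence and the bounds reduce to an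
    inf-sup condition for [b] on [V_h * W_h] that is uniform in the mesh.  The
    part of a pressure orthogonal to the constants on the interior subdomains is
    controlled by [V_h^0].  The constants are controlled by fields with constant
    flux [t i - t j] through each interface, which lie in [V_h] for both choices
    of the projection.  Their total fluxes out of the interior subdomains are
    given by the Laplacian of the adjacency graph of the subdomains; it is
    invertible, for otherwise some union of closed subdomains would have a
    boundary of zero surface measure, although every line of a fixed direction
    that starts in a small ball has to leave it.

    The mesh-independent fields with prescribed constant fluxes are taken from
    one admissible discretization (if there is none, the claim is void): their
    components are piecewise polynomials, hence in [L^s], and they can be
    interpolated in every other discretization. *)

Set Implicit Arguments.
Unset Strict Implicit.
Unset Printing Implicit Defensive.

Local Open Scope classical_set_scope.
Local Open Scope ring_scope.

(** * Finite-dimensional subspaces *)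

(** Functions that agree almost everywhere stay distinct here, so the inner products are only
    semidefinite and existence cannot be read off from injectivity. Every existence statement
    (projections, local extensions, coarse fluxes, the discrete problem) goes through one criterion:
    the load must vanish on the kernel of the bilinear form. This follows from Cauchy-Schwarz once
    the components of a kernel vector that the load sees have norm zero.

    No bound on the extension operator ever enters. Once the flux space is described by traces, test
    fields can be assembled by hand, and only the finitely many fields with unit flux through one
    interface need a bound uniform in the mesh. The inf-sup conditions do not give that bound; the
    interpolation operator does.

    Volume and area are Caratheodory restrictions of outer measures defined by covers, so
    measurability of subdomains and interfaces has to be earned first. The line argument becomes a
    statement about area by projection: a set of zero area casts a null shadow, so some nearby line
    of the given direction misses it. *)

Section Subspaces.
Variable R : realType.

Definition subspace (V : lmodType R) (S : set V) :=
  S 0 /\ forall a x y, S x -> S y -> S (a *: x + y).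

(** Linearity is asked on [S] only, because integrals are additive on integrable functions and not
    on arbitrary ones. *)
Definition linear_on (V : lmodType R) (S : set V) (f : V -> R) :=
  forall a x y, S x -> S y -> f (a *: x + y) = a * f x + f y.

Section Sub.
Variables (V : lmodType R) (S : set V).
Hypothesis subS : subspace S.

Lemma subspaceD x y : S x -> S y -> S (x + y).
Proof. by move=> Sx Sy; rewrite -[x]scale1r; apply: subS.2. Qed.

Lemma subspaceZ a x : S x -> S (a *: x).
Proof. by move=> Sx; rewrite -[_ *: _]addr0; apply: subS.2 => //; exact: subS.1. Qed.

Lemma subspaceB x y : S x -> S y -> S (x - y).
Proof. by move=> Sx Sy; rewrite addrC -scaleN1r; apply: subS.2. Qed.

Lemma subspace_sum (I : Type) (r : seq I) (P : pred I) (F : I -> V) :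
  (forall i, P i -> S (F i)) -> S (\sum_(i <- r | P i) F i).
Proof. by move=> SF; elim/big_ind: _ => //; [exact: subS.1|exact: subspaceD]. Qed.

Variable f : V -> R.
Hypothesis linf : linear_on S f.

Lemma linear_on0 : f 0 = 0.
Proof.
have := linf 1 subS.1 subS.1; rewrite scale1r addr0 mul1r => /eqP.
by rewrite addrC -subr_eq subrr => /eqP.
Qed.

Lemma linear_onD x y : S x -> S y -> f (x + y) = f x + f y.
Proof. by move=> Sx Sy; rewrite -[x in LHS]scale1r linf// mul1r. Qed.

Lemma linear_onZ a x : S x -> f (a *: x) = a * f x.
Proof.
by move=> Sx; rewrite -[_ *: _]addr0 linf ?linear_on0 ?addr0//; exact: subS.1.
Qed.

Lemma linear_onB x y : S x -> S y -> f (x - y) = f x - f y.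
Proof. by move=> Sx Sy; rewrite addrC -scaleN1r linf// mulN1r addrC. Qed.

Lemma linear_on_sum (I : Type) (r : seq I) (P : pred I) (F : I -> V) :
  (forall i, P i -> S (F i)) ->
  f (\sum_(i <- r | P i) F i) = \sum_(i <- r | P i) f (F i).
Proof.
move=> SF; suff [] : f (\sum_(i <- r | P i) F i) = \sum_(i <- r | P i) f (F i) /\
  S (\sum_(i <- r | P i) F i) by [].
elim/big_ind2: _ => //; first by split; [exact: linear_on0|exact: subS.1].
  by move=> x a y b [<- Sx] [<- Sy]; rewrite linear_onD//; split=> //; exact: subspaceD.
by move=> i Pi; split=> //; exact: SF.
Qed.

End Sub.

Lemma linear_onS (V : lmodType R) (S S' : set V) (f : V -> R) :
  S `<=` S' -> linear_on S' f -> linear_on S f.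
Proof. by move=> SS' lf a x y /SS' Sx /SS' Sy; exact: lf. Qed.

Section FiniteDim.
Variables (V : lmodType R) (S : set V).

Lemma fds_subspace : finite_dim_subspace S -> subspace S.
Proof.
move=> [m [e ->]]; split; first by exists (fun=> 0) => //; rewrite big1// => k; rewrite scale0r.
move=> a _ _ [c _ <-] [d _ <-]; exists (fun k => a * c k + d k) => //.
rewrite scaler_sumr -big_split/=; apply: eq_bigr => k _.
by rewrite scalerDl scalerA.
Qed.

(* In coordinates, the row [l] lies in the row space of the matrix of [B] as
   soon as it vanishes on the right kernel of that matrix. *)
Lemma fds_solvable (B : V -> V -> R) (l : V -> R) :
  finite_dim_subspace S ->
  (forall u, S u -> linear_on S (B u)) ->
  (forall v, S v -> linear_on S (B^~ v)) ->
  linear_on S l ->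
  (forall v, S v -> (forall u, S u -> B u v = 0) -> l v = 0) ->
  exists2 u, S u & forall v, S v -> B u v = l v.
Proof.
move=> fS; have sS := fds_subspace fS.
move: fS => [m [e SE]] linr linl ll ker.
have Se k : S (e k).
  rewrite SE; exists (fun k' => (k' == k)%:R) => //.
  rewrite (bigD1 k)//= eqxx scale1r big1 ?addr0// => i /negbTE ->.
  by rewrite scale0r.
have SZ c k : S (c *: e k) by exact: subspaceZ.
pose M : 'M[R]_m := \matrix_(i, j) B (e i) (e j).
pose L : 'rV[R]_m := \row_j l (e j).
have /submxP[C LE] : (L <= M)%MS.
  rewrite submxE; apply/eqP/rowP => k; rewrite !mxE.
  pose v := \sum_j cokermx M j k *: e j.
  have Sv : S v by apply: subspace_sum.
  rewrite -[RHS](ker v)//.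
    rewrite /v (linear_on_sum sS ll)//; apply: eq_bigr => j _.
    by rewrite [L _ _]mxE (linear_onZ sS ll)// mulrC.
  suff Be i : B (e i) v = 0.
    move=> u; rewrite SE => -[c _ <-].
    rewrite (linear_on_sum sS (linl _ Sv))// big1// => i _.
    by rewrite (linear_onZ sS (linl _ Sv))// Be mulr0.
  rewrite /v (linear_on_sum sS (linr _ (Se i)))//.
  transitivity ((M *m cokermx M) i k); last by rewrite mulmx_coker mxE.
  rewrite mxE; apply: eq_bigr => j _.
  by rewrite (linear_onZ sS (linr _ (Se i)))// [M _ _]mxE mulrC.
exists (\sum_i C 0 i *: e i); first exact: subspace_sum.
move=> v Sv; move: (Sv); rewrite {1}SE => -[d _ dE].
rewrite (linear_on_sum sS (linl _ Sv))// -dE (linear_on_sum sS ll)//.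
transitivity (\sum_i \sum_j C 0 i * M i j * d j).
  apply: eq_bigr => i _; rewrite dE (linear_onZ sS (linl _ Sv))//.
  rewrite -dE (linear_on_sum sS (linr _ (Se i)))// mulr_sumr.
  apply: eq_bigr => j _.
  by rewrite (linear_onZ sS (linr _ (Se i)))// mxE -mulrA [d j * _]mulrC.
rewrite exchange_big/=; apply: eq_bigr => j _.
rewrite (linear_onZ sS ll)// -mulr_suml mulrC; congr (_ * _).
by have /rowP/(_ j) := LE; rewrite !mxE => ->.
Qed.

(** The generators [e] may be dependent, so dimension is measured among coefficient vectors: a
    matrix [M] of maximal rank whose row space is mapped into [P] already reaches all of [P], since
    adjoining the coefficients of a missed vector would raise the rank. *)
Lemma fds_sub (P : set V) :
  finite_dim_subspace S -> P `<=` S -> subspace P -> finite_dim_subspace P.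
Proof.
move=> [m [e SE]] PS sP.
pose val (v : 'rV[R]_m) : V := \sum_k v 0 k *: e k.
have valD a u v : val (a *: u + v) = a *: val u + val v.
  rewrite /val scaler_sumr -big_split/=; apply: eq_bigr => k _.
  by rewrite !mxE scalerDl scalerA.
pose Q (M : 'M[R]_m) := forall v, (v <= M)%MS -> P (val v).
have Q0 : Q 0.
  move=> v /submx0null ->; rewrite /val big1; first exact: sP.1.
  by move=> k _; rewrite mxE scale0r.
pose r k := `[< exists2 M, Q M & \rank M = k >].
have exr : exists k, r k by exists 0%N; apply/asboolP; exists 0 => //; exact: mxrank0.
have ubr k : r k -> (k <= m)%N by move=> /asboolP[M _ <-]; exact: rank_leq_row.
case: (ex_maxnP exr ubr) => k /asboolP[M QM rM] maxr.
exists m, (fun i => val (row i M)); apply/seteqP; split=> [p Pp|_ [c _ <-]]; last first.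
  by apply: (subspace_sum sP) => i _; apply: (subspaceZ sP); apply: QM; exact: row_sub.
have := PS _ Pp; rewrite SE => -[c _ cE].
pose v : 'rV[R]_m := \row_k c k.
have vE : val v = p by rewrite /val -cE; apply: eq_bigr => i _; rewrite mxE.
have QMv : Q (M + <<v>>)%MS.
  move=> w /sub_addsmxP[[a b]/= ->].
  have -> : a *m M + b *m <<v>>%MS = 1 *: (a *m M) + b *m <<v>>%MS by rewrite scale1r.
  rewrite valD; apply: sP.2; first by apply: QM; exact: submxMl.
  have : (b *m <<v>>%MS <= v)%MS by apply: (submx_trans (submxMl _ _)); rewrite genmxE.
  move=> /sub_rVP[d ->]; rewrite -[d *: v]addr0 valD vE.
  by apply: sP.2 => //; apply: Q0; exact: sub0mx.
have vM : (v <= M)%MS.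
  have le : (\rank (M + <<v>>)%MS <= k)%N.
    by apply: maxr; apply/asboolP; exists (M + <<v>>)%MS.
  have := mxrank_leqif_sup (addsmxSl M <<v>>%MS).
  move=> [le1 eq1].
  have : (\rank M == \rank (M + <<v>>)%MS)%N by rewrite eqn_leq le1 rM le.
  rewrite eq1 => h; apply: (submx_trans _ h).
  by apply: (submx_trans _ (addsmxSr _ _)); rewrite genmxE.
have /submxP[a aE] := vM.
exists (fun i => a 0 i) => //; rewrite -vE aE.
rewrite /val; under eq_bigr do rewrite scaler_sumr.
rewrite exchange_big/=; apply: eq_bigr => j _; rewrite mxE scaler_suml.
by apply: eq_bigr => i _; rewrite mxE scalerA.
Qed.

End FiniteDim.

Lemma fds_image (V W : lmodType R) (S : set V) (f : V -> W) :
  (forall a x y, f (a *: x + y) = a *: f x + f y) ->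
  finite_dim_subspace S -> finite_dim_subspace (f @` S).
Proof.
move=> lf [m [e ->]]; exists m, (f \o e).
have f0 : f 0 = 0.
  have := lf 1 0 0; rewrite !scale1r addr0 => /eqP.
  by rewrite addrC -subr_eq subrr => /eqP.
have fS c : f (\sum_(k < m) c k *: e k) = \sum_(k < m) c k *: f (e k).
  rewrite (big_morph f (id1 := 0) (op1 := +%R))//.
    by apply: eq_bigr => k _; rewrite -[_ *: _]addr0 lf f0 addr0.
  by move=> x y; rewrite -[x in LHS]scale1r lf scale1r.
by apply/seteqP; split=> [_ [_ [c _ <-] <-]|_ [c _ <-]];
  [exists c|exists (\sum_k c k *: e k) => //; exists c].
Qed.

Lemma fds_pi (I : finType) (V : lmodType R) (S : I -> set V) :
  (forall i, finite_dim_subspace (S i)) ->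
  finite_dim_subspace [set u : I -> V | forall i, S i (u i)].
Proof.
move=> fS; pose m i := projT1 (cid (fS i)).
pose e i : 'I_(m i) -> V := projT1 (cid (projT2 (cid (fS i)))).
have SE i : S i = [set \sum_k c k *: e i k | c in [set: 'I_(m i) -> R]].
  exact: projT2 (cid (projT2 (cid (fS i)))).
(* One generator for each pair of a component and a generator of its space, extended by zero to the
   other components. *)
pose J : finType := {i : I & 'I_(m i)}.
pose b (t : J) : I -> V := fun i => if tag t == i then e (tag t) (tagged t) else 0.
pose tg i (k : 'I_(m i)) : J := existT (fun i => 'I_(m i)) i k.
suff -> : [set u : I -> V | forall i, S i (u i)] =
    [set \sum_t c t *: b t | c in [set: J -> R]].
  exists #|J|, (b \o enum_val); apply/seteqP; split=> [_ [c _ <-]|_ [c _ <-]].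
    exists (c \o enum_val) => //=.
    by rewrite [RHS](reindex_onto (@enum_val J xpredT) enum_rank)/=;
      [apply: eq_bigl => i; rewrite enum_valK eqxx|move=> *; exact: enum_rankK].
  exists (c \o enum_rank) => //=.
  rewrite (reindex_onto (@enum_val J xpredT) enum_rank)/=; last first.
    by move=> *; exact: enum_rankK.
  by apply: eq_big => i; rewrite ?enum_valK ?eqxx// => _; rewrite enum_valK.
have bE (c : J -> R) i : (\sum_t c t *: b t) i = \sum_k c (tg _ k) *: e i k.
  rewrite fct_sumE/=.
  rewrite [LHS](_ : _ = \sum_i' \sum_(k : 'I_(m i')) (c (tg _ k) *: b (tg _ k)) i); last first.
    by rewrite sig_big_dep/=; apply: eq_bigr => -[].
  rewrite (bigD1 i)//= [X in _ + X]big1 ?addr0; last first.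
    move=> i' /negbTE i'i; rewrite big1// => k _.
    by rewrite /b /= /GRing.scale /= i'i scaler0.
  by apply: eq_bigr => k _; rewrite /b /GRing.scale/= eqxx.
apply/seteqP; split=> [u /= Su|_ [c _ <-] i]; last first.
  by rewrite SE bE; exists (fun k => c (tg _ k)).
have {}Su i : exists c : 'I_(m i) -> R, \sum_k c k *: e i k = u i.
  by have := Su i; rewrite SE => -[c _ <-]; exists c.
exists (fun t => projT1 (cid (Su (tag t))) (tagged t)) => //.
by apply/funext => i; rewrite bE/=; case: cid.
Qed.

Lemma fds_prod (V W : lmodType R) (S : set V) (Q : set W) :
  finite_dim_subspace S -> finite_dim_subspace Q ->
  finite_dim_subspace (S `*` Q).
Proof.
move=> [m [e ->]] [p [f ->]].
pose b (t : 'I_m + 'I_p) : V * W := match t with inl k => (e k, 0) | inr k => (0, f k) end.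
exists (m + p)%N, (b \o @fintype.split m p).
have bE (c : 'I_(m + p) -> R) : \sum_k c k *: (b \o @fintype.split m p) k =
    (\sum_k c (lshift p k) *: e k, \sum_k c (rshift m k) *: f k).
  rewrite big_split_ord/=.
  under eq_bigr do rewrite (unsplitK (inl _))/=.
  under [X in _ + X]eq_bigr do rewrite (unsplitK (inr _))/=.
  apply/pair_equal_spec; split.
    rewrite [LHS]/= !(big_morph (@fst V W) (id1 := 0) (op1 := +%R))//=.
    by rewrite [X in _ + X]big1 ?addr0// => i _; rewrite scaler0.
  rewrite !(big_morph (@snd V W) (id1 := 0) (op1 := +%R))//=.
  by rewrite [X in X + _]big1 ?add0r// => i _; rewrite scaler0.
apply/seteqP; split=> [[_ _] /= [[c _ <-] [d _ <-]]|_ [c _ <-]].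
  exists (fun k => match fintype.split k with inl i => c i | inr i => d i end) => //.
  rewrite bE; congr pair; apply: eq_bigr => i _.
    by rewrite (unsplitK (inl _)).
  by rewrite (unsplitK (inr _)).
by rewrite bE; split=> /=; [exists (c \o lshift p)|exists (c \o @rshift m p)].
Qed.

End Subspaces.

(** * Measurability of open sets *)

Section Caratheodory.
Local Open Scope ereal_scope.
Variable R : realType.

(** Splitting every member of a cover of the union gives one cover of [A] and one of [B] at no extra
    cost. Three gauges are allowed because Hausdorff measure is a supremum over [delta], and the two
    summands are approached with different values of it. *)
Lemma mu_ext_superadditive d (T : measurableType d) (g1 g2 g : set T -> \bar R)
    (A B : set T) :
  (forall S, 0 <= g1 S) -> (forall S, 0 <= g2 S) ->
  (forall F, measurable F -> exists F1 F2, [/\ measurable F1, measurable F2,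
     F `&` A `<=` F1, F `&` B `<=` F2 & g1 F1 + g2 F2 <= g F]) ->
  mu_ext g1 A + mu_ext g2 B <= mu_ext g (A `|` B).
Proof.
move=> g10 g20 split; apply: le_ereal_inf_tmp => _ [F [mF cF] <-].
pose P k (G : set T * set T) := [/\ measurable G.1, measurable G.2,
     F k `&` A `<=` G.1, F k `&` B `<=` G.2 & g1 G.1 + g2 G.2 <= g (F k)].
have [G PG] : {G : nat -> set T * set T & forall k, P k (G k)}.
  apply: (@choice _ _ P) => k; have [F1 [F2 h]] := split _ (mF k).
  by exists (F1, F2).
apply: (@le_trans _ _ (\sum_(k <oo) (g1 (G k).1 + g2 (G k).2))); last first.
  apply: lee_nneseries => k _; first by rewrite adde_ge0.
  by case: (PG k).
rewrite nneseriesD; [|by move=> *; exact: g10|by move=> *; exact: g20].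
apply: leeD; apply: ereal_inf_lbound.
  exists (fun k => (G k).1) => //; split=> [k|x Ax]; first by case: (PG k).
  have [k _ Fkx] := cF x (or_introl Ax).
  by exists k => //; case: (PG k) => _ _ h _ _; exact: h.
exists (fun k => (G k).2) => //; split=> [k|x Bx]; first by case: (PG k).
have [k _ Fkx] := cF x (or_intror Bx).
by exists k => //; case: (PG k) => _ _ _ h _; exact: h.
Qed.

(* Caratheodory's criterion: among the layers [Q m] of [X] below the level [a],
   those with indices of equal parity are separated, hence the sum of their
   measures is bounded and its tails vanish. *)
Lemma separated_caratheodory (T : Type) (mu : {outer_measure set T -> \bar R})
    (f : T -> R) (a : R) :
  (forall A B e, (0 < e)%R -> (forall x y, A x -> B y -> (f x + e <= f y)%R) ->
    mu A + mu B <= mu (A `|` B)) ->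
  mu.-caratheodory [set x | (f x < a)%R].
Proof.
move=> sep; apply: le_caratheodory_measurable => X.
have [->|Xfin] := eqVneq (mu X) +oo; first by rewrite leey.
pose r (m : nat) : R := (a - m.+1%:R^-1)%R.
have rlt m : (r m < r m.+1)%R.
  by rewrite /r ltrD2l ltrN2 ltf_pV2 ?posrE ?ltr0n// ltr_nat.
pose A m := X `&` [set x | (f x < r m)%R].
pose Q m := A m.+1 `\` A m.
have muAX m : mu (A m) <= mu X by apply: le_outer_measure => x [].
(* This induction takes care of both parities at once: [A m] and [Q m.+1] are separated by the gap
   between [r m] and [r m.+1], so together they measure at most [A m.+2]. *)
have sumQ m : \sum_(0 <= i < m.+1) mu (Q i) <= mu (A m.+1) + mu (A m).
  elim: m => [|m IH].
    rewrite big_nat1; apply: (@le_trans _ _ (mu (A 1%N))).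
      by apply: le_outer_measure => x [].
    by rewrite leeDl// outer_measure_ge0.
  rewrite big_nat_recr//=; apply: le_trans (leeD2r _ IH) _.
  rewrite -addeA addeC; apply: leeD2r.
  apply: (le_trans (sep _ _ (r m.+1 - r m)%R _ _)).
  - by rewrite subr_gt0 rlt.
  - move=> x y [_ /= fx] [[Xy _] /not_andP[//|/negP]] /=.
    by rewrite -leNgt => fy; lra.
  - apply: le_outer_measure => x [[Xx fx]|[]//]; split=> //=.
    by apply: lt_trans (rlt _); apply: lt_trans (rlt _).
have Qfin : \sum_(0 <= i <oo) mu (Q i) < +oo.
  apply: (@le_lt_trans _ _ (mu X + mu X)); last first.
    by rewrite lte_add_pinfty// ltey.
  apply: lime_le; first by apply: is_cvg_nneseries => *; exact: outer_measure_ge0.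
  near=> m; rewrite -[m]prednK; last by near: m; exact: nbhs_infty_gt.
  by apply: (le_trans (sumQ _)); exact: leeD.
apply/lee_addgt0Pr => e e0.
have := @nneseries_tail_cvg R (mu \o Q) xpredT Qfin (fun=> fun=> outer_measure_ge0 _ _).
move=> /fine_cvgP[_] /cvgrPdist_lt /(_ _ e0) [m _ /(_ m (leqnn m))] /=.
rewrite sub0r normrN => tail_lt.
have tail0 : 0 <= \sum_(m <= i <oo) mu (Q i).
  by apply: nneseries_ge0 => *; exact: outer_measure_ge0.
have tail_fin : \sum_(m <= i <oo) mu (Q i) < +oo.
  apply: le_lt_trans Qfin.
  rewrite [leRHS](nneseries_split _ m)//; last by move=> *; exact: outer_measure_ge0.
  rewrite add0n leeDr//; apply: sume_ge0 => *; exact: outer_measure_ge0.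
have tail_le : \sum_(m <= i <oo) mu (Q i) <= e%:E.
  rewrite -[leLHS]fineK ?ge0_fin_numE// lee_fin.
  by apply: le_trans (ltW tail_lt); exact: ler_norm.
have XE : X `&` [set x | (f x < a)%R] `<=` A m `|` \bigcup_(i in ~` `I_m) Q i.
  move=> x [Xx /= fxa].
  have [Am|nAm] := pselect (A m x); [by left|right].
  have ex : exists k, (f x < r k)%R.
    have d0 : (0 < a - f x)%R by rewrite subr_gt0.
    have := near_infty_natSinv_lt (PosNum d0) => -[k _ /(_ k (leqnn k))] /= lt.
    have {}lt : (k.+1%:R^-1 < a - f x)%R := lt.
    by exists k; rewrite /r ltrBrDl -ltrBrDr.
  case: (ex_minnP ex) => k fk kmin.
  have mk : (m < k)%N.
    rewrite ltnNge; apply/negP => km; apply: nAm; split=> //=.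
    apply: (lt_le_trans fk); rewrite /r lerD2l lerN2 lef_pV2 ?posrE ?ltr0n//.
    by rewrite ler_nat.
  exists k.-1; first by apply/negP; rewrite -leqNgt -ltnS prednK// (leq_ltn_trans _ mk).
  have kE : k.-1.+1 = k by rewrite prednK// (leq_ltn_trans _ mk).
  split; first by rewrite kE.
  by move=> -[_ /= /kmin]; rewrite -ltnS kE ltnn.
apply: (@le_trans _ _ (mu (A m) + \sum_(m <= i <oo) mu (Q i) +
    mu (X `&` ~` [set x | (f x < a)%R]))).
  apply: leeD2r; apply: (le_trans (le_outer_measure mu _ _ XE)).
  apply: (le_trans (outer_measureU2 _ _ _)); apply: leeD2l.
  exact: outer_measure_sigma_subadditive_tail.
rewrite addeAC; apply: leeD => //.
apply: (le_trans (sep _ _ (m.+1%:R^-1)%R _ _)).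
- by rewrite invr_gt0 ltr0n.
- move=> x y [_ /= fx] [_ /= /negP]; rewrite -leNgt => fy; move: fx.
  by rewrite /r ltrBrDr => /ltW fx; apply: le_trans fy.
- by apply: le_outer_measure => x [[]//|[]//].
Unshelve. all: by end_near. Qed.

End Caratheodory.

Section OpenMeasurable.
Variables (R : realType) (n : nat).
Local Notation E := 'rV[R]_n.
Local Notation Borel := (g_sigma_algebraType (@open E)).

Lemma open_coord_lt (k : 'I_n) (t : R) : open [set x : E | x 0 k < t].
Proof.
apply: (@open_comp _ _ (fun x : E => x 0 k) [set y | y < t]); last exact: open_lt.
by move=> x _; exact: coord_continuous.
Qed.

Lemma Borel_coord_lt (k : 'I_n) (t : R) :
  measurable ([set x : E | x 0 k < t] : set Borel).
Proof. by apply: sub_sigma_algebra; exact: open_coord_lt. Qed.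

Lemma box_gauge_le (S : set Borel) (a b : E) :
  (forall k, a 0 k <= b 0 k) -> S `<=` box a b ->
  (box_gauge S <= (\prod_k (b 0 k - a 0 k))%:E)%E.
Proof.
move=> ab Sab; rewrite /box_gauge; case: asboolP => _.
  by rewrite lee_fin; apply: prodr_ge0 => k _; rewrite subr_ge0.
by apply: ereal_inf_lbound => /=; exists (a, b).
Qed.

(** A hyperplane orthogonal to an axis cuts an enclosing box into two boxes whose volumes add up to
    that of the box. *)
Lemma vol_caratheodory_coord_lt (k : 'I_n) (t : R) :
  (lebesgue_outer_measure R n).-caratheodory [set x : E | x 0 k < t].
Proof.
apply: le_caratheodory_measurable => X.
rewrite [leRHS](_ : _ = mu_ext (@box_gauge R n)
  ((X `&` [set x : E | x 0 k < t]) `|` (X `&` ~` [set x : E | x 0 k < t]))); last first.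
  by rewrite -setIUr setUCr setIT.
apply: mu_ext_superadditive; [exact: box_gauge_ge0|exact: box_gauge_ge0|].
move=> F mF; have mt := Borel_coord_lt k t.
set H := [set x : E | x 0 k < t] in mt *.
exists (F `&` H), (F `&` ~` H).
split; [exact: measurableI|by apply: measurableI => //; exact: measurableC| | |].
- by move=> x [? []].
- by move=> x [? []].
rewrite {3}/box_gauge; case: asboolP => [->|F0].
  by rewrite !set0I box_gauge0 adde0.
apply: le_ereal_inf_tmp => _ /= [[a b] /= [ab Fab] <-].
(* The level [t] clamped to the [k]-th side of the box, so that both halves are boxes, possibly
   degenerate, even if the hyperplane misses it. *)
pose t' := Num.min (b 0 k) (Num.max (a 0 k) t).
have at' : a 0 k <= t' by rewrite le_min ab le_max lexx.
have t'b : t' <= b 0 k by rewrite ge_min lexx.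
pose b1 : E := \row_j if j == k then t' else b 0 j.
pose a1 : E := \row_j if j == k then t' else a 0 j.
have le1 : (box_gauge (F `&` H) <=
    (\prod_j (b1 0 j - a 0 j))%:E)%E.
  apply: box_gauge_le => [j|x [Fx /= xt] j].
    by rewrite mxE; case: eqP => [->|].
  rewrite mxE; have /andP[ax xb] := Fab _ Fx j; rewrite ax/=.
  case: eqP => [jk|//]; rewrite jk in ax xb *.
  by rewrite le_min xb le_max (ltW xt) orbT.
have le2 : (box_gauge (F `&` ~` H) <=
    (\prod_j (b 0 j - a1 0 j))%:E)%E.
  apply: box_gauge_le => [j|x [Fx /= /negP xt] j].
    by rewrite mxE; case: eqP => [->|].
  rewrite -leNgt in xt.
  rewrite mxE; have /andP[ax xb] := Fab _ Fx j; rewrite xb andbT.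
  case: eqP => [jk|//]; rewrite jk in ax xb *.
  by rewrite ge_min ge_max ax xt orbT.
apply: (le_trans (leeD le1 le2)); rewrite -EFinD lee_fin.
rewrite (bigD1 k)//= [X in _ + X](bigD1 k)//= [leRHS](bigD1 k)//=.
rewrite !mxE eqxx.
under eq_bigr => j jk do rewrite mxE (negbTE jk).
under [X in _ + _ * X]eq_bigr => j jk do rewrite mxE (negbTE jk).
by rewrite -mulrDl addrC addrA subrK.
Qed.

Lemma normr_coord_le_enorm (x : E) k : `|x 0 k| <= enorm x.
Proof.
rewrite -sqrtr_sqr /enorm ler_wsqrtr// /dotp (bigD1 k)//= expr2 lerDl.
by apply: sumr_ge0 => j _; rewrite -expr2 sqr_ge0.
Qed.

Lemma hausdorff_gauge_le (m : nat) (d d' : R) (S : set Borel) : d <= d' ->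
  (hausdorff_gauge m d' S <= hausdorff_gauge m d S)%E.
Proof.
move=> dd'; rewrite /hausdorff_gauge; case: asboolP => // _.
have [Sd|Sd] := boolP (diam S <= d%:E)%E; last by rewrite leey.
by rewrite (le_trans Sd) ?lee_fin.
Qed.

(** A set of diameter at most [e / 2] cannot meet both [A] and [B], so each member of a fine cover
    serves only one of them. *)
Lemma hausdorff_separated (m : nat) (k : 'I_n) (A B : set Borel) (e : R) :
  0 < e -> (forall x y : E, A x -> B y -> x 0 k + e <= y 0 k) ->
  (hausdorff_outer m A + hausdorff_outer m B <= hausdorff_outer m (A `|` B))%E.
Proof.
move=> e0 AB.
have key d1 d2 : 0 < d1 -> 0 < d2 ->
    (mu_ext (hausdorff_gauge m d1) A + mu_ext (hausdorff_gauge m d2) B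
     <= hausdorff_outer m (A `|` B))%E.
  move=> d10 d20; pose d := Num.min (e / 2) (Num.min d1 d2).
  have d0 : 0 < d by rewrite !lt_min d10 d20 divr_gt0.
  apply: (@le_trans _ _ (mu_ext (hausdorff_gauge m d) (A `|` B))); last first.
    by apply: ereal_sup_ubound; exists d.
  apply: mu_ext_superadditive; [exact: hausdorff_gauge_ge0|exact: hausdorff_gauge_ge0|].
  move=> F mF.
  have [Fd|Fd] := boolP (hausdorff_gauge m d F == +oo%E).
    by exists F, F; split => //; [move=> x []..|rewrite (eqP Fd) leey].
  have g1 : (hausdorff_gauge m d1 F <= hausdorff_gauge m d F)%E.
    by apply: hausdorff_gauge_le; rewrite /d !ge_min lexx !orbT.
  have g2 : (hausdorff_gauge m d2 F <= hausdorff_gauge m d F)%E.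
    by apply: hausdorff_gauge_le; rewrite /d !ge_min lexx !orbT.
  have [FA|FA] := pselect (F `&` A = set0).
    exists set0, F; split => //; first by rewrite FA.
    by rewrite hausdorff_gauge0 add0e.
  exists F, set0; split => //; last by rewrite hausdorff_gauge0 adde0.
  move=> y [Fy By].
  have /set0P[x [Fx Ax]] : F `&` A != set0 by apply/eqP.
  move: Fd; rewrite /hausdorff_gauge; case: asboolP => [F0|_].
    by exfalso; rewrite F0 in Fx.
  case: ifPn => // Fd _; exfalso.
  have : ((enorm (y - x))%:E <= d%:E)%E.
    apply: le_trans Fd; apply: ereal_sup_ubound; exists (y, x) => //.
  rewrite lee_fin => yxd; have := AB _ _ Ax By.
  have := normr_coord_le_enorm (y - x) k; rewrite !mxE => h1.
  have h2 := ler_norm (y 0 k - x 0 k).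
  have : d <= e / 2 by rewrite /d ge_min lexx.
  by move=> h3 h4; lra.
(* The two suprema over [delta] are taken one after the other; each time the other summand is moved
   across, which requires it to be finite. *)
have [->|fin] := eqVneq (hausdorff_outer m (A `|` B)) +oo%E; first by rewrite leey.
have geA : (hausdorff_outer m A <= hausdorff_outer m (A `|` B))%E.
  by apply: le_hausdorff_outer => x; left.
have finA : hausdorff_outer m A \is a fin_num.
  by rewrite ge0_fin_numE ?hausdorff_outer_ge0// (le_lt_trans geA)// ltey.
rewrite addeC -leeBrDr//; apply: ge_ereal_sup => _ [d2 /= d20 <-].
rewrite leeBrDr// addeC.
have geB : (mu_ext (hausdorff_gauge m d2) B <= hausdorff_outer m (A `|` B))%E.
  apply: (@le_trans _ _ (mu_ext (hausdorff_gauge m d2) (A `|` B))).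
    by apply: le_mu_ext => x; right.
  by apply: ereal_sup_ubound; exists d2.
have finB : mu_ext (hausdorff_gauge m d2) B \is a fin_num.
  rewrite ge0_fin_numE ?mu_ext_ge0//; last by move=> S; exact: hausdorff_gauge_ge0.
  by rewrite (le_lt_trans geB)// ltey.
rewrite -leeBrDr//; apply: ge_ereal_sup => _ [d1 /= d10 <-].
by rewrite leeBrDr//; exact: key.
Qed.

Lemma area_caratheodory_coord_lt (k : 'I_n) (t : R) m :
  (hausdorff_outer_measure R n m).-caratheodory [set x : E | x 0 k < t].
Proof.
apply: (@separated_caratheodory _ _ _ (fun x : E => x 0 k)) => A B e e0 AB.
exact: hausdorff_separated AB.
Qed.

(** An open set is a countable union of boxes with rational corners, and these are finite
    intersections of coordinate half-spaces and complements of such. Stated for any outer measure,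
    it serves volume and area alike. *)
Lemma open_caratheodory (mu : {outer_measure set Borel -> \bar R}) (U : set E) :
  (forall k t, mu.-caratheodory [set x : E | x 0 k < t]) ->
  open U -> mu.-caratheodory U.
Proof.
move=> mlt oU; rewrite -[mu.-caratheodory]/(mu.-cara.-measurable).
pose F (pq : {ffun 'I_n -> rat} * {ffun 'I_n -> rat}) : set (caratheodory_type mu) :=
  \bigcap_(k in [set: 'I_n]) [set x : E | ratr (pq.1 k) <= x 0 k < ratr (pq.2 k)].
pose G pq := if `[< F pq `<=` U >] then F pq else set0.
have mF pq : measurable (F pq).
  apply: fin_bigcap_measurable => // k _.
  rewrite [X in measurable X](_ : _ = [set x : E | x 0 k < ratr (pq.2 k)] `&`
     ~` [set x : E | x 0 k < ratr (pq.1 k)]); last first.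
    apply/seteqP; split=> x /=; first by move=> /andP[+ ->]; split=> //; apply/negP; rewrite -leNgt.
    by move=> [-> /negP]; rewrite -leNgt => ->.
  by apply: measurableI; [exact: mlt|apply: measurableC; exact: mlt].
rewrite (_ : U = \bigcup_pq G pq).
  apply: countable_bigcupT_measurable => //.
  by rewrite /G => pq; case: asboolP.
apply/seteqP; split=> [x Ux|x [pq _]]; last first.
  by rewrite /G; case: asboolP => // FU Fx; exact: FU.
have : nbhs x U by exact: open_nbhs_nbhs.
move=> /nbhs_ballP[e /= e0 eU].
have ratp y : {q : rat | y - e < ratr q < y}.
  by apply/cid; have [|q] := @rat_in_itvoo R (y - e) y; [lra|rewrite in_itv/=; exists q].
have ratq y : {q : rat | y < ratr q < y + e}.
  by apply/cid; have [|q] := @rat_in_itvoo R y (y + e); [lra|rewrite in_itv/=; exists q].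
pose p : {ffun 'I_n -> rat} := [ffun k => projT1 (ratp (x 0 k))].
pose q : {ffun 'I_n -> rat} := [ffun k => projT1 (ratq (x 0 k))].
have pE k : x 0 k - e < ratr (p k) < x 0 k by rewrite ffunE; exact: projT2 (ratp _).
have qE k : x 0 k < ratr (q k) < x 0 k + e by rewrite ffunE; exact: projT2 (ratq _).
exists (p, q) => //; rewrite /G; case: asboolP => [_ k _ /=|[]].
  by have /andP[_ /ltW ->] := pE k; have /andP[-> _] := qE k.
move=> y Fy; apply: eU; split=> // i j; rewrite (ord1 i).
have /= := Fy j I; have := pE j; have := qE j.
rewrite /ball/= /ball_/= => /andP[h1 h2] /andP[h3 h4] /andP[h5 h6].
by rewrite ltr_norml; apply/andP; split; lra.
Qed.

Lemma vol_measurable_open (U : set E) : open U ->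
  measurable (U : set (caratheodory_type (lebesgue_outer_measure R n))).
Proof. by apply: open_caratheodory => k t; exact: vol_caratheodory_coord_lt. Qed.

Lemma area_measurable_open (U : set E) : open U ->
  measurable (U : set (caratheodory_type (hausdorff_outer_measure R n n.-1))).
Proof. by apply: open_caratheodory => k t; exact: area_caratheodory_coord_lt. Qed.

Lemma area_measurable_boundary (A : set E) :
  measurable (boundary A : set (caratheodory_type (hausdorff_outer_measure R n n.-1))).
Proof.
rewrite /boundary; apply: measurableD.
  rewrite -[closure A]setCK; apply: measurableC; apply: area_measurable_open.
  by apply: closed_openC; exact: closed_closure.
by apply: area_measurable_open; exact: open_interior.
Qed.

End OpenMeasurable.

(** * Square-integrable functions *)

Section SemiInner.
Variables (R : realType) (V : lmodType R) (S : set V) (B : V -> V -> R).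

(** Definiteness is left out on purpose: a function that vanishes almost everywhere has norm zero
    without being zero. *)
Definition semi_inner :=
  [/\ subspace S, forall x y, B x y = B y x,
      forall x, S x -> linear_on S (B x) & forall x, S x -> 0 <= B x x].

Hypothesis sB : semi_inner.
Let subS : subspace S. Proof. by case: sB. Qed.
Let symB x y : B x y = B y x. Proof. by case: sB. Qed.
Let linB x : S x -> linear_on S (B x). Proof. by case: sB => _ _ + _ => /[apply]. Qed.
Let B0 x : S x -> 0 <= B x x. Proof. by case: sB => _ _ _; apply. Qed.

Local Notation N x := (Num.sqrt (B x x)).

Lemma semi_inner_expand a x y : S x -> S y ->
  B (a *: x + y) (a *: x + y) = a ^+ 2 * B x x + 2 * a * B x y + B y y.
Proof.
move=> Sx Sy; have Sxy : S (a *: x + y) by exact: subS.2.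
rewrite linB// ![B (a *: x + y) _]symB !linB//.
by rewrite (symB y x); ring.
Qed.

Lemma semi_inner_cs x y : S x -> S y -> `|B x y| <= N x * N y.
Proof.
move=> Sx Sy; rewrite -sqrtrM ?B0// -sqrtr_sqr ler_wsqrtr//.
have key t : 0 <= t ^+ 2 * B x x + 2 * t * B x y + B y y.
  by rewrite -semi_inner_expand//; apply: B0; exact: subS.2.
have [xx0|xxn0] := eqVneq (B x x) 0.
  rewrite xx0 mul0r; have [->|xyn0] := eqVneq (B x y) 0; first by rewrite expr0n.
  (* With [B x x = 0] the quadratic is affine in [t]; this [t] would give it the value -1. *)
  have := key (- (B y y + 1) / (2 * B x y)); rewrite xx0 mulr0 add0r.
  rewrite (_ : 2 * _ * _ = - (B y y + 1)); first by lra.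
  by field.
have xx0 : 0 < B x x by rewrite lt_neqAle eq_sym xxn0 B0.
have := key (- B x y / B x x).
rewrite (_ : _ + _ + _ = (B x x * B y y - B x y ^+ 2) / B x x); last by field.
by rewrite pmulr_lge0 ?invr_gt0// subr_ge0.
Qed.

Lemma semi_inner_normZ a x : S x -> N (a *: x) = `|a| * N x.
Proof.
move=> Sx; have := semi_inner_expand a Sx subS.1.
rewrite !addr0 => ->; have h := linB Sx.
rewrite (linear_on0 subS h) (linear_on0 subS (linB subS.1)) mulr0 !addr0.
by rewrite sqrtrM ?sqr_ge0// sqrtr_sqr.
Qed.

Lemma semi_inner_triangle x y : S x -> S y -> N (x + y) <= N x + N y.
Proof.
move=> Sx Sy; have := semi_inner_expand 1 Sx Sy; rewrite scale1r => ->.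
rewrite -[leRHS]ger0_norm ?addr_ge0// -sqrtr_sqr ler_wsqrtr//.
rewrite sqrrD !sqr_sqrtr ?B0// expr1n mul1r mulr1 lerD2r lerD2l.
by have := semi_inner_cs Sx Sy; have := ler_norm (B x y); lra.
Qed.

Lemma semi_inner_triangle_sum (I : finType) (F : I -> V) :
  (forall i, S (F i)) -> N (\sum_i F i) <= \sum_i N (F i).
Proof.
move=> SF; suff [] : N (\sum_i F i) <= \sum_i N (F i) /\ S (\sum_i F i) by [].
elim/big_ind2: _ => //.
  by split; [rewrite (linear_on0 subS (linB subS.1)) sqrtr0|exact: subS.1].
move=> x a y b [xa Sx] [yb Sy]; split; last exact: subspaceD.
by apply: le_trans (semi_inner_triangle Sx Sy) _; exact: lerD.
Qed.

Lemma semi_inner_sq x : S x -> N x ^+ 2 = B x x.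
Proof. by move=> Sx; rewrite sqr_sqrtr// B0. Qed.

(** A consequence of Cauchy-Schwarz that stands in for definiteness in the kernel computations
    below. *)
Lemma semi_inner_null x y : S x -> S y -> N x = 0 -> B x y = 0.
Proof.
move=> Sx Sy Nx; apply/eqP; rewrite -normr_le0.
by have := semi_inner_cs Sx Sy; rewrite Nx mul0r.
Qed.

End SemiInner.

Section L2Theory.
Context d (T : measurableType d) (R : realType).
Variables (mu : {measure set T -> \bar R}) (D : set T).
Hypothesis mD : measurable D.
Local Notation L2 := (L2 mu D).
Local Notation ip := (ip mu D).

Lemma integrable_comb a (f g : T -> R) :
  mu.-integrable D (EFin \o f) -> mu.-integrable D (EFin \o g) ->
  mu.-integrable D (EFin \o (fun x => a * f x + g x)).
Proof. by move=> fi gi; exact: (integrableD mD (integrableZl mD a fi) gi). Qed.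

Lemma L2_prod (f g : T -> R) : L2 f -> L2 g ->
  mu.-integrable D (EFin \o (fun x => f x * g x)).
Proof.
move=> [mf if2] [mg ig2].
apply: (@le_integrable _ _ _ mu D mD _ (EFin \o (fun x => f x ^+ 2 + g x ^+ 2))).
- by apply/measurable_EFinP; exact: measurable_funM.
- move=> x Dx /=; rewrite lee_fin [leRHS]ger0_norm ?addr_ge0 ?sqr_ge0// normrM.
  have := sqr_ge0 (`|f x| - `|g x|); rewrite sqrrB !real_normK ?num_real//.
  have := sqr_ge0 (`|f x| + `|g x|); rewrite sqrrD !real_normK ?num_real//.
  by lra.
- exact: (integrableD mD if2 ig2).
Qed.

Lemma L2_subspace : subspace [set f : T -> R | L2 f].
Proof.
split.
  split; first exact: measurable_cst.
  rewrite (_ : _ \o _ = cst 0%E); first exact: integrable0.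
  by apply/funext => x /=; rewrite expr0n.
move=> a f g L2f L2g; have [mf if2] := L2f; have [mg ig2] := L2g.
split.
  by apply: measurable_funD => //; apply: measurable_funM => //; exact: measurable_cst.
have := integrable_comb (a ^+ 2) if2 (integrable_comb (2 * a) (L2_prod L2f L2g) ig2).
apply: eq_integrable => // x _ /=; congr EFin; rewrite [(_ + g) x](_ : _ = a * f x + g x)//; ring.
Qed.

(** Completeness of the measure is what carries measurability over to [g]. *)
Lemma L2_ae (f g : T -> R) : measure_is_complete mu ->
  {ae mu, forall x, D x -> f x = g x} -> L2 f -> L2 g.
Proof.
move=> cmu fg [mf if2].
have mg : measurable_fun D g.
  apply/measurable_EFinP; apply: (ae_measurable_fun cmu (f := EFin \o f)).
    by apply: filterS fg => x fg Dx /=; rewrite fg.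
  exact/measurable_EFinP.
split=> //; apply/integrableP; split.
  by apply/measurable_EFinP; exact: measurable_funX.
move/integrableP : if2 => [mf2]; apply: le_lt_trans.
rewrite le_eqVlt; apply/orP; left; apply/eqP; apply: ae_eq_integral => //.
- by apply: measurableT_comp => //; apply/measurable_EFinP; exact: measurable_funX.
- by apply: measurableT_comp.
- by apply: filterS fg => x fg Dx /=; rewrite fg.
Qed.

Lemma ip_linear (f : T -> R) : L2 f -> linear_on [set f | L2 f] (ip f).
Proof.
move=> L2f a g h L2g L2h; rewrite /ip.
transitivity (\int[mu]_(x in D) (a * (f x * g x) + f x * h x)).
  by apply: eq_Rintegral => x _; rewrite [(_ + h) x](_ : _ = a * g x + h x)//; ring.
rewrite RintegralD//; last exact: L2_prod.
  by rewrite RintegralZl//; exact: L2_prod.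
exact: (integrableZl mD a (L2_prod L2f L2g)).
Qed.

Lemma ipC (f g : T -> R) : ip f g = ip g f.
Proof. by rewrite /ip; apply: eq_Rintegral => x _; rewrite mulrC. Qed.

Lemma ip_ge0 (f : T -> R) : 0 <= ip f f.
Proof. by apply: Rintegral_ge0 => x _; rewrite -expr2 sqr_ge0. Qed.

Lemma ip_semi_inner : semi_inner [set f : T -> R | L2 f] ip.
Proof.
split; [exact: L2_subspace|exact: ipC|exact: ip_linear|by move=> f _; exact: ip_ge0].
Qed.

Lemma Rintegral_ae (f g : T -> R) : measurable_fun D f -> measurable_fun D g ->
  {ae mu, forall x, D x -> f x = g x} ->
  \int[mu]_(x in D) f x = \int[mu]_(x in D) g x.
Proof.
move=> mf mg fg; rewrite /Rintegral; congr fine; apply: ae_eq_integral => //.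
- exact/measurable_EFinP.
- exact/measurable_EFinP.
- by apply: filterS fg => x fg Dx /=; rewrite fg.
Qed.

Lemma ip_ae (f f' g : T -> R) : L2 f -> L2 f' -> L2 g ->
  {ae mu, forall x, D x -> f x = f' x} -> ip f g = ip f' g.
Proof.
move=> [mf _] [mf' _] [mg _] ff'; apply: Rintegral_ae.
- exact: measurable_funM.
- exact: measurable_funM.
- by apply: filterS ff' => x ff' Dx; rewrite ff'.
Qed.

Lemma nrm_ge0 (f : T -> R) : 0 <= nrm mu D f.
Proof. exact: sqrtr_ge0. Qed.

Lemma nrm_ae (f g : T -> R) : L2 f -> L2 g ->
  {ae mu, forall x, D x -> f x = g x} -> nrm mu D f = nrm mu D g.
Proof.
move=> L2f L2g fg; rewrite /nrm (ip_ae L2f L2g L2f fg) ipC.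
by rewrite (ip_ae L2f L2g L2g fg).
Qed.

End L2Theory.

Lemma L2_subset d (T : measurableType d) (R : realType)
    (mu : {measure set T -> \bar R}) (A D : set T) (f : T -> R) :
  measurable A -> measurable D -> A `<=` D -> L2 mu D f -> L2 mu A f.
Proof.
move=> mA mD AD [mf if2]; split; first exact: measurable_funS mf.
exact: integrableS if2.
Qed.

Lemma nrm_subset d (T : measurableType d) (R : realType)
    (mu : {measure set T -> \bar R}) (A D : set T) (f : T -> R) :
  measurable A -> measurable D -> A `<=` D -> L2 mu D f ->
  nrm mu A f <= nrm mu D f.
Proof.
move=> mA mD AD L2f; rewrite /nrm ler_wsqrtr// /ip /Rintegral fine_le//.
- by apply: integrable_fin_num => //; apply: L2_prod => //; exact: L2_subset L2f.
- by apply: integrable_fin_num => //; exact: L2_prod.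
- apply: ge0_subset_integral => //; last by move=> x _; rewrite lee_fin -expr2 sqr_ge0.
  by apply/measurable_EFinP; apply: measurable_funM; case: L2f.
Qed.

(* The type of points of [vol] and [area] hides the filter instance. *)
Section AlmostEverywhere.
Variables (R : realType) (n : nat).
Implicit Types P Q : 'rV[R]_n -> Prop.

Lemma area_aeS P Q : (forall x, P x -> Q x) ->
  {ae area R n, forall x, P x} -> {ae area R n, forall x, Q x}.
Proof. by move=> PQ; apply: (@filterS _ _ (ae_filter_ringOfSetsType _)) => x; exact: PQ. Qed.

Lemma area_aeI P Q : {ae area R n, forall x, P x} -> {ae area R n, forall x, Q x} ->
  {ae area R n, forall x, P x /\ Q x}.
Proof. exact: (@filterI _ _ (ae_filter_ringOfSetsType _)). Qed.

Lemma area_aeW P : (forall x, P x) -> {ae area R n, forall x, P x}.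
Proof. by move=> PT; apply: (@nearW _ _ _ (ae_filter_ringOfSetsType _)). Qed.

Lemma area_ae_forall (I : finType) (P : I -> 'rV[R]_n -> Prop) :
  (forall i, {ae area R n, forall x, P i x}) -> {ae area R n, forall x, forall i, P i x}.
Proof. by move=> h; apply: filter_forall. Qed.

Lemma vol_aeS P Q : (forall x, P x -> Q x) ->
  {ae vol R n, forall x, P x} -> {ae vol R n, forall x, Q x}.
Proof. by move=> PQ; apply: (@filterS _ _ (ae_filter_ringOfSetsType _)) => x; exact: PQ. Qed.

Lemma vol_aeI P Q : {ae vol R n, forall x, P x} -> {ae vol R n, forall x, Q x} ->
  {ae vol R n, forall x, P x /\ Q x}.
Proof. exact: (@filterI _ _ (ae_filter_ringOfSetsType _)). Qed.

Lemma vol_ae_forall (I : finType) (P : I -> 'rV[R]_n -> Prop) :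
  (forall i, {ae vol R n, forall x, P i x}) -> {ae vol R n, forall x, forall i, P i x}.
Proof. by move=> h; apply: filter_forall. Qed.

End AlmostEverywhere.

(** * Pointwise and integrated estimates for the inverse tensor *)

Section Dotp.
Variables (R : realType) (n : nat).
Local Notation E := 'rV[R]_n.
Implicit Types (x y u v : E) (M : 'M[R]_n).

Lemma dotpC x y : dotp x y = dotp y x.
Proof. by apply: eq_bigr => k _; rewrite mulrC. Qed.

Lemma dotp_linear x : linear_on setT (dotp x).
Proof.
move=> a y z _ _; rewrite /dotp mulr_sumr -big_split/=; apply: eq_bigr => k _.
by rewrite !mxE; ring.
Qed.

Lemma dotp_ge0 x : 0 <= dotp x x.
Proof. by apply: sumr_ge0 => k _; rewrite -expr2 sqr_ge0. Qed.

Lemma dotp_eq0 x : dotp x x = 0 -> x = 0.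
Proof.
move=> /eqP; rewrite psumr_eq0; last by move=> k _; rewrite -expr2 sqr_ge0.
move=> /allP x0; apply/rowP => k; rewrite mxE; apply/eqP.
by have := x0 k (mem_index_enum _); rewrite -expr2 expf_eq0.
Qed.

Lemma dotp_semi_inner : semi_inner [set: E] (@dotp R n).
Proof.
by split; [split|exact: dotpC|move=> x _; exact: dotp_linear|move=> x _; exact: dotp_ge0].
Qed.

Lemma dotp_cs x y : dotp x y <= enorm x * enorm y.
Proof. exact: le_trans (ler_norm _) (semi_inner_cs dotp_semi_inner (I : setT x) (I : setT y)). Qed.

Lemma enorm_sq x : enorm x ^+ 2 = dotp x x.
Proof. by rewrite sqr_sqrtr// dotp_ge0. Qed.

Lemma dotp_mulmxT M x y : dotp (x *m M) y = dotp x (y *m M^T).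
Proof.
rewrite /dotp; under eq_bigr do rewrite mxE mulr_suml.
rewrite exchange_big/=; apply: eq_bigr => k _; rewrite mxE mulr_sumr.
by apply: eq_bigr => l _; rewrite mxE; ring.
Qed.

Section Tensor.
Variables (M : 'M[R]_n) (kmin kmax : R).
Hypotheses (kmin0 : 0 < kmin) (kmax0 : 0 < kmax) (symM : M^T = M)
  (ellM : forall xi, kmin * enorm xi ^+ 2 <= dotp (xi *m M) xi <= kmax * enorm xi ^+ 2).

Lemma tensor_unitmx : M \in unitmx.
Proof.
rewrite -row_free_unit; apply: inj_row_free => v vM.
have /andP[+ _] := ellM v; rewrite vM enorm_sq.
rewrite [dotp 0 v]dotpC (linear_on0 (conj I (fun _ _ _ _ _ => I)) (@dotp_linear v)).
rewrite pmulr_rle0// => h; apply: dotp_eq0.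
by apply/eqP; rewrite eq_le h dotp_ge0.
Qed.

(** For [xi = u *m invmx M], ellipticity and Cauchy-Schwarz give [kmin * enorm xi ^+ 2 <= dotp u xi
    <= enorm u * enorm xi]; one factor [enorm xi] cancels. *)
Lemma tensor_inv_bound u :
  kmin ^+ 2 * dotp (u *m invmx M) (u *m invmx M) <= dotp u u.
Proof.
set xi := u *m invmx M.
have uE : u = xi *m M by rewrite /xi mulmxKV// tensor_unitmx.
have [->|xn0] := eqVneq (dotp xi xi) 0; first by rewrite mulr0 dotp_ge0.
have x0 : 0 < dotp xi xi by rewrite lt_neqAle eq_sym xn0 dotp_ge0.
rewrite -(ler_pM2r x0) -mulrA -expr2 -exprMn -!enorm_sq -exprMn.
rewrite ler_sqr ?nnegrE ?mulr_ge0 ?sqr_ge0 ?sqrtr_ge0//; last exact: ltW.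
by have /andP[h _] := ellM xi; apply: (le_trans h); rewrite -uE dotp_cs.
Qed.

(** Cauchy-Schwarz for the form [B] of [M] at [xi] and [u]: here [B xi u = dotp u u] and
    [B xi xi = dotp xi u], while [B u u <= kmax * dotp u u]. *)
Lemma tensor_inv_coercive u : dotp u u <= kmax * dotp (u *m invmx M) u.
Proof.
set xi := u *m invmx M.
have uE : u = xi *m M by rewrite /xi mulmxKV// tensor_unitmx.
pose B x y := dotp (x *m M) y.
have sB : semi_inner [set: E] B.
  split; [by split|by move=> x y; rewrite /B dotp_mulmxT symM dotpC| |].
    by move=> x _; exact: dotp_linear.
  move=> x _; have /andP[+ _] := ellM x; apply: le_trans.
  by rewrite mulr_ge0 ?sqr_ge0// ltW.
have := semi_inner_cs sB (I : setT xi) (I : setT u).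
have B0 x : 0 <= B x x by case: sB => _ _ _; apply.
rewrite -sqrtrM// -(@ler_pXn2r _ 2%N)// ?nnegrE ?sqrtr_ge0//.
rewrite real_normK ?num_real// sqr_sqrtr ?mulr_ge0//.
have /andP[_] := ellM u; rewrite enorm_sq -/(B u u).
rewrite {2 3}/B -uE dotpC => h cs.
have [->|un0] := eqVneq (dotp u u) 0.
  rewrite (_ : dotp xi u = B xi xi); last by rewrite /B -uE dotpC.
  by rewrite mulr_ge0// ltW.
have u0 : 0 < dotp u u by rewrite lt_neqAle eq_sym un0 dotp_ge0.
have xiu0 : 0 <= dotp xi u by have := B0 xi; rewrite /B -uE dotpC.
rewrite -(ler_pM2r u0) -expr2; apply: (le_trans cs).
by rewrite [kmax * _]mulrC -mulrA ler_wpM2l.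
Qed.

End Tensor.
End Dotp.

Lemma Rintegral_sum d (T : measurableType d) (R : realType)
    (mu : {measure set T -> \bar R}) (D : set T) (I : finType) (F : I -> T -> R) :
  measurable D -> (forall i, mu.-integrable D (EFin \o F i)) ->
  mu.-integrable D (EFin \o (fun x => \sum_i F i x)) /\
  \int[mu]_(x in D) (\sum_i F i x) = \sum_i \int[mu]_(x in D) F i x.
Proof.
move=> mD iF; elim: (index_enum I) => [|i s [IH1 IH2]].
  under [X in _.-integrable _ (_ \o X)]eq_fun do rewrite big_nil.
  split; first exact: integrable0.
  rewrite big_nil (@eq_Rintegral _ _ _ mu D (cst 0)) ?Rintegral_cst ?mul0r//.
  by move=> x _; rewrite big_nil.
under [X in _.-integrable _ (_ \o X)]eq_fun do rewrite big_cons.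
split; first by have := integrable_comb mD 1 (iF i) IH1; under eq_fun do rewrite mul1r.
rewrite big_cons -IH2 -RintegralD//.
by apply: eq_Rintegral => x _; rewrite big_cons.
Qed.

(** The reciprocal is written as [f] times a real power of the nonnegative [f ^+ 2]; at zeros of [f]
    both sides are 0, by the convention for the inverse of 0. *)
Lemma measurable_funV d (T : measurableType d) (R : realType) (D : set T) (f : T -> R) :
  measurable_fun D f -> measurable_fun D (fun x => (f x)^-1).
Proof.
move=> mf; rewrite (_ : (fun x => _) = (fun x => f x * (f x ^+ 2) `^ (-1))).
  apply: measurable_funM => //.
  apply: (@measurableT_comp _ _ _ _ _ _ (fun y : R => y `^ (-1))) => //.
  exact: measurable_funX.
apply/funext => x; rewrite powR_inv1 ?sqr_ge0//.
have [->|fx0] := eqVneq (f x) 0; first by rewrite invr0 mul0r.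
by field.
Qed.

Lemma measurable_det d (T : measurableType d) (R : realType) (D : set T) m
    (M : T -> 'M[R]_m) :
  (forall i j, measurable_fun D (fun x => M x i j)) ->
  measurable_fun D (fun x => \det (M x)).
Proof.
move=> mM; apply: measurable_sum => s; apply: measurable_funM => //.
by apply: measurable_prod => i _; exact: mM.
Qed.

Section VectorTheory.
Variables (R : realType) (n : nat).
Local Notation E := 'rV[R]_n.
Local Notation vol := (vol R n).
Local Notation volT := (caratheodory_type (lebesgue_outer_measure R n)).
Variables (D : set E).
Hypothesis mD : measurable (D : set volT).

Lemma vL2_subspace : subspace [set u : E -> E | vL2 D u].
Proof.
have sL := @L2_subspace _ _ _ vol _ mD.
split=> [k|a u v vu vv k].
  by rewrite (_ : (fun x => _) = 0) ?sL.1//; [exact: sL.1|apply/funext => x; rewrite mxE].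
rewrite (_ : (fun x => _) = a *: (fun x => u x 0 k) + (fun x => v x 0 k)).
  by apply: sL.2; [exact: vu|exact: vv].
by apply/funext => x; rewrite [LHS]mxE [X in X + _ = _]mxE.
Qed.

Lemma vL2_dotp (u v : E -> E) : vL2 D u -> vL2 D v ->
  vol.-integrable D (EFin \o (fun x => dotp (u x) (v x))).
Proof.
move=> vu vv; apply: (@Rintegral_sum _ _ _ vol _ _ _ mD _).1 => k.
by apply: (@L2_prod _ _ _ vol _ mD); [exact: vu|exact: vv].
Qed.

Lemma vip_semi_inner : semi_inner [set u : E -> E | vL2 D u] (vip D).
Proof.
split; first exact: vL2_subspace.
- by move=> u v; apply: eq_Rintegral => x _; exact: dotpC.
- move=> u vu a v w vv vw; rewrite /vip.
  transitivity (\int[vol]_(x in D) (a * dotp (u x) (v x) + dotp (u x) (w x))).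
    apply: eq_Rintegral => x _; exact: (@dotp_linear _ _ (u x) a (v x) (w x) I I).
  rewrite RintegralD//; last exact: vL2_dotp.
    by rewrite RintegralZl//; exact: vL2_dotp.
  exact: (integrableZl mD a (vL2_dotp vu vv)).
- by move=> u vu; apply: Rintegral_ge0 => x _; exact: dotp_ge0.
Qed.

Section Tensor.
Variables (A : set E) (K : E -> 'M[R]_n) (kmin kmax : R).
Hypotheses (tK : tensor_field A K kmin kmax) (DA : D `<=` A)
  (mA : measurable (A : set volT)).

Let kmin0 : 0 < kmin. Proof. by case: tK. Qed.
Let kmax0 : 0 < kmax. Proof. by case: tK => h /(lt_trans h). Qed.
Let symK x : D x -> (K x)^T = K x. Proof. by case: tK => _ _ _ + _ /DA; apply. Qed.
Let ellK x : D x -> forall xi, kmin * enorm xi ^+ 2 <= dotp (xi *m K x) xi <= kmax * enorm xi ^+ 2.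
Proof. by case: tK => _ _ _ _ h /DA Ax xi; exact: h. Qed.

(** By Cramer's formula the entries of the inverse are cofactors divided by the determinant, hence
    measurable functions of the entries of [K]. *)
Lemma Kinv_measurable (u : E -> E) k : vL2 D u ->
  measurable_fun (D : set volT) (fun x => Kinv K u x 0 k).
Proof.
move=> vu.
have mK i j : measurable_fun (D : set volT) (fun x => K x i j).
  by case: tK => _ _ mK _ _; exact: (measurable_funS mA DA (mK i j)).
apply: (@eq_measurable_fun _ _ volT _ D
  (fun x => \sum_l u x 0 l * ((\det (K x))^-1 * cofactor (K x) k l))).
  move=> x; rewrite inE => Dx; rewrite /Kinv mxE; apply: eq_bigr => l _.
  rewrite /invmx (tensor_unitmx kmin0 (ellK Dx)) !mxE.
  by [].
apply: measurable_sum => l; apply: measurable_funM; first by case: (vu l).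
apply: measurable_funM; first by apply: measurable_funV; exact: measurable_det.
rewrite /cofactor; apply: measurable_funM => //; apply: measurable_det => i j.
by under eq_fun do rewrite !mxE; exact: mK.
Qed.

Lemma Kinv_vL2 (u : E -> E) : vL2 D u -> vL2 D (Kinv K u).
Proof.
move=> vu k; split; first exact: Kinv_measurable.
have := integrableZl mD (kmin ^- 2) (vL2_dotp vu vu).
apply: le_integrable => //.
  by apply/measurable_EFinP; apply: measurable_funX; exact: Kinv_measurable.
move=> x Dx /=; rewrite lee_fin !ger0_norm ?sqr_ge0//; last first.
  by rewrite mulr_ge0 ?dotp_ge0// invr_ge0 sqr_ge0.
rewrite ler_pdivlMl ?exprn_gt0//.
apply: le_trans (tensor_inv_bound kmin0 (ellK Dx) (u x)).
rewrite ler_pM2l ?exprn_gt0// /dotp (bigD1 k)//= -expr2 lerDl.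
by apply: sumr_ge0 => l _; rewrite -expr2 sqr_ge0.
Qed.

Lemma Kinv_bound (u : E -> E) : vL2 D u -> vnrm D (Kinv K u) <= kmin^-1 * vnrm D u.
Proof.
move=> vu; have vKu := Kinv_vL2 vu.
rewrite -[leRHS]ger0_norm; last by rewrite mulr_ge0 ?sqrtr_ge0// invr_ge0 ltW.
rewrite -sqrtr_sqr ler_wsqrtr// exprMn sqr_sqrtr; last first.
  by case: vip_semi_inner => _ _ _; apply.
rewrite exprVn ler_pdivlMl ?exprn_gt0// /vip.
rewrite -RintegralZl//; last exact: vL2_dotp.
apply: le_Rintegral => //; last by move=> x Dx; exact: (tensor_inv_bound kmin0 (ellK Dx)).
  exact: (integrableZl mD _ (vL2_dotp vKu vKu)).
exact: vL2_dotp.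
Qed.

Lemma Kinv_coercive (u : E -> E) : vL2 D u ->
  vnrm D u ^+ 2 <= kmax * vip D (Kinv K u) u.
Proof.
move=> vu; have vKu := Kinv_vL2 vu.
rewrite sqr_sqrtr; last by case: vip_semi_inner => _ _ _; apply.
rewrite /vip -RintegralZl//; last exact: vL2_dotp.
apply: le_Rintegral => //; first exact: vL2_dotp.
  exact: (integrableZl mD _ (vL2_dotp vKu vu)).
by move=> x Dx; exact: (tensor_inv_coercive kmin0 kmax0 (symK Dx) (ellK Dx)).
Qed.

Lemma Kinv_cs (u v : E -> E) : vL2 D u -> vL2 D v ->
  `|vip D (Kinv K u) v| <= kmin^-1 * vnrm D u * vnrm D v.
Proof.
move=> vu vv; apply: le_trans (semi_inner_cs vip_semi_inner (Kinv_vL2 vu) vv) _.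
by apply: ler_wpM2r; [exact: sqrtr_ge0|exact: Kinv_bound].
Qed.

Lemma Kinv_linear a (u v : E -> E) : Kinv K (a *: u + v) = a *: Kinv K u + Kinv K v.
Proof. by apply/funext => x; rewrite /Kinv [LHS]mulmxDl -scalemxAl. Qed.

Lemma vip_Kinv_linearl (v : E -> E) : vL2 D v ->
  linear_on [set u | vL2 D u] (fun u => vip D (Kinv K u) v).
Proof.
move=> vv a u w vu vw /=; have [_ C L _] := vip_semi_inner.
rewrite Kinv_linear (C _ v) (L v vv a _ _ (Kinv_vL2 vu) (Kinv_vL2 vw)).
by rewrite (C v (Kinv K u)) (C v (Kinv K w)).
Qed.

End Tensor.
End VectorTheory.

(** * Outward normals and adjacency of the subdomains *)

Section NormalGeometry.
Variables (R : realType) (n : nat).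
Local Notation E := 'rV[R]_n.
Implicit Types (x y nu : E) (A B : set E).

Lemma enormZ a x : enorm (a *: x) = `|a| * enorm x.
Proof. exact: (semi_inner_normZ (@dotp_semi_inner R n) a (I : setT x)). Qed.

Lemma enorm_triangle x y : enorm (x + y) <= enorm x + enorm y.
Proof. exact: (semi_inner_triangle (@dotp_semi_inner R n) (I : setT x) (I : setT y)). Qed.

Lemma dotpZr a x y : dotp x (a *: y) = a * dotp x y.
Proof. by rewrite /dotp mulr_sumr; apply: eq_bigr => k _; rewrite !mxE; ring. Qed.

Lemma dotpDr x y z : dotp x (y + z) = dotp x y + dotp x z.
Proof. by rewrite /dotp -big_split/=; apply: eq_bigr => k _; rewrite !mxE; ring. Qed.

Lemma dotpNl x y : dotp (- x) y = - dotp x y.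
Proof. by rewrite /dotp -sumrN; apply: eq_bigr => k _; rewrite !mxE; ring. Qed.

Lemma enorm_lt r x : 0 < r -> (forall k, `|x 0 k| <= r / n.+1%:R) -> enorm x < r.
Proof.
move=> r0 xr; rewrite -[r]gtr0_norm// -sqrtr_sqr ltr_sqrt ?exprn_gt0//.
apply: (@le_lt_trans _ _ (\sum_(k < n) (r / n.+1%:R) ^+ 2)).
  apply: ler_sum => k _; rewrite -expr2 -real_normK ?num_real//.
  by rewrite ler_sqr ?nnegrE// ltW// divr_gt0// ltr0n.
rewrite sumr_const card_ord expr_div_n -[_ *+ n]mulr_natr -mulrA gtr_pMr ?exprn_gt0//.
rewrite mulrC ltr_pdivrMr ?exprn_gt0 ?ltr0n// mul1r -natrX ltr_nat.
by rewrite (leq_trans (ltnSn n))// leq_pmull.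
Qed.

(** If [nu + mu] were nonzero, a small step along its opposite would enter both half-spaces, hence
    both of the disjoint sets. Otherwise [dotp nu mu <= -1], which for unit vectors forces the sum
    to vanish. *)
Lemma outward_normal_opp A B x nu mu : A `&` B = set0 ->
  outward_normal A x nu -> outward_normal B x mu -> mu = - nu.
Proof.
move=> AB [nu1 [r r0 rA]] [mu1 [s s0 sB]].
have nn : dotp nu nu = 1 by rewrite -enorm_sq nu1 expr1n.
have mm : dotp mu mu = 1 by rewrite -enorm_sq mu1 expr1n.
suff h : dotp nu mu <= -1.
  apply/eqP; rewrite -addr_eq0; apply/eqP/dotp_eq0/eqP.
  rewrite eq_le dotp_ge0 andbT dotpDr ![dotp (mu + nu) _]dotpC !dotpDr.
  by rewrite nn mm [dotp mu nu]dotpC; lra.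
rewrite leNgt; apply/negP => h.
pose d := Num.min r s; have d0 : 0 < d by rewrite lt_min r0.
(* The sum of two unit vectors has norm at most 2, so the factor [d / 4] keeps [v] well inside the
   radius [d]. *)
pose v := - (d / 4) *: (nu + mu).
have vd : enorm v < d.
  rewrite enormZ normrN gtr0_norm ?divr_gt0//.
  by have := enorm_triangle nu mu; rewrite nu1 mu1 => h1; nra.
have nuv : dotp nu v < 0 by rewrite dotpZr dotpDr nn; nra.
have muv : dotp mu v < 0 by rewrite dotpZr dotpDr mm dotpC; nra.
have Av : A (x + v).
  apply/rA; rewrite addrAC subrr add0r//; apply: lt_le_trans vd _.
  by rewrite /d ge_min lexx.
have Bv : B (x + v).
  apply/sB; rewrite addrAC subrr add0r//; apply: lt_le_trans vd _.
  by rewrite /d ge_min lexx orbT.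
by have : (A `&` B) (x + v) by []; rewrite AB.
Qed.

(** A point of the closed half-ball becomes a point of [A] after an arbitrarily small shift along
    [- nu]. *)
Lemma outward_normal_closure A x nu : outward_normal A x nu ->
  exists2 r : R, 0 < r & forall y, enorm (y - x) < r -> dotp nu (y - x) <= 0 -> closure A y.
Proof.
move=> [nu1 [r r0 rA]]; exists r => // y yr yle U /nbhs_ballP[e /= e0 eU].
have nn : dotp nu nu = 1 by rewrite -enorm_sq nu1 expr1n.
pose t := Num.min (e / 2) ((r - enorm (y - x)) / 2).
have t0 : 0 < t by rewrite lt_min !divr_gt0// subr_gt0.
have te : t <= e / 2 by rewrite /t ge_min lexx.
have tr : t <= (r - enorm (y - x)) / 2 by rewrite /t ge_min lexx orbT.
exists (y - t *: nu); split.
  apply/rA; rewrite addrAC -scaleNr.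
    have := enorm_triangle (y - x) (- t *: nu).
    by rewrite enormZ normrN gtr0_norm// nu1 mulr1; lra.
  by rewrite dotpDr dotpZr nn; lra.
apply: eU; split=> // i k; rewrite (ord1 i) !mxE /ball/= opprB addrC subrK.
have := normr_coord_le_enorm nu k; rewrite nu1 normrM gtr0_norm// => h.
by apply: (@le_lt_trans _ _ t); [nra|lra].
Qed.

(** The normals are opposite, so the two closed half-balls fill a neighbourhood of [x]. *)
Lemma outward_normals_interior A B x nu mu : A `&` B = set0 ->
  outward_normal A x nu -> outward_normal B x mu ->
  interior (closure A `|` closure B) x.
Proof.
move=> AB nA nB; have muE := outward_normal_opp AB nA nB; subst mu.
have [r r0 rA] := outward_normal_closure nA.
have [s s0 sB] := outward_normal_closure nB.
pose d := Num.min r s; have d0 : 0 < d by rewrite lt_min r0.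
apply/nbhs_ballP; exists (d / n.+1%:R) => /=; first by rewrite divr_gt0// ltr0n.
move=> y [_ xy].
have yd : enorm (y - x) < d.
  by apply: enorm_lt => // k; rewrite !mxE distrC ltW//; exact: xy.
have [le0|lt0] := leP (dotp nu (y - x)) 0.
  by left; apply: rA => //; apply: lt_le_trans yd _; rewrite /d ge_min lexx.
right; apply: sB; first by apply: lt_le_trans yd _; rewrite /d ge_min lexx orbT.
by rewrite dotpNl oppr_le0 ltW.
Qed.

End NormalGeometry.

(** * Shadows of sets of zero Hausdorff measure *)

Section NullProjection.
Variables (R : realType) (n : nat).
Local Notation E := 'rV[R]_n.
Local Open Scope ereal_scope.

(** The shadow of each member of a cover of [Z] has measure at most [c] times its gauge, and [Z] has
    covers of arbitrarily small total gauge. The set [B] appears because the shadow itself need not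
    be measurable; the diameter bound 1 is just one choice of [delta]. *)
Lemma null_projection d (T : measurableType d) (nu : {measure set T -> \bar R})
    (pr : E -> T) (m : nat) (c : R) (Z : set E) (B : set T) : (0 < c)%R ->
  (forall F : set E, F !=set0 -> diam F <= 1 -> exists S, [/\ measurable S,
     pr @` F `<=` S & nu S <= (c * (ball_volume R m * (fine (diam F) / 2) ^+ m))%:E]) ->
  hausdorff_outer m Z = 0 -> measurable B -> B `<=` pr @` Z -> nu B = 0.
Proof.
move=> c0 prF Z0 mB BZ.
have mu0 : mu_ext (@hausdorff_gauge R n m 1%R) Z = 0.
  apply/eqP; rewrite eq_le mu_ext_ge0 ?andbT; last by move=> S; exact: hausdorff_gauge_ge0.
  by rewrite -Z0; apply: ereal_sup_ubound; exists 1%R => /=.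
apply/eqP; rewrite eq_le measure_ge0 andbT.
apply/lee_addgt0Pr => e e0; rewrite add0e.
have ec : (0 < e / c)%R by rewrite divr_gt0.
have : mu_ext (@hausdorff_gauge R n m 1%R) Z \is a fin_num by rewrite mu0.
move=> /(lb_ereal_inf_adherent ec)[_ [F [mF ZF] <-]].
rewrite -/(mu_ext (@hausdorff_gauge R n m 1%R) Z) mu0 add0e => sumF.
(* A finite total makes every gauge finite, so every nonempty member has diameter at most 1 and
   [prF] applies to it. *)
have gfin k : hausdorff_gauge m 1%R (F k) < +oo.
  apply: le_lt_trans (lt_trans sumF (ltry _)).
  rewrite (nneseries_split _ k.+1); last by move=> *; exact: hausdorff_gauge_ge0.
  rewrite big_mkord big_ord_recr/= -addeA addeC -addeA leeDl// adde_ge0//.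
    by apply: nneseries_ge0 => *; exact: hausdorff_gauge_ge0.
  by apply: sume_ge0 => *; exact: hausdorff_gauge_ge0.
have exS k : exists S, [/\ measurable S, pr @` F k `<=` S &
    nu S <= c%:E * hausdorff_gauge m 1%R (F k)].
  have [F0|/eqP F0] := pselect (F k = set0).
    exists set0; split => //; first by rewrite F0 image_set0.
    by rewrite measure0; apply: mule_ge0; [rewrite lee_fin ltW|exact: hausdorff_gauge_ge0].
  move/set0P in F0.
  have := gfin k; rewrite /hausdorff_gauge; case: asboolP => [F0'|_].
    by move: F0 => -[x]; rewrite F0'.
  case: ifPn => // Fd _; have [S [mS FS nuS]] := prF _ F0 Fd.
  by exists S; split=> //; rewrite -EFinM.
pose S k := projT1 (cid (exS k)).
have SP k : [/\ measurable (S k), pr @` F k `<=` S k &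
    nu (S k) <= c%:E * hausdorff_gauge m 1%R (F k)] by exact: projT2 (cid (exS k)).
apply: (@le_trans _ _ (\sum_(k <oo) nu (S k))).
  apply: (@measure_sigma_subadditive _ _ _ nu) => //; first by move=> k; case: (SP k).
  move=> t /BZ[z /ZF[k _ Fkz] <-]; exists k => //.
  by case: (SP k) => _ + _; apply; exists z.
apply: (@le_trans _ _ (\sum_(k <oo) (c%:E * hausdorff_gauge m 1%R (F k)))).
  by apply: lee_nneseries => // k _; case: (SP k).
rewrite nneseriesZl//; last by move=> *; exact: hausdorff_gauge_ge0.
rewrite -lee_pdivlMl// (le_trans (ltW sumF))// -EFinM lee_fin mulrC.
by [].
Qed.

Lemma coord_le_diam (F : set E) (x y : E) k : F x -> F y -> diam F <= 1 ->
  (`|x 0 k - y 0 k| <= fine (diam F))%R.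
Proof.
move=> Fx Fy Fd; have h : (enorm (x - y))%:E <= diam F.
  by apply: ereal_sup_ubound; exists (x, y).
have := normr_coord_le_enorm (x - y) k; rewrite !mxE => /le_trans; apply.
rewrite -lee_fin fineK// fin_numE; apply/andP; split; apply/eqP => E0.
  by move: h; rewrite E0 leeNy_eq.
by move: Fd; rewrite E0.
Qed.

End NullProjection.

Section Shadow.
Variable R : realType.

Lemma lebesgue_itv_centered (a r : R) : 0 <= r ->
  lebesgue_measure (`[a - r, a + r]%classic : set R) = (2 * r)%:E.
Proof.
move=> r0; rewrite lebesgue_measure_itv/= lte_fin.
case: ltP => h; first by rewrite -EFinB; congr EFin; ring.
by have -> : r = 0 by [lra|]; rewrite mulr0.
Qed.

Lemma lebesgue_square_centered (a b r : R) : 0 <= r ->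
  (@lebesgue_measure R \x @lebesgue_measure R)%E
    (`[a - r, a + r]%classic `*` `[b - r, b + r]%classic) = (2 * r * (2 * r))%:E.
Proof.
move=> r0; rewrite product_measure1E// EFinM.
exact: (congr2 mule (lebesgue_itv_centered _ r0) (lebesgue_itv_centered _ r0)).
Qed.

Lemma diam_fine_ge0 n (F : set 'rV[R]_n) : 0 <= fine (diam F).
Proof.
have [F0|/eqP/set0P[x Fx]] := pselect (F = set0).
  rewrite F0 /diam (_ : [set _ | _ in _] = set0) ?ereal_sup0//.
  by apply/seteqP; split=> // y [[a b] []].
apply: fine_ge0; apply: ereal_sup_ubound; exists (x, x) => //=.
by rewrite subrr /enorm /dotp big1 ?sqrtr0// => k _; rewrite !mxE mul0r.
Qed.

Lemma in_centered_itv n (F : set 'rV[R]_n) (x y : 'rV[R]_n) k : F x -> F y ->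
  (diam F <= 1)%E ->
  (`[x 0 k - fine (diam F), x 0 k + fine (diam F)]%classic : set R) (y 0 k).
Proof.
move=> Fx Fy Fd /=; have := coord_le_diam k Fy Fx Fd.
by rewrite in_itv/= ler_norml => /andP[h1 h2]; apply/andP; split; lra.
Qed.

(** If every line with base point near [x0] met [Z], a whole segment would lie in the shadow of [Z]
    and have length zero. *)
Lemma shadow2 (Z : set 'rV[R]_2) (x0 : 'rV[R]_2) (r : R) : 0 < r ->
  hausdorff_outer 1 Z = 0%E ->
  exists y : 'rV[R]_2, (forall k, `|y 0 k - x0 0 k| <= r) /\
    forall t, ~ Z (y + t *: delta_mx 0 ord0).
Proof.
move=> r0 Z0; apply: contrapT => /forallNP h.
pose B : set R := `[x0 0 ord_max - r, x0 0 ord_max + r]%classic.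
suff : lebesgue_measure B = 0%E.
  by rewrite /B lebesgue_itv_centered ?ltW// => -[/eqP]; rewrite mulf_eq0 pnatr_eq0/= gt_eqF.
(* The constant 2: the covering interval has length twice the diameter, and the one-dimensional
   gauge is the diameter itself. *)
apply: (@null_projection _ 2 _ _ lebesgue_measure (fun x : 'rV[R]_2 => x 0 ord_max) 1 2 Z) => //.
  move=> F [x Fx] Fd.
  exists (`[x 0 ord_max - fine (diam F), x 0 ord_max + fine (diam F)]%classic); split => //.
    by move=> _ [y Fy <-]; exact: in_centered_itv.
  rewrite [leLHS](_ : _ = (2 * fine (diam F))%:E); last exact/lebesgue_itv_centered/diam_fine_ge0.
  rewrite lee_fin expr1 /=.
  by have := diam_fine_ge0 F; lra.
  by rewrite /B.
move=> b; rewrite /B /= ?in_itv/= => /andP[b1 b2].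
pose y : 'rV[R]_2 := \row_k if k == ord_max then b else x0 0 k.
have := h y => /not_andP[[]|/existsNP[t /contrapT Zt]].
  move=> k; rewrite mxE; case: eqP => [->|_]; last by rewrite subrr normr0 ltW.
  by rewrite ler_norml; apply/andP; split; lra.
by exists (y + t *: delta_mx 0 ord0) => //; rewrite !mxE/= mulr0 addr0.
Qed.

Lemma shadow3 (Z : set 'rV[R]_3) (x0 : 'rV[R]_3) (r : R) : 0 < r ->
  hausdorff_outer 2 Z = 0%E ->
  exists y : 'rV[R]_3, (forall k, `|y 0 k - x0 0 k| <= r) /\
    forall t, ~ Z (y + t *: delta_mx 0 ord0).
Proof.
move=> r0 Z0; apply: contrapT => /forallNP h.
pose k1 : 'I_3 := lift ord0 ord0; pose k2 : 'I_3 := ord_max.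
pose I k : set R := `[x0 0 k - r, x0 0 k + r]%classic.
pose nu := ((@lebesgue_measure R) \x (@lebesgue_measure R))%E.
suff : nu (I k1 `*` I k2) = 0%E.
  rewrite [X in X = _](_ : _ = (2 * r * (2 * r))%:E); last first.
    exact/lebesgue_square_centered/ltW.
  move=> -[/eqP].
  by rewrite !mulf_eq0 pnatr_eq0/= gt_eqF.
(* The constant [16 / pi]: the covering square has side twice the diameter, while the
   two-dimensional gauge is [pi / 4] times the squared diameter. *)
apply: (@null_projection _ 3 _ _ nu (fun x : 'rV[R]_3 => (x 0 k1, x 0 k2)) 2 (16 / pi) Z) => //.
- by rewrite divr_gt0// pi_gt0.
- move=> F [x Fx] Fd.
  exists (`[x 0 k1 - fine (diam F), x 0 k1 + fine (diam F)]%classic `*`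
          `[x 0 k2 - fine (diam F), x 0 k2 + fine (diam F)]%classic); split.
  + exact: measurableX.
  + by move=> _ [y Fy <-]; split; exact: in_centered_itv.
  + rewrite [leLHS](_ : _ = (2 * fine (diam F) * (2 * fine (diam F)))%:E); last first.
      exact/lebesgue_square_centered/diam_fine_ge0.
    rewrite lee_fin.
    rewrite /= mulr1 (_ : 2 * pi / 2 = pi); last by field.
    rewrite (_ : 16 / pi * _ = 4 * fine (diam F) ^+ 2); first by rewrite expr2; lra.
    have pn0 : pi != 0 :> R by rewrite gt_eqF// pi_gt0.
    by rewrite mulrA divfK// expr_div_n; set d := fine _; field.
- by apply: measurableX; rewrite /I.
- move=> [b1 b2] [/=]; rewrite /I /= ?in_itv/= => /andP[h1 h2] /andP[h3 h4].
  pose y : 'rV[R]_3 := \row_k if k == k1 then b1 else if k == k2 then b2 else x0 0 k.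
  have := h y => /not_andP[[]|/existsNP[t /contrapT Zt]].
    move=> k; rewrite mxE; case: eqP => [->|_].
      by rewrite ler_norml; apply/andP; split; lra.
    case: eqP => [->|_]; last by rewrite subrr normr0 ltW.
    by rewrite ler_norml; apply/andP; split; lra.
  by exists (y + t *: delta_mx 0 ord0) => //; rewrite !mxE/= !mulr0 !addr0.
Qed.

Lemma exists_shadow n : n = 2%N \/ n = 3%N -> exists k0 : 'I_n,
  forall (Z : set 'rV[R]_n) (x0 : 'rV[R]_n) (r : R), 0 < r ->
  hausdorff_outer n.-1 Z = 0%E ->
  exists y : 'rV[R]_n, (forall k, `|y 0 k - x0 0 k| <= r) /\
    forall t, ~ Z (y + t *: delta_mx 0 k0).
Proof. by move=> [] ->; exists ord0; [exact: shadow2|exact: shadow3]. Qed.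

End Shadow.

(** * Contact of subdomains, and escape from a union of interior ones *)

Section DecompositionGeometry.
Context (R : realType) (n N : nat) (D : @decomposition R n N).
Local Notation E := 'rV[R]_n.
Implicit Types (i j k : 'I_N).

Lemma open_sub i : open (sub D i).
Proof. by case: (sub_polygonal D i). Qed.

Lemma boundary_sub i x : boundary (sub D i) x <-> closure (sub D i) x /\ ~ sub D i x.
Proof. by rewrite /boundary; have /interior_id -> := @open_sub i. Qed.

Definition good_normal i x := outward_normal (sub D i) x (normal D i x).

Lemma good_normals : {ae area R n, forall x, forall i, boundary (sub D i) x -> good_normal i x}.
Proof. by apply: filter_forall => i; exact: (normal_outward D i). Qed.

Lemma ae_area_null (P : E -> Prop) : {ae area R n, forall x, P x} ->
  hausdorff_outer n.-1 [set x | ~ P x] = 0%E.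
Proof.
move=> [A [mA A0 PA]]; apply/eqP; rewrite eq_le hausdorff_outer_ge0 andbT.
have <- : hausdorff_outer n.-1 A = 0%E := A0.
exact: le_hausdorff_outer.
Qed.

(* Three pairwise disjoint half-spaces cannot share a boundary point. *)
Lemma good_normal_triple i j k x : i != j -> i != k -> j != k ->
  good_normal i x -> good_normal j x -> good_normal k x -> False.
Proof.
move=> ij ik jk gi gj gk.
have h1 := outward_normal_opp (sub_disjoint D ij) gi gj.
have h2 := outward_normal_opp (sub_disjoint D ik) gi gk.
have h3 := outward_normal_opp (sub_disjoint D jk) gj gk.
have n0 : normal D i x = 0.
  have : normal D i x = - normal D i x by rewrite -h2 h3 h1 opprK.
  move=> /eqP; rewrite -addr_eq0 -mulr2n -scaler_nat scaler_eq0 pnatr_eq0/=.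
  by move/eqP.
have [+ _] := gi; rewrite n0 /enorm /dotp big1; last by move=> l _; rewrite mxE mul0r.
by rewrite sqrtr0 => /eqP; rewrite eq_sym oner_eq0.
Qed.

Lemma triple_ae : {ae area R n, forall x, forall i j k, i != j -> i != k -> j != k ->
  boundary (sub D i) x -> boundary (sub D j) x -> boundary (sub D k) x -> False}.
Proof.
apply: area_aeS good_normals => x g i j k ij ik jk bi bj bk.
by apply: (@good_normal_triple i j k x) => //; exact: g.
Qed.

Lemma gammaC i j : gamma D i j = gamma D j i.
Proof. exact: setIC. Qed.

Lemma interfaceC i j : interface D i j <-> interface D j i.
Proof. by rewrite /interface gammaC eq_sym. Qed.

Lemma sub_bounded : exists M : R, forall i x, closure (sub D i) x -> forall k : 'I_n, x 0 k <= M.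
Proof.
have [[x0 Dx0] _] := dom_connected D.
have PF : ProperFilter (globally (dom D)) by exact: (globally_properfilter Dx0).
have /ex_bound[M MD] := dom_bounded D; exists M => i x cx k.
have cl : closed [set y : E | y 0 k <= M].
  apply: (@closed_comp _ _ (fun y : E => y 0 k) [set z | z <= M]); last exact: closed_le.
  by move=> y _; exact: coord_continuous.
have sD : sub D i `<=` [set y : E | y 0 k <= M].
  move=> y /sub_dom /MD /=; apply: le_trans; apply: le_trans (ler_norm _) _.
  by rewrite -[leRHS]/(mx_norm y) mx_normrE (le_bigmax _ (fun ij => `|y ij.1 ij.2|) (0, k)).
by have /closure_id clE := cl; have := closureS sD cx; rewrite -clE.
Qed.

(* The union of the subdomains indexed by [A] would have a boundary of zero
   surface measure, but every line through one of them leaves the union. *)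
Lemma no_closed_component (n23 : n = 2%N \/ n = 3%N) (A : set 'I_N) i0 : A i0 ->
  (forall i, A i -> is_interior D i) ->
  (forall i j, A i -> interface D i j -> A j) -> False.
Proof.
move=> Ai0 Aint Aint2.
pose U := \bigcup_(i in A) closure (sub D i).
have cU : closed U by apply: closed_bigcup => [|i _]; [exact: finite_finset|exact: closed_closure].
have [k0 shadow] := exists_shadow R n23.
have [[x0 sx0] _] := sub_connected D i0.
have : nbhs x0 (sub D i0) by apply: open_nbhs_nbhs; split=> //; exact: open_sub.
move=> /nbhs_ballP[e /= e0 esub].
have e20 : 0 < e / 2 by rewrite divr_gt0.
have [y [yx0 yt]] := shadow _ x0 _ e20 (ae_area_null good_normals).
have sy : sub D i0 y.
  apply: esub; split=> // i k; rewrite (ord1 i) /ball/= distrC.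
  by apply: le_lt_trans (yx0 k) _; lra.
have [M MU] := sub_bounded.
(* The parameters at which the line lies in [U]. Their supremum exists because the subdomains are
   bounded, and is attained because [U] is closed. *)
pose T := [set t : R | U (y + t *: delta_mx 0 k0)].
have T0 : T 0 by exists i0 => //; rewrite scale0r addr0; exact: subset_closure.
have Tub t : T t -> t <= M - y 0 k0.
  move=> [i _ /MU/(_ k0)]; rewrite !mxE !eqxx/= mulr1 => h.
  by rewrite lerBrDr addrC.
have hT : has_ubound T by exists (M - y 0 k0) => t /Tub.
have cT : closed T.
  apply: (@closed_comp _ _ (fun t : R => y + t *: delta_mx 0 k0) U) => //.
  move=> t _; apply: cvgD; first exact: cvg_cst.
  by apply: cvgZ; [exact: cvg_id|exact: cvg_cst].
have Ts : T (sup T).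
  rewrite {1}(_ : T = closure T); last exact/closure_id.
  by apply: closure_sup => //; exists 0.
set z := y + sup T *: delta_mx 0 k0.
(* Otherwise the line would stay in [U] beyond its last point [z]. *)
have zint : ~ interior U z.
  move=> /nbhs_ballP[d /= d0 dU].
  have : T (sup T + d / 2).
    apply: dU; split=> // i k; rewrite (ord1 i) /z !mxE /ball/=.
    rewrite (_ : _ - _ = - (d / 2) * (k == k0)%:R); last first.
      by case: (k == k0) => /=; ring.
    rewrite normrM normrN normr_nat gtr0_norm ?divr_gt0//.
    by case: (k == k0) => /=; lra.
  move=> /(ub_le_sup hT); rewrite gerDl leNgt => /negP; apply.
  exact: divr_gt0.
(* The line avoids the null set of bad points, so each subdomain whose boundary contains [z] has a
   true outward normal there. *)
apply: (yt (sup T)); move=> good.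
have [i Ai ci] := Ts.
have iz : ~ sub D i z.
  move=> sz; apply: zint; apply/nbhs_ballP.
  have : nbhs z (sub D i) by apply: open_nbhs_nbhs; split=> //; exact: open_sub.
  move=> /nbhs_ballP[d d0 dU]; exists d => // w /dU sw.
  by exists i => //; exact: subset_closure.
have bi : boundary (sub D i) z by apply/boundary_sub.
(* The closures of [sub D i] and of a second member of [A] touching [z] would fill a neighbourhood
   of [z]. *)
have pair j : j != i -> A j -> boundary (sub D j) z -> False.
  move=> ji Aj bj; apply: zint.
  have dij : sub D j `&` sub D i = set0 by exact: sub_disjoint.
  have := outward_normals_interior dij (good _ bj) (good _ bi).
  apply: interiorS => w [cw|cw]; [by exists j|by exists i].
(* As [sub D i] is interior, [z] lies on some interface. If [i] is one of its sides, the other side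
   belongs to [A] too and [pair] applies; if not, three subdomains meet at [z]. *)
have [k [l [kl int [bk bl]]]] := Aint _ Ai _ bi.
have [ik|ik] := eqVneq i k.
  subst k; apply: (pair l) => //; last exact: (Aint2 _ _ Ai int).
  by case: int; rewrite eq_sym.
have [il|il] := eqVneq i l.
  subst l; apply: (pair k) => //; first by rewrite eq_sym.
  by apply: (Aint2 _ _ Ai); apply/interfaceC.
by case: int => kl' _; exact: (good_normal_triple ik il kl' (good _ bi) (good _ bk) (good _ bl)).
Qed.

End DecompositionGeometry.

(** * Interfaces *)

Section RestrictedL2.
Context d (T : measurableType d) (R : realType).
Variables (mu : {measure set T -> \bar R}) (D : set T).
Hypothesis mD : measurable D.

Lemma ip_restrict (A : set T) (f g : T -> R) : A `<=` D ->
  ip mu D (f \_ A) g = ip mu A f g.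
Proof.
move=> AD; rewrite /ip -[in RHS](setIidr AD) [RHS]Rintegral_mkcondr.
apply: eq_Rintegral => x _; rewrite /patch; case: ifP => // _.
by rewrite mul0r.
Qed.

Lemma L2_restrict (A : set T) (f : T -> R) : measurable A -> A `<=` D ->
  L2 mu A f -> L2 mu D (f \_ A).
Proof.
move=> mA AD [mf if2]; split.
  by apply/measurable_restrict => //; rewrite (setIidr AD).
rewrite -[A](setIidr AD) in if2.
have := (integrable_restrict _ mA mD _).1 if2.
apply: eq_integrable => // x _; rewrite /patch /=; case: ifP => //= _.
by rewrite expr0n.
Qed.

Lemma nrm_restrict (A : set T) (f : T -> R) : A `<=` D ->
  nrm mu D (f \_ A) = nrm mu A f.
Proof.
move=> AD; rewrite /nrm ip_restrict// /ip; congr Num.sqrt.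
by apply: eq_Rintegral => x xA; rewrite /patch xA.
Qed.

Lemma nrm_eq0_ae (f : T -> R) : L2 mu D f -> nrm mu D f = 0 ->
  {ae mu, forall x, D x -> f x = 0}.
Proof.
move=> L2f /eqP; rewrite sqrtr_eq0 => ip0.
have {}ip0 : ip mu D f f = 0 by apply/eqP; rewrite eq_le ip0 ip_ge0.
have [mf _] := L2f.
have : (\int[mu]_(x in D) `|(f x * f x)%:E| = 0)%E.
  pose ff x := f x * f x.
  transitivity (\int[mu]_(x in D) (EFin \o ff) x)%E.
    by apply: eq_integral => x _ /=; rewrite ger0_norm// -expr2 sqr_ge0.
  rewrite -[LHS]fineK; first by congr EFin.
  by apply: integrable_fin_num => //; exact: L2_prod.
move=> /(@ae_eq_integral_abs _ _ _ mu D mD (fun x => (f x * f x)%:E)).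
have mff : measurable_fun D (fun x => (f x * f x)%:E).
  by apply/measurable_EFinP; exact: measurable_funM.
move=> /(_ mff); apply: filterS => x h Dx; have [/eqP] := h Dx.
by rewrite mulf_eq0 orbb => /eqP.
Qed.

Lemma integrable_ae_bounded (f : T -> R) (M : R) : L2 mu D (cst 1) ->
  measurable_fun D f -> {ae mu, forall x, D x -> `|f x| <= M} ->
  mu.-integrable D (EFin \o f).
Proof.
move=> [_ i1] mf fM; apply/integrableP; split; first exact/measurable_EFinP.
have iM := integrableZl mD `|M| i1.
have /integrableP[miM lty] := iM.
apply: le_lt_trans lty; apply: ae_ge0_le_integral => //.
- by apply: measurableT_comp => //; exact/measurable_EFinP.
- by apply: measurableT_comp.
apply: filterS fM => x h /h; rewrite /= expr1n mulr1 lee_fin normr_id => h2.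
exact: le_trans h2 (ler_norm _).
Qed.

End RestrictedL2.

Section OuterNull.
Context (R : realType) (T : pointedType) (mu : {outer_measure set T -> \bar R}).

(** A set of zero outer measure satisfies Caratheodory's criterion, so it is its own measurable null
    cover. *)
Lemma outer_null_negligible (A : set (caratheodory_type mu)) :
  mu A = 0%E -> (mu : set (caratheodory_type mu) -> \bar R).-negligible A.
Proof.
move=> A0; exists A; split=> //; apply: le_caratheodory_measurable => X.
rewrite (_ : mu (X `&` A) = 0%E) ?add0e; last first.
  apply/eqP; rewrite eq_le outer_measure_ge0 andbT -A0.
  by apply: le_outer_measure; exact: subIsetr.
by apply: le_outer_measure; exact: subIsetl.
Qed.

End OuterNull.

(** * Essential boundedness of piecewise polynomials *)

Section Polynomials.
Variables (R : realType) (n : nat).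
Local Notation E := 'rV[R]_n.

Lemma polynomial_fun_bounded (q : E -> R) (r : R) : polynomial_fun q ->
  exists M, forall x : E, (forall k, `|x 0 k| <= r) -> `|q x| <= M.
Proof.
elim=> [c|k|p q' _ [M1 h1] _ [M2 h2]|p q' _ [M1 h1] _ [M2 h2]].
- by exists `|c|.
- by exists r.
- exists (M1 + M2) => x xr; apply: le_trans (ler_normD _ _) _.
  by apply: lerD; [exact: h1|exact: h2].
- exists (M1 * M2) => x xr; rewrite normrM.
  by apply: ler_pM => //; [exact: h1|exact: h2].
Qed.

Lemma element_set_bounded m (t : @affine_element R n m) :
  exists r, forall x : E, element_set t x -> forall k, `|x 0 k| <= r.
Proof.
exists (\sum_k (`|org t 0 k| + \sum_l `|mx t l k|)) => _ [xi [xi01 _] <-] k.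
rewrite (bigD1 k)//= !mxE -[leLHS]addr0; apply: lerD; last first.
  apply: sumr_ge0 => j _; apply: addr_ge0 => //.
  by apply: sumr_ge0 => l _; exact: normr_ge0.
apply: le_trans (ler_normD _ _) _; apply: lerD => //.
apply: le_trans (ler_norm_sum _ _ _) _; apply: ler_sum => l _.
have /andP[h0 h1] := xi01 l.
by rewrite normrM ger0_norm// ler_piMl.
Qed.

(** Polynomials are bounded on the bounded elements, and there are finitely many of them. This is
    how discrete fields get into [L^s]. *)
Lemma piecewise_polynomial_bounded m (M : @mesh R n m) (f : E -> R) :
  piecewise_polynomial M (vol R n) f ->
  exists B, {ae vol R n, forall x : E, mesh_set M x -> `|f x| <= B}.
Proof.
move=> pf.
have pt t : exists B, {ae vol R n, forall x : E, element_set (element M t) x -> `|f x| <= B}.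
  have [q pq fq] := pf t.
  have [r tr] := element_set_bounded (element M t).
  have [B qB] := polynomial_fun_bounded r pq.
  exists B; have := outer_null_negligible fq; apply: negligibleS.
  move=> x /= /not_implyP[tx fB]; split=> //; apply/negP => /eqP fqx.
  by apply: fB; rewrite fqx; apply: qB; exact: tr.
pose B t := projT1 (cid (pt t)).
have BP t : {ae vol R n, forall x : E, element_set (element M t) x -> `|f x| <= B t}.
  exact: projT2 (cid (pt t)).
exists (\sum_t `|B t|).
apply: vol_aeS (vol_ae_forall BP) => x h [t _ tx].
apply: le_trans (h t tx) _; apply: le_trans (ler_norm _) _.
by rewrite (bigD1 t)//= lerDl; apply: sumr_ge0.
Qed.

End Polynomials.

Section Faces.
Context (R : realType) (n N : nat) (D : @decomposition R n N).
Local Notation E := 'rV[R]_n.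
Local Notation areaT := (caratheodory_type (hausdorff_outer_measure R n n.-1)).
Local Notation area := (area R n).
Implicit Types (i j k l : 'I_N).

(** Contacts of zero area are discarded, so membership alone records that the two subdomains share
    an interface. *)
Definition face i j : set E := [set x | interface D i j /\ gamma D i j x].

Lemma faceC i j : face i j = face j i.
Proof.
by apply/seteqP; split=> x [/interfaceC h g]; split=> //; rewrite gammaC.
Qed.

Lemma faceE i j : interface D i j -> face i j = gamma D i j.
Proof. by move=> h; apply/seteqP; split=> x // []. Qed.

Lemma face_boundary i j x : face i j x -> boundary (sub D i) x /\ boundary (sub D j) x.
Proof. by case. Qed.

Lemma measurable_gamma i j : measurable (gamma D i j : set areaT).
Proof. by apply: measurableI; exact: area_measurable_boundary. Qed.

Lemma measurable_face i j : measurable (face i j : set areaT).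
Proof.
have [h|h] := pselect (interface D i j); first by rewrite faceE//; exact: measurable_gamma.
by rewrite (_ : face i j = set0)//; apply/seteqP; split=> x // [].
Qed.

Lemma Gamma_faces x : Gamma D x <-> exists i j, (i < j)%N /\ face i j x.
Proof.
split=> [[i [j [ij int g]]]|[i [j [ij [int g]]]]]; exists i, j; split => //.
Qed.

Lemma face_lt i j x : face i j x -> (i < j)%N \/ (j < i)%N.
Proof. by move=> [[ij _] _]; apply/orP; rewrite -neq_ltn. Qed.

Lemma face_Gamma_ i j : face i j `<=` Gamma_ D i.
Proof.
move=> x f; split; last by case: (face_boundary f).
apply/Gamma_faces; have [ij|ji] := face_lt f; first by exists i, j.
by exists j, i; rewrite faceC.
Qed.

Lemma measurable_Gamma : measurable (Gamma D : set areaT).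
Proof.
pose F (p : 'I_N * 'I_N) : set areaT := if (p.1 < p.2)%N then face p.1 p.2 else set0.
rewrite (_ : Gamma D = \bigcup_p F p).
  apply: countable_bigcupT_measurable => // -[i j]; rewrite /F.
  by case: ifP => // _; exact: measurable_face.
apply/seteqP; split=> x.
  by move=> /Gamma_faces[i [j [ij f]]]; exists (i, j) => //; rewrite /F /= ij.
move=> [[i j] _]; rewrite /F/=; case: ifP => // ij f.
by apply/Gamma_faces; exists i, j.
Qed.

Lemma measurable_Gamma_ i : measurable (Gamma_ D i : set areaT).
Proof. by apply: measurableI; [exact: measurable_Gamma|exact: area_measurable_boundary]. Qed.

Lemma area_complete : measure_is_complete area.
Proof. exact: measure_is_complete_caratheodory. Qed.

(** At least three subdomains meet at a point of two different interfaces, and such points form a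
    null set. *)
Lemma face_unique_ae : {ae area, forall x : E, forall i j k l,
  (i < j)%N -> (k < l)%N -> face i j x -> face k l x -> i = k /\ j = l}.
Proof.
apply: area_aeS (triple_ae D) => x tri i j k l ij kl fij fkl.
have [bi bj] := face_boundary fij; have [bk bl] := face_boundary fkl.
have ij' : i != j by rewrite neq_ltn ij.
have kl' : k != l by rewrite neq_ltn kl.
have h m : boundary (sub D m) x -> m = i \/ m = j.
  move=> bm; have [->|mi] := eqVneq m i; first by left.
  have [->|mj] := eqVneq m j; first by right.
  by have [] := tri i j m ij' _ _ bi bj bm; rewrite eq_sym.
have [kE|kE] := h k bk; have [lE|lE] := h l bl; split=> //; move: kl; rewrite kE lE ?ltnn//.
- by rewrite ltnNge ltnW.
- by rewrite ltnNge ltnW.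
Qed.

Lemma face_ae_split : {ae area, forall x : E, forall i, Gamma_ D i x ->
  exists2 j, face i j x & forall k, face i k x -> k = j}.
Proof.
apply: area_aeS (triple_ae D) => x tri i [/Gamma_faces[k [l [kl f]]] bi].
have [bk bl] := face_boundary f; have kl' : k != l by rewrite neq_ltn kl.
have un j : face i j x -> forall k, face i k x -> k = j.
  move=> fj m fm; have [//|mj] := eqVneq m j.
  have [_ bj] := face_boundary fj; have [_ bm] := face_boundary fm.
  have [[im _] _] := fm; have [[ij _] _] := fj.
  by have [] := tri i m j im ij mj bi bm bj.
have [ik|ik] := eqVneq i k; first by subst k; exists l => //; exact: un.
have [il|il] := eqVneq i l.
  by subst l; rewrite faceC in f; exists k => //; exact: un.
by have [] := tri i k l ik il kl' bi bk bl.
Qed.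

(** The interfaces are disjoint up to a null set, so [f] is almost everywhere the sum of its
    restrictions, and the triangle inequality applies. *)
Lemma Gamma_L2 (f : E -> R) :
  (forall i j, (i < j)%N -> interface D i j -> L2 area (gamma D i j) f) ->
  L2 area (Gamma D) f /\
  nrm area (Gamma D) f <=
    \sum_(i < N) \sum_(j < N) (if `[< (i < j)%N /\ interface D i j >]
                   then nrm area (gamma D i j) f else 0).
Proof.
move=> L2f; pose cond (p : 'I_N * 'I_N) := `[< (p.1 < p.2)%N /\ interface D p.1 p.2 >].
pose F (p : 'I_N * 'I_N) : E -> R := if cond p then f \_ (gamma D p.1 p.2) else 0.
have gG p : cond p -> gamma D p.1 p.2 `<=` Gamma D.
  by move=> /asboolP[h1 h2] x gx; exists p.1, p.2.
have mG := measurable_Gamma.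
have sL := @L2_subspace _ _ _ area _ mG.
have L2F p : L2 area (Gamma D) (F p).
  rewrite /F; case: ifPn => [cp|_]; last exact: sL.1.
  apply: L2_restrict => //; [exact: measurable_gamma|exact: gG|].
  by move/asboolP : cp => -[]; exact: L2f.
have fE : {ae area, forall x : E, Gamma D x -> (\sum_p F p) x = f x}.
  apply: area_aeS face_unique_ae => x un /Gamma_faces[i [j [ij fij]]].
  have [int gij] := fij.
  have cij : cond (i, j) by apply/asboolP.
  rewrite fct_sumE (bigD1 (i, j))//= [X in _ + X]big1 ?addr0.
    by rewrite /F cij /patch ifT// inE.
  move=> [k l] klij; rewrite /F; case: ifPn => // /asboolP[/= kl intkl].
  rewrite /patch ifF//; apply/negbTE; rewrite notin_setE => gkl.
  have fkl : face k l x by [].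
  have [ik jl] := un _ _ _ _ ij kl fij fkl.
  by rewrite ik jl eqxx in klij.
have L2s : L2 area (Gamma D) (\sum_p F p) by apply: (subspace_sum sL) => p _; exact: L2F.
have L2fG : L2 area (Gamma D) f by exact: (L2_ae mG area_complete fE L2s).
split=> //; rewrite -(nrm_ae mG L2s L2fG fE).
apply: le_trans (semi_inner_triangle_sum (@ip_semi_inner _ _ _ area _ mG) L2F) _.
rewrite pair_bigA/=; apply: ler_sum => p _; rewrite -/(cond p) /F.
case: ifPn => [cp|_]; last by rewrite (linear_on0 sL (ip_linear mG sL.1)) sqrtr0.
by rewrite -[X in X <= _]/(nrm area (Gamma D) _) nrm_restrict//; exact: gG.
Qed.

Lemma sided_comb i a (f g : E -> R) :
  sided D i (a *: f + g) = a *: sided D i f + sided D i g.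
Proof.
apply/funext => x; rewrite [RHS](_ : _ = a * sided D i f x + sided D i g x)//.
rewrite /sided (_ : (a *: f + g) x = a * f x + g x)//.
by case: asboolP => // _; ring.
Qed.

Lemma sided_pos i j x f : (i < j)%N -> face i j x -> sided D i f x = f x.
Proof.
move=> ij [int g]; rewrite /sided; case: asboolP => // -[].
by exists j.
Qed.

(** The sign can be wrong only where a third subdomain [k] with [i < k] touches the face as well. *)
Lemma sided_neg_ae : {ae area, forall x : E, forall f i j,
  (j < i)%N -> face i j x -> sided D i f x = - f x}.
Proof.
apply: area_aeS (triple_ae D) => x tri f i j ji fij.
rewrite /sided; case: asboolP => // -[k [ik int gk]]; exfalso.
have [[_ bj] [bi bk]] := (face_boundary fij, gk).
apply: (tri i j k) => //; rewrite neq_ltn ?ji ?ik ?orbT//.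
by rewrite (ltn_trans ji ik).
Qed.

Lemma sided_L2 i f : L2 area (Gamma D) f -> L2 area (Gamma_ D i) (sided D i f).
Proof.
move=> L2f; have mi := measurable_Gamma_ i.
have [mf if2] : L2 area (Gamma_ D i) f.
  by apply: L2_subset L2f => //; [exact: measurable_Gamma|exact: subIsetl].
pose P : set areaT := [set x | exists j, [/\ (i < j)%N, interface D i j & gamma D i j x]].
have mP : measurable P.
  pose F j : set areaT := if (i < j)%N then face i j else set0.
  rewrite (_ : P = \bigcup_j F j).
    apply: countable_bigcupT_measurable => // j; rewrite /F.
    by case: ifP => // _; exact: measurable_face.
  apply/seteqP; split=> x.
    by move=> [j [ij int g]]; exists j => //; rewrite /F ij.
  by move=> [j _]; rewrite /F; case: ifP => // ij [int g]; exists j.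
(* Measurability is read off from the sign written as [2 * \1_P x - 1]. *)
have sE : sided D i f = fun x => (2 * \1_P x - 1) * f x.
  apply/funext => x; rewrite /sided indicE.
  have -> : (x \in P) = `[< exists j, [/\ (i < j)%N, interface D i j & gamma D i j x] >].
    by apply/idP/idP => [|/asboolP] h; [apply/asboolP; rewrite inE in h|rewrite inE].
  by case: asboolP => _ /=; ring.
have mI : measurable_fun (Gamma_ D i : set areaT) (\1_P : areaT -> R).
  exact: measurable_indic.
have m2 := measurable_funM (@measurable_cst _ _ _ _ (Gamma_ D i : set areaT) (2 : R)) mI.
have m1 := measurable_funB m2 (@measurable_cst _ _ _ _ (Gamma_ D i : set areaT) (1 : R)).
split; rewrite sE; first exact: (measurable_funM m1 mf).
apply: (@eq_integrable _ _ _ area _ mi _ _ _ if2) => x _ /=; congr EFin.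
by rewrite exprMn indicE; case: (x \in P) => /=; ring.
Qed.

End Faces.

(** * The discrete spaces *)

Lemma linear_on_pi (R : realType) (I : finType) (V : lmodType R) (S : I -> set V)
    (f : I -> V -> R) : (forall i, linear_on (S i) (f i)) ->
  linear_on [set u : I -> V | forall i, S i (u i)] (fun u => \sum_i f i (u i)).
Proof.
move=> lf a x y Sx Sy; rewrite mulr_sumr -big_split/=; apply: eq_bigr => i _.
exact: lf.
Qed.

Lemma linear_on_sym (R : realType) (V : lmodType R) (S : set V) (B : V -> V -> R) :
  semi_inner S B -> forall y, S y -> linear_on S (B^~ y).
Proof. by move=> [_ C L _] y Sy a u v Su Sv /=; rewrite ![B _ y]C L. Qed.

Section Discrete.
Context (R : realType) (n N : nat) (D : @decomposition R n N).
Local Notation E := 'rV[R]_n.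
Local Notation volT := (caratheodory_type (lebesgue_outer_measure R n)).
Local Notation areaT := (caratheodory_type (hausdorff_outer_measure R n n.-1)).
Local Notation area := (area R n).
Local Notation vol := (vol R n).
Local Notation hfield := (@hfield R n).
Implicit Types (i j k l : 'I_N).

Lemma measurable_sub i : measurable (sub D i : set volT).
Proof. by apply: vol_measurable_open; exact: open_sub. Qed.

Lemma measurable_dom : measurable (dom D : set volT).
Proof. by apply: vol_measurable_open; case: (dom_polygonal D). Qed.

Lemma vol_complete : measure_is_complete vol.
Proof. exact: measure_is_complete_caratheodory. Qed.

(** Square integrability alone: it suffices for the forms and norms and involves neither Green's
    formula nor traces. *)
Definition Hdiv i : set hfield :=
  [set v | vL2 (sub D i) (fld v) /\ L2 vol (sub D i) (dvg v)].

Definition hdiv_ip i (u v : hfield) : R :=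
  vip (sub D i) (fld u) (fld v) + ip vol (sub D i) (dvg u) (dvg v).

Lemma L2_semi_inner i : semi_inner [set f | L2 vol (sub D i) f] (ip vol (sub D i)).
Proof. exact: (@ip_semi_inner _ _ _ vol _ (measurable_sub i)). Qed.

Lemma vL2_semi_inner i : semi_inner [set f | vL2 (sub D i) f] (vip (sub D i)).
Proof. exact: (vip_semi_inner (measurable_sub i)). Qed.

Lemma trace_semi_inner i : semi_inner [set f | L2 area (Gamma_ D i) f] (ip area (Gamma_ D i)).
Proof. exact: (@ip_semi_inner _ _ _ area _ (measurable_Gamma_ D i)). Qed.

Lemma hdiv_semi_inner i : semi_inner (Hdiv i) (hdiv_ip i).
Proof.
have [s1 c1 l1 p1] := vL2_semi_inner i; have [s2 c2 l2 p2] := L2_semi_inner i.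
split.
- split; first by split; [exact: s1.1|exact: s2.1].
  move=> a u v [u1 u2] [v1 v2].
  by split; [exact: (s1.2 a _ _ u1 v1)|exact: (s2.2 a _ _ u2 v2)].
- by move=> u v; rewrite /hdiv_ip c1 c2.
- move=> u [u1 u2] a v w [v1 v2] [w1 w2]; rewrite /hdiv_ip.
  rewrite (l1 _ u1 a _ _ v1 w1) (l2 _ u2 a _ _ v2 w2).
  by rewrite mulrDr addrACA.
- by move=> u [u1 u2]; apply: addr_ge0; [exact: p1|exact: p2].
Qed.

Lemma div_normE i v : Hdiv i v -> div_norm D i v = Num.sqrt (hdiv_ip i v v).
Proof.
move=> [v1 v2]; rewrite /div_norm /vnrm /nrm !sqr_sqrtr//.
  by have [_ _ _ p] := L2_semi_inner i; exact: p.
by have [_ _ _ p] := vL2_semi_inner i; exact: p.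
Qed.

Lemma div_norm_ge0 i v : 0 <= div_norm D i v.
Proof. exact: sqrtr_ge0. Qed.

Lemma vnrm_le_div_norm i v : vnrm (sub D i) (fld v) <= div_norm D i v.
Proof.
rewrite -[leLHS]ger0_norm ?sqrtr_ge0// -sqrtr_sqr ler_wsqrtr// lerDl.
exact: sqr_ge0.
Qed.

Lemma nrm_le_div_norm i v : nrm vol (sub D i) (dvg v) <= div_norm D i v.
Proof.
rewrite -[leLHS]ger0_norm ?sqrtr_ge0// -sqrtr_sqr ler_wsqrtr// lerDr.
exact: sqr_ge0.
Qed.

Lemma div_norm_le i v : div_norm D i v <= vnrm (sub D i) (fld v) + nrm vol (sub D i) (dvg v).
Proof.
have h1 : 0 <= vnrm (sub D i) (fld v) by exact: sqrtr_ge0.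
have h2 : 0 <= nrm vol (sub D i) (dvg v) by exact: sqrtr_ge0.
rewrite -[leRHS]ger0_norm ?addr_ge0// -sqrtr_sqr ler_wsqrtr// sqrrD.
by rewrite lerD2r lerDl mulrn_wge0// mulr_ge0.
Qed.

Variables (K : E -> 'M[R]_n) (kmin kmax : R) (tK : tensor_field (dom D) K kmin kmax).

Lemma sub_in_dom i : sub D i `<=` dom D.
Proof. by move=> x; exact: sub_dom. Qed.

Definition aform i (u v : hfield) : R := vip (sub D i) (Kinv K (fld u)) (fld v).

Lemma aform_linearr i u : Hdiv i u -> linear_on (Hdiv i) (aform i u).
Proof.
move=> [u1 _]; have [_ _ L _] := vL2_semi_inner i.
move=> a v w [v1 _] [w1 _]; rewrite /aform.
exact: (L _ (Kinv_vL2 (measurable_sub i) tK (sub_in_dom (i:=i)) measurable_dom u1) a _ _ v1 w1).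
Qed.

Lemma aform_linearl i v : Hdiv i v -> linear_on (Hdiv i) (aform i ^~ v).
Proof.
move=> [v1 _] a u w [u1 _] [w1 _]; rewrite /aform.
exact: (vip_Kinv_linearl (measurable_sub i) tK (sub_in_dom (i:=i)) measurable_dom v1 a u1 w1).
Qed.

Lemma aform_coercive i u : Hdiv i u -> vnrm (sub D i) (fld u) ^+ 2 <= kmax * aform i u u.
Proof.
move=> [u1 _].
exact: (Kinv_coercive (measurable_sub i) tK (sub_in_dom (i:=i)) measurable_dom u1).
Qed.

Lemma aform_bound i u v : Hdiv i u -> Hdiv i v ->
  `|aform i u v| <= kmin^-1 * vnrm (sub D i) (fld u) * vnrm (sub D i) (fld v).
Proof.
move=> [u1 _] [v1 _].
exact: (Kinv_cs (measurable_sub i) tK (sub_in_dom (i:=i)) measurable_dom u1 v1).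
Qed.

Lemma aform_null i u v : Hdiv i u -> Hdiv i v -> vnrm (sub D i) (fld v) = 0 -> aform i u v = 0.
Proof.
move=> Hu Hv v0; apply/eqP; rewrite -normr_le0.
by have := aform_bound Hu Hv; rewrite v0 mulr0.
Qed.

Variables (c s h : R) (T : @discretization R n N) (adm : admissible D c s h T).

Lemma Vh_subspace i : subspace (Vh T i).
Proof. exact: fds_subspace (adm_V adm i). Qed.

Lemma Wh_subspace i : subspace (Wh T i).
Proof. exact: fds_subspace (adm_W adm i). Qed.

Lemma Vh_Hdiv i v : Vh T i v -> Hdiv i v.
Proof. by move=> /(adm_V_Hdiv adm)[]. Qed.

Lemma Vh_trace i v : Vh T i v -> L2 area (Gamma_ D i) (trc v).
Proof. by move=> /(adm_V_Hdiv adm)[]. Qed.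

Lemma Wh_L2 i w : Wh T i w -> L2 vol (sub D i) w.
Proof. exact: (adm_W_L2 adm). Qed.

Lemma V0_Vh i v : V0 D T i v -> Vh T i v.
Proof. by case. Qed.

Lemma V0_subspace i : subspace (V0 D T i).
Proof.
split; first by split; [exact: (Vh_subspace i).1|exact: area_aeW].
move=> a u v [Vu u0] [Vv v0]; split; first exact: (Vh_subspace i).2.
apply: area_aeS (area_aeI u0 v0) => x [h1 h2] Gx.
rewrite [LHS](_ : _ = a * trc u x + trc v x)//.
by rewrite h1// h2// mulr0 addr0.
Qed.

Lemma V0_fds i : finite_dim_subspace (V0 D T i).
Proof. by apply: (fds_sub (adm_V adm i)); [move=> v []|exact: V0_subspace]. Qed.

(** Finite volume of the subdomain, read off from the discrete space, which contains a function
    equal to 1 almost everywhere. *)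
Lemma cst1_L2 i : L2 vol (sub D i) (cst 1).
Proof.
have [w Ww w1] := adm_W_cst adm i.
exact: (L2_ae (measurable_sub i) vol_complete w1 (Wh_L2 Ww)).
Qed.

Lemma cst_L2 i r : L2 vol (sub D i) (cst r).
Proof.
have [sL _ _ _] := L2_semi_inner i.
rewrite (_ : cst r = r *: (cst 1 : E -> R)); first exact: subspaceZ sL r _ (cst1_L2 i).
by apply/funext => x; rewrite [RHS]mulr1.
Qed.

Lemma Wh_cst i r : exists2 w, Wh T i w & {ae vol, forall x : E, sub D i x -> w x = r}.
Proof.
have [w Ww w1] := adm_W_cst adm i.
exists (r *: w); first exact: subspaceZ (Wh_subspace i) r _ Ww.
by apply: vol_aeS w1 => x h1 Dx; rewrite [LHS](_ : _ = r * w x)// h1// mulr1.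
Qed.

(** The divergence theorem: the constant 1 is an admissible test function because no part of the
    boundary lies outside [Gamma]. *)
Lemma interior_flux i v : is_interior D i -> in_Hdiv D i v ->
  ip vol (sub D i) (dvg v) (cst 1) = ip area (Gamma_ D i) (trc v) (cst 1).
Proof.
move=> int [_ _ _ green].
have C1c : C1 (cst 1 : E -> R).
  split; first by move=> x; exact: differentiable_cst.
  move=> k; rewrite (_ : (fun x => _) = cst 0); first exact: cst_continuous.
  by apply/funext => x; rewrite mxE derive_cst.
rewrite /ip -green//; last by move=> x /int.
apply: eq_Rintegral => x _.
rewrite [dotp _ _](_ : _ = 0) ?add0r//.
by rewrite /dotp big1// => k _; rewrite mxE derive_cst mulr0.
Qed.

Lemma V0_flux i v : is_interior D i -> V0 D T i v -> ip vol (sub D i) (dvg v) (cst 1) = 0.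
Proof.
move=> int [Vv v0]; rewrite (interior_flux int (adm_V_Hdiv adm Vv)).
have [mt _] := Vh_trace Vv.
transitivity (\int[area]_(x in Gamma_ D i) (cst 0 x : R)).
  apply: (@Rintegral_ae _ _ _ area _ (measurable_Gamma_ D i)).
  - exact: (measurable_funM mt (@measurable_cst _ _ _ _ _ (1 : R))).
  - exact: measurable_cst.
  - by apply: area_aeS v0 => x h1 Gx; rewrite h1// mul0r.
by rewrite (@Rintegral_cst _ _ _ area _ (measurable_Gamma_ D i)) mul0r.
Qed.

(** The local inf-sup condition, recast as a bound by a dual norm. The absolute value is there
    because [c] comes without a sign. *)
Lemma infsup0_bound i w G : Wh T i w -> (forall r, SH D i r -> ip vol (sub D i) w (cst r) = 0) ->
  0 <= G ->
  (forall v, V0 D T i v -> `|ip vol (sub D i) (dvg v) w| <= G * div_norm D i v) ->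
  nrm vol (sub D i) w <= `|c| * G.
Proof.
move=> Ww wS G0 vG; have [->|wn0] := eqVneq (nrm vol (sub D i) w) 0; first exact: mulr_ge0.
have [v [V0v vn0 vw]] := adm_infsup0 adm Ww wS wn0.
have v0 : 0 < div_norm D i v by rewrite lt_neqAle eq_sym vn0 div_norm_ge0.
rewrite -(ler_pM2l v0); apply: (le_trans vw).
apply: le_trans (ler_norm _) _; rewrite normrM mulrCA ler_wpM2l//.
by rewrite mulrC; exact: vG.
Qed.

End Discrete.

(** * The local saddle point problem *)

Section Extension.
Context (R : realType) (n N : nat) (D : @decomposition R n N).
Local Notation E := 'rV[R]_n.
Local Notation area := (area R n).
Local Notation vol := (vol R n).
Local Notation hfield := (@hfield R n).
Implicit Types (i j k l : 'I_N).
Variables (K : E -> 'M[R]_n) (kmin kmax : R) (tK : tensor_field (dom D) K kmin kmax).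
Variables (c s h : R) (T : @discretization R n N) (adm : admissible D c s h T).
Local Notation aform := (aform D K).

Local Notation bform i v w := (ip vol (sub D i) (dvg v) w).

Lemma dvg_comb a (u v : hfield) : dvg (a *: u + v) = a *: dvg u + dvg v.
Proof. by []. Qed.

Lemma trc_comb a (u v : hfield) : trc (a *: u + v) = a *: trc u + trc v.
Proof. by []. Qed.

Lemma cst_comb (a r q : R^o) : cst (a *: r + q) = a *: cst r + cst q :> (E -> R).
Proof. by []. Qed.

Lemma ip_linr i f : L2 vol (sub D i) f ->
  linear_on [set g | L2 vol (sub D i) g] (ip vol (sub D i) f).
Proof. by have [_ _ L _] := L2_semi_inner D i; exact: L. Qed.

Lemma ip_linl i f : L2 vol (sub D i) f ->
  linear_on [set g | L2 vol (sub D i) g] ((ip vol (sub D i))^~ f).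
Proof. by move=> L2f; exact: (linear_on_sym (L2_semi_inner D i) L2f). Qed.

Lemma ip0r i f : L2 vol (sub D i) f -> ip vol (sub D i) f 0 = 0.
Proof.
by move=> L2f; have [sL _ _ _] := L2_semi_inner D i; exact: (linear_on0 sL (ip_linr L2f)).
Qed.

Lemma ip0l i f : L2 vol (sub D i) f -> ip vol (sub D i) 0 f = 0.
Proof. by move=> L2f; rewrite ipC ip0r. Qed.

Lemma aform0r i u : Hdiv D i u -> aform i u 0 = 0.
Proof.
by move=> Hu; have [sH _ _ _] := hdiv_semi_inner D i; exact: (linear_on0 sH (aform_linearr tK Hu)).
Qed.

Lemma aform0l i u : Hdiv D i u -> aform i 0 u = 0.
Proof.
by move=> Hu; have [sH _ _ _] := hdiv_semi_inner D i; exact: (linear_on0 sH (aform_linearl tK Hu)).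
Qed.

Lemma aform_def i v : Hdiv D i v -> aform i v v = 0 -> vnrm (sub D i) (fld v) = 0.
Proof.
move=> Hv v0; have := aform_coercive tK Hv; rewrite v0 mulr0 => h0.
by apply/eqP; rewrite -sqrf_eq0 eq_le h0 sqr_ge0.
Qed.

Lemma SH_subspace i : subspace (SH D i : set R^o).
Proof.
split; first by [].
by move=> a x y Sx Sy ni; rewrite Sx// Sy// scaler0 addr0.
Qed.

Lemma SH_fds i : finite_dim_subspace (SH D i : set R^o).
Proof.
apply: (@fds_sub _ _ [set: R^o]) => //; last exact: SH_subspace.
exists 1%N, (fun=> 1); apply/seteqP; split=> // x _.
by exists (fun=> x) => //; rewrite big_ord1 /GRing.scale/= mulr1.
Qed.

(** The correction [u] stays in [V0], so the trace of [g] is kept. For a kernel vector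
    [((v, w), q)], the field [v] has zero energy and then [w] is null by the inf-sup condition; [q]
    is left undetermined, but the load [L] does not see it. *)
Lemma local_extension i g : Vh T i g -> exists u p r, [/\ V0 D T i u, Wh T i p, SH D i r &
  [/\ forall v, V0 D T i v -> aform i (u + g) v - bform i v p = 0,
      forall w, Wh T i w -> bform i (u + g) w - ip vol (sub D i) (cst r) w = 0 &
      forall q, SH D i q -> ip vol (sub D i) p (cst q) = 0]].
Proof.
move=> Vg; have Hg := Vh_Hdiv adm Vg.
have VH v : V0 D T i v -> Hdiv D i v by move=> /V0_Vh; exact: (Vh_Hdiv adm).
have dL v : Hdiv D i v -> L2 vol (sub D i) (dvg v) by case.
have WL w : Wh T i w -> L2 vol (sub D i) w by exact: (Wh_L2 adm).
have cL r : L2 vol (sub D i) (cst r) by exact: (cst_L2 adm).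
pose X : lmodType R := ((hfield * (E -> R)) * R^o)%type.
pose S : set X := (V0 D T i `*` Wh T i) `*` (SH D i : set R^o).
have Xcomb a (v v' : hfield) (w w' : E -> R) (q q' : R^o) :
  a *: ((v, w), q) + ((v', w'), q') = ((a *: v + v', a *: w + w'), a *: q + q') :> X.
  by reflexivity.
pose B (x y : X) : R := aform i x.1.1 y.1.1 - bform i y.1.1 x.1.2 + bform i x.1.1 y.1.2
  - ip vol (sub D i) (cst x.2) y.1.2 + ip vol (sub D i) x.1.2 (cst y.2).
pose L (y : X) : R := - aform i g y.1.1 - bform i g y.1.2.
have BE u p r v w q : B ((u, p), r) ((v, w), q) = aform i u v - bform i v p + bform i u w
  - ip vol (sub D i) (cst r) w + ip vol (sub D i) p (cst q) by reflexivity.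
have LE v w q : L ((v, w), q) = - aform i g v - bform i g w by reflexivity.
have c0l f : L2 vol (sub D i) f -> ip vol (sub D i) (cst 0) f = 0 by exact: ip0l.
have c0r f : L2 vol (sub D i) f -> ip vol (sub D i) f (cst 0) = 0 by exact: ip0r.
have d0 : dvg 0 = 0 :> (E -> R) by reflexivity.
have V00 := (V0_subspace adm i).1; have W00 := (Wh_subspace adm i).1.
have SH0 := (SH_subspace i).1.
have H0 := VH _ V00; have L0 := WL _ W00.
have fS : finite_dim_subspace S.
  apply: fds_prod; last exact: SH_fds.
  by apply: fds_prod; [exact: V0_fds adm i|exact: (adm_W adm)].
have linr x : S x -> linear_on S (B x).
  move: x => [[u p] r] [[/VH Hx /WL Lx] _] a [[y1 y2] y3] [[z1 z2] z3].
  move=> [[/VH Hy /WL Ly] _] [[/VH Hz /WL Lz] _].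
  have e1 := aform_linearr tK Hx a Hy Hz.
  have e2 := ip_linl Lx a (dL _ Hy) (dL _ Hz).
  have e3 := ip_linr (dL _ Hx) a Ly Lz.
  have e4 := ip_linr (cL r) a Ly Lz.
  have e5 := ip_linr Lx a (cL y3) (cL z3).
  by rewrite Xcomb !BE dvg_comb cst_comb e1 e2 e3 e4 e5; ring.
have linl y : S y -> linear_on S (B^~ y).
  move: y => [[v w] q] [[/VH Hx /WL Lx] _] a [[u1 u2] u3] [[z1 z2] z3].
  move=> [[/VH Hy /WL Ly] _] [[/VH Hz /WL Lz] _].
  have e1 := aform_linearl tK Hx a Hy Hz.
  have e2 := ip_linr (dL _ Hx) a Ly Lz.
  have e3 := ip_linl Lx a (dL _ Hy) (dL _ Hz).
  have e4 := ip_linl Lx a (cL u3) (cL z3).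
  have e5 := ip_linl (cL q) a Ly Lz.
  by rewrite Xcomb !BE dvg_comb cst_comb e1 e2 e3 e4 e5; ring.
have ll : linear_on S L.
  move=> a [[y1 y2] y3] [[z1 z2] z3] [[/VH Hy /WL Ly] _] [[/VH Hz /WL Lz] _].
  have e1 := aform_linearr tK Hg a Hy Hz.
  have e3 := ip_linr (dL _ Hg) a Ly Lz.
  by rewrite Xcomb !LE e1 e3; ring.
have ker y : S y -> (forall x, S x -> B x y = 0) -> L y = 0.
  move: y => [[v w] q] [[/= V0v Ww] Sq] By.
  have Hv := VH _ V0v; have Lw := WL _ Ww.
  have k1 r : SH D i r -> ip vol (sub D i) w (cst r) = 0.
    move=> Sr; have := By ((0, 0), r) (conj (conj V00 W00) Sr); rewrite BE ?d0.
    rewrite (aform0l Hv) (ip0r (dL _ Hv)) (ip0l Lw) (ip0l (cL q)).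
    by rewrite ipC => h1; lra.
  have k2 p : Wh T i p -> bform i v p = ip vol (sub D i) p (cst q).
    move=> Wp; have := By ((0, p), 0) (conj (conj V00 Wp) SH0); rewrite BE ?d0.
    rewrite (aform0l Hv) (ip0l Lw) ?(c0l _ Lw).
    by move=> h1; lra.
  have k3 u : V0 D T i u -> aform i u v + bform i u w = 0.
    move=> Vu; have := By ((u, 0), 0) (conj (conj Vu W00) SH0); rewrite BE ?d0.
    rewrite (ip0r (dL _ Hv)) (ip0l (cL q)) ?(c0l _ Lw).
    by move=> h1; lra.
  (* Test with [v] itself: by [k2] its pairing with [w] equals that of [w] with the constant [q],
     which vanishes by [k1]. *)
  have v0 : vnrm (sub D i) (fld v) = 0.
    by apply: aform_def => //; have := k3 _ V0v; rewrite k2// k1// addr0.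
  have w0 : nrm vol (sub D i) w = 0.
    apply/eqP; rewrite eq_le nrm_ge0 andbT.
    rewrite -[leRHS](mulr0 `|c|); apply: (infsup0_bound adm Ww k1) => // u Vu.
    have := k3 _ Vu; rewrite (aform_null tK (VH _ Vu) Hv v0) add0r => ->.
    by rewrite normr0 mul0r.
  rewrite LE (aform_null tK Hg Hv v0) ipC.
  by rewrite (semi_inner_null (L2_semi_inner D i) Lw (dL _ Hg) w0); ring.
have [y Sy sol] := fds_solvable fS linr linl ll ker.
move: y Sy sol => [[u p] r] [[Vu Wp] Sr] sol.
exists u, p, r; have Hu := VH _ Vu.
have adu v : Hdiv D i v -> aform i (u + g) v = aform i u v + aform i g v.
  by move=> Hv; have := aform_linearl tK Hv 1 Hu Hg; rewrite scale1r mul1r.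
have bdu w : L2 vol (sub D i) w -> bform i (u + g) w = bform i u w + bform i g w.
  by move=> Lw; have := ip_linl Lw 1 (dL _ Hu) (dL _ Hg); rewrite scale1r mul1r.
split=> //; split.
- move=> v V0v; have Hv := VH _ V0v.
  have := sol ((v, 0), 0) (conj (conj V0v W00) SH0); rewrite BE LE ?d0.
  rewrite (ip0r (dL _ Hu)) (ip0r (cL r)) (ip0r (dL _ Hg)).
  rewrite (c0r _ (WL _ Wp)).
  by rewrite adu// => h1; lra.
- move=> w Ww; have := sol ((0, w), 0) (conj (conj V00 Ww) SH0); rewrite BE LE ?d0.
  rewrite (aform0r Hu) (aform0r Hg) (ip0l (WL _ Wp)).
  rewrite (c0r _ (WL _ Wp)).
  by rewrite bdu//; [move=> h1; lra|exact: WL].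
- move=> q Sq; have := sol ((0, 0), q) (conj (conj V00 W00) Sq); rewrite BE LE ?d0.
  rewrite (aform0r Hu) (aform0r Hg) (ip0l (WL _ Wp)).
  rewrite (ip0r (dL _ Hu)) (ip0r (cL r)) (ip0r (dL _ Hg)).
  by move=> h1; lra.
Qed.

End Extension.

(** * Projections of mortar functions and the trace description of the flux space *)

Section Projection.
Context (R : realType) (n N : nat) (D : @decomposition R n N).
Local Notation E := 'rV[R]_n.
Local Notation area := (area R n).
Local Notation vol := (vol R n).
Local Notation hfield := (@hfield R n).
Implicit Types (i j k l : 'I_N).
Variables (K : E -> 'M[R]_n) (kmin kmax : R) (tK : tensor_field (dom D) K kmin kmax).
Variables (c s h : R) (T : @discretization R n N) (adm : admissible D c s h T).
Local Notation "( f , g )_Gamma[ i ]" := (ip area (Gamma_ D i) f g).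

Lemma Lambda_L2 mu : Lambda_h D T mu -> L2 area (Gamma D) mu.
Proof.
move=> Lmu; apply: (Gamma_L2 _).1 => i j ij int.
have [nu Lnu munu] := Lmu i j ij int.
apply: (L2_ae (measurable_gamma D i j) (@area_complete R n) _ (adm_L_L2 adm ij int Lnu)).
by apply: area_aeS munu => x h1 gx; rewrite h1.
Qed.

Lemma Lambda_subspace : subspace (Lambda_h D T).
Proof.
have Ls i j (ij : (i < j)%N) (int : interface D i j) := fds_subspace (adm_L adm ij int).
split=> [i j ij int|a mu mu' Lmu Lmu' i j ij int].
  by exists 0; [exact: (Ls _ _ ij int).1|exact: area_aeW].
have [nu Lnu e] := Lmu i j ij int; have [nu' Lnu' e'] := Lmu' i j ij int.
exists (a *: nu + nu'); first exact: (Ls _ _ ij int).2.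
apply: area_aeS (area_aeI e e') => x [h1 h2] gx.
rewrite [LHS](_ : _ = a * mu x + mu' x)// h1// h2//.
Qed.

Lemma sided_Lambda_L2 i mu : Lambda_h D T mu -> L2 area (Gamma_ D i) (sided D i mu).
Proof. by move=> /Lambda_L2; exact: sided_L2. Qed.

Lemma Lambda_L2_ i mu : Lambda_h D T mu -> L2 area (Gamma_ D i) mu.
Proof.
move=> /Lambda_L2; apply: L2_subset; [exact: measurable_Gamma_|exact: measurable_Gamma|].
exact: subIsetl.
Qed.

Lemma VGamma_fds i : finite_dim_subspace (VGamma T i).
Proof. by apply: fds_image (adm_V adm i). Qed.

Lemma VGamma_L2 i xi : VGamma T i xi -> L2 area (Gamma_ D i) xi.
Proof. by move=> [v /(Vh_trace adm) + <-]. Qed.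

Lemma trace_linr i f : L2 area (Gamma_ D i) f ->
  linear_on (VGamma T i) (ip area (Gamma_ D i) f).
Proof.
move=> L2f; have [_ _ L _] := trace_semi_inner D i.
exact: linear_onS (@VGamma_L2 i) (L _ L2f).
Qed.

Lemma trace_linl i f : L2 area (Gamma_ D i) f ->
  linear_on (VGamma T i) ((ip area (Gamma_ D i))^~ f).
Proof.
move=> L2f; exact: linear_onS (@VGamma_L2 i) (linear_on_sym (trace_semi_inner D i) L2f).
Qed.

Lemma VGamma_c_subspace : subspace (VGamma_c D T).
Proof.
have Vs i := fds_subspace (VGamma_fds i).
split.
  split=> [i|mu Lmu]; first exact: (Vs i).1.
  by rewrite big1// => i _; exact: (linear_on0 (Vs i) (trace_linl (Lambda_L2_ i Lmu))).
move=> a x y [Vx cx] [Vy cy]; split=> [i|mu Lmu]; first exact: (Vs i).2.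
have := @linear_on_pi R _ _ (VGamma T) _ (fun i => trace_linl (Lambda_L2_ i Lmu)) a x y Vx Vy.
by move=> ->; rewrite cx// cy// mulr0 addr0.
Qed.

Lemma VGamma_c_fds : finite_dim_subspace (VGamma_c D T).
Proof.
apply: (fds_sub (fds_pi VGamma_fds)); last exact: VGamma_c_subspace.
by move=> x [].
Qed.

Lemma projection_VGamma b mu xi i : is_projection D b T mu xi -> VGamma T i (xi i).
Proof. by case: b => [h1|[[h1 _] _]]; [case: (h1 i)|exact: h1]. Qed.

(** The Gram form may degenerate, but by Cauchy-Schwarz the load vanishes on every trace of norm
    zero, which is all that [fds_solvable] asks. *)
Lemma projection_exists b mu : Lambda_h D T mu -> exists xi, is_projection D b T mu xi.
Proof.
move=> Lmu; have sL i := sided_Lambda_L2 i Lmu.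
case: b.
- have ex i : exists xi, VGamma T i xi /\
      forall eta, VGamma T i eta -> (xi, eta)_Gamma[i] = (sided D i mu, eta)_Gamma[i].
    have [||||xi Vxi xiE] := @fds_solvable R _ _ (ip area (Gamma_ D i))
        (ip area (Gamma_ D i) (sided D i mu)) (VGamma_fds i).
    + by move=> f /VGamma_L2; exact: trace_linr.
    + by move=> f /VGamma_L2; exact: trace_linl.
    + exact: trace_linr.
    + move=> eta Veta e0; rewrite ipC; have Le := VGamma_L2 Veta.
      by apply: (semi_inner_null (trace_semi_inner D i) Le (sL i)); rewrite e0// sqrtr0.
    + by exists xi.
  exists (fun i => projT1 (cid (ex i))) => i; exact: projT2 (cid (ex i)).
- have VL x i : VGamma_c D T x -> L2 area (Gamma_ D i) (x i).
    by move=> [Vx _]; exact: VGamma_L2.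
  have sub : VGamma_c D T `<=` [set u | forall i, VGamma T i (u i)] by move=> x [].
  have [||||xi Vxi xiE] := @fds_solvable R _ _
        (fun x y => \sum_i (x i, y i)_Gamma[i])
        (fun y => \sum_i (sided D i mu, y i)_Gamma[i]) VGamma_c_fds.
  + move=> x Vx; apply: (linear_onS sub).
    exact: (@linear_on_pi R _ _ (VGamma T) _ (fun i => trace_linr (VL x i Vx))).
  + move=> x Vx; apply: (linear_onS sub).
    exact: (@linear_on_pi R _ _ (VGamma T) _ (fun i => trace_linl (VL x i Vx))).
  + apply: (linear_onS sub).
    exact: (@linear_on_pi R _ _ (VGamma T) _ (fun i => trace_linr (sL i))).
  + move=> eta Veta e0.
    have := e0 _ Veta => /eqP; rewrite psumr_eq0; last by move=> i _; exact: ip_ge0.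
    move=> /allP e0'; rewrite big1// => i _; rewrite ipC.
    apply: (semi_inner_null (trace_semi_inner D i) (VL _ i Veta) (sL i)).
    by have /eqP -> := e0' i (mem_index_enum _); rewrite sqrtr0.
  + by exists xi.
Qed.

Lemma projection_comb b a mu xi mu' xi' :
  Lambda_h D T mu -> Lambda_h D T mu' ->
  is_projection D b T mu xi -> is_projection D b T mu' xi' ->
  is_projection D b T (a *: mu + mu') (a *: xi + xi').
Proof.
move=> Lmu Lmu' P P'.
have Vxi i := projection_VGamma i P; have Vxi' i := projection_VGamma i P'.
have key i eta : VGamma T i eta ->
    (a *: xi i + xi' i, eta)_Gamma[i] = a * (xi i, eta)_Gamma[i] + (xi' i, eta)_Gamma[i].
  by move=> /VGamma_L2 Le; exact: (trace_linl Le a (Vxi i) (Vxi' i)).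
have keys i eta : VGamma T i eta -> (sided D i (a *: mu + mu'), eta)_Gamma[i] =
    a * (sided D i mu, eta)_Gamma[i] + (sided D i mu', eta)_Gamma[i].
  move=> /VGamma_L2 Le; rewrite sided_comb.
  have := linear_on_sym (trace_semi_inner D i) Le.
  by move=> /(_ a _ _ (sided_Lambda_L2 i Lmu) (sided_Lambda_L2 i Lmu')).
case: b P P' => [P P' i|[cP P] [cP' P']].
  split; first exact: (fds_subspace (VGamma_fds i)).2.
  move=> eta Veta; rewrite key// keys//.
  by rewrite (P i).2// (P' i).2.
split; first exact: VGamma_c_subspace.2.
move=> eta Ceta; have Veta := Ceta.1.
under eq_bigr do rewrite key//.
under [RHS]eq_bigr do rewrite keys//.
by rewrite !big_split/= -!mulr_sumr P// P'.
Qed.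

Lemma mortar_of_trace b u lam : mortar_of D K b T u lam ->
  Lambda_h D T lam /\ exists xi, [/\ is_projection D b T lam xi, forall i, Vh T i (u i) &
    forall i, {ae area, forall x : E, Gamma_ D i x -> trc (u i) x = xi i x}].
Proof.
move=> [Llam [u0 [Rl [Vu0 [xi P ext] uE]]]]; split=> //; exists xi; split=> // i.
  have [p [r [VR _ _ _]]] := ext i.
  by rewrite uE; exact: (subspaceD (Vh_subspace adm i) (V0_Vh (Vu0 i)) VR).
have [p [r [_ _ _ [_ _ _ tR]]]] := ext i.
apply: area_aeS (area_aeI (Vu0 i).2 tR) => x [h1 h2] Gx.
by rewrite uE [LHS](_ : _ = trc (u0 i) x + trc (Rl i) x)// h1// h2// add0r.
Qed.

(** From right to left, [local_extension] corrects [u] by some [w] in [V0] to an extension of [mu],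
    and [- w] goes into the [V_h^0] part. Thereby the extension operator disappears from the rest of
    the proof. *)
Lemma VspaceP b u : Vspace D K b T u <->
  (forall i, Vh T i (u i)) /\ exists mu xi, [/\ Lambda_h D T mu, is_projection D b T mu xi &
    forall i, {ae area, forall x : E, Gamma_ D i x -> trc (u i) x = xi i x}].
Proof.
split=> [[mu /mortar_of_trace[Lmu [xi [P Vu tu]]]]|[Vu [mu [xi [Lmu P tu]]]]].
  by split=> //; exists mu, xi.
exists mu; split=> //.
have ex i : exists w, V0 D T i w /\ exists p r, [/\ Vh T i (w + u i), Wh T i p, SH D i r &
    [/\ forall v, V0 D T i v ->
          vip (sub D i) (Kinv K (fld (w + u i))) (fld v) - ip vol (sub D i) (dvg v) p = 0,
        forall w', Wh T i w' ->
          ip vol (sub D i) (dvg (w + u i)) w' - ip vol (sub D i) (cst r) w' = 0,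
        forall q, SH D i q -> ip vol (sub D i) p (cst q) = 0 &
        {ae area, forall x, Gamma_ D i x -> trc (w + u i) x = xi i x}]].
  have [w [p [r [Vw Wp Sr [e1 e2 e3]]]]] := local_extension tK adm (Vu i).
  exists w; split=> //; exists p, r; split=> //.
    exact: subspaceD (Vh_subspace adm i) _ _ (V0_Vh Vw) (Vu i).
  split=> //.
  apply: area_aeS (area_aeI Vw.2 (tu i)) => x [h1 h2] Gx.
  by rewrite [LHS](_ : _ = trc w x + trc (u i) x)// h1// h2// add0r.
pose w i := projT1 (cid (ex i)).
have wP i := projT2 (cid (ex i)).
exists (fun i => - w i), (fun i => w i + u i); split.
- move=> i; have Vw : V0 D T i (w i) by case: (wP i).
  have sV := V0_subspace adm i.
  by rewrite -[- w i]add0r; apply: (subspaceB sV) => //; exact: sV.1.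
- exists xi => // i; have [_ [p [r h1]]] := wP i.
  by exists p, r.
- by move=> i; rewrite addKr.
Qed.

Lemma Vspace_subspace b : subspace (Vspace D K b T).
Proof.
have Vs i := Vh_subspace adm i.
split.
  apply/VspaceP; split=> [i|]; first exact: (Vs i).1.
  have L0 := Lambda_subspace.1; have [xi P] := projection_exists b L0.
  exists 0, 0; split=> //; last by move=> i; exact: area_aeW.
  by have := projection_comb (-1) L0 L0 P P; rewrite !scaleN1r !addNr.
move=> a u v /VspaceP[Vu [mu [xi [Lmu P tu]]]] /VspaceP[Vv [mu' [xi' [Lmu' P' tv]]]].
apply/VspaceP; split=> [i|]; first exact: (Vs i).2.
exists (a *: mu + mu'), (a *: xi + xi'); split.
- exact: Lambda_subspace.2.
- exact: projection_comb.
- move=> i; apply: area_aeS (area_aeI (tu i) (tv i)) => x [h1 h2] Gx.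
  rewrite [LHS](_ : _ = a * trc (u i) x + trc (v i) x)// h1// h2//.
Qed.

Lemma Vspace_Vh b u i : Vspace D K b T u -> Vh T i (u i).
Proof. by move=> /VspaceP[]. Qed.

Lemma Vspace_fds b : finite_dim_subspace (Vspace D K b T).
Proof.
apply: (fds_sub (fds_pi (adm_V adm))); last exact: Vspace_subspace.
by move=> u Vu i; exact: (Vspace_Vh i Vu).
Qed.

Lemma Wspace_fds : finite_dim_subspace (Wspace T).
Proof. exact: (fds_pi (adm_W adm)). Qed.

(** Such a field has the same traces as the zero field, so a mortar function of the zero field
    serves for it. *)
Lemma V0_Vspace b i v : V0 D T i v -> Vspace D K b T (fun j => if j == i then v else 0).
Proof.
move=> V0v; have [/VspaceP[_ [mu [xi [Lmu P t0]]]] _] := Vspace_subspace b.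
apply/VspaceP; split=> [j|].
  by case: eqP => [->|_]; [case: V0v|exact: (Vh_subspace adm j).1].
exists mu, xi; split=> // j; have [->|_] := eqVneq j i; last exact: t0.
by apply: area_aeS (area_aeI (t0 i) V0v.2) => x [h1 h2] Gx; rewrite h2// -h1.
Qed.

End Projection.

(** * The coarse problem *)

Section Lift.
Context (R : realType) (n N : nat) (D : @decomposition R n N).
Local Notation E := 'rV[R]_n.
Local Notation area := (area R n).
Local Notation vol := (vol R n).
Local Notation volT := (caratheodory_type (lebesgue_outer_measure R n)).
Local Notation hfield := (@hfield R n).
Implicit Types (i j : 'I_N).

Definition face_fun i j : E -> R := (cst 1 : E -> R) \_ (gamma D i j).

Lemma face_funE i j x : face_fun i j x = if x \in gamma D i j then 1 else 0.
Proof. by []. Qed.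

(** A trace equal to 1 on the interface exists by assumption, and the splitting of traces removes
    what it does on the others. *)
Lemma face_fun_trace c s h (T : @discretization R n N) (adm : admissible D c s h T) i j :
  interface D i j -> exists2 v, Vh T i v &
  {ae area, forall x : E, Gamma_ D i x -> trc v x = face_fun i j x}.
Proof.
move=> int; have [eta Veta e1] := adm_trace_cst adm int.
have [_ [v Vv <-] e2] := adm_trace_split adm int Veta.
exists v => //; apply: area_aeS (area_aeI e1 e2) => x [h1 h2] Gx.
have [h3 h4] := h2 Gx; rewrite face_funE.
by case: ifPn; rewrite ?inE ?notin_setE => gx; [rewrite h3// h1|rewrite h4].
Qed.

Lemma face_fun_L2 c s h (T : @discretization R n N) (adm : admissible D c s h T) i j :
  interface D i j -> L2 area (Gamma_ D i) (face_fun i j).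
Proof.
move=> int; have [v Vv e] := face_fun_trace adm int.
exact: (L2_ae (measurable_Gamma_ D i) (@area_complete R n) e (Vh_trace adm Vv)).
Qed.

Lemma gamma_Gamma_ i j : interface D i j -> gamma D i j `<=` Gamma_ D i.
Proof. by move=> int; rewrite -(faceE int); exact: face_Gamma_. Qed.

Lemma ip_face_fun i j f : interface D i j ->
  ip area (Gamma_ D i) (face_fun i j) f = ip area (gamma D i j) (cst 1) f.
Proof. by move=> int; apply: ip_restrict; exact: gamma_Gamma_. Qed.

(** The indicator of the interface agrees almost everywhere with a discrete trace, hence is square
    integrable. *)
Lemma area_gamma_fin c s h (T : @discretization R n N) (adm : admissible D c s h T) i j :
  interface D i j -> (area (gamma D i j) < +oo)%E.
Proof.
move=> int; have := face_fun_L2 adm int; have mg := measurable_gamma D i j.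
move=> /(L2_subset mg (measurable_Gamma_ D i) (gamma_Gamma_ int)) [_ i1].
have {}i1 : area.-integrable (gamma D i j) (cst 1%E).
  apply: (@eq_integrable _ _ _ area _ mg _ _ _ i1) => x xg /=.
  by rewrite face_funE xg expr1n.
have /integrableP[_] := i1.
by rewrite (@eq_integral _ _ _ area _ (cst 1%E)) ?integral_cst ?mul1e// => x _ /=; rewrite normr1.
Qed.

Lemma bounded_Lp (s : R) i (u : E -> E) : 0 < s -> L2 vol (sub D i) (cst 1) ->
  vL2 (sub D i) u ->
  (forall k : 'I_n, exists B, {ae vol, forall x : E, sub D i x -> `|u x 0 k| <= B}) ->
  Lp_integrable (sub D i) s u.
Proof.
move=> s0 L1 vu ub; have mS := measurable_sub D i.
pose B k := projT1 (cid (ub k)).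
have BP (k : 'I_n) : {ae vol, forall x : E, sub D i x -> `|u x 0 k| <= B k}.
  exact: projT2 (cid (ub k)).
have md : measurable_fun (sub D i : set volT) (fun x => dotp (u x) (u x)).
  apply: measurable_sum => k; have [mk _] := vu k.
  exact: (measurable_funM mk mk).
(* The norm power becomes a power of the dot product, which is visibly measurable. *)
have powE x : enorm (u x) `^ s = dotp (u x) (u x) `^ (2^-1 * s).
  by rewrite /enorm -powR12_sqrt ?dotp_ge0// -powRrM.
apply: (@integrable_ae_bounded _ _ _ vol _ mS _ ((\sum_k B k ^+ 2) `^ (2^-1 * s)) L1).
  rewrite (_ : (fun x => _) = (fun x => dotp (u x) (u x) `^ (2^-1 * s))); last exact/funext.
  by have := measurableT_comp (@measurable_powR R (2^-1 * s)) md.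
apply: vol_aeS (vol_ae_forall BP) => x hB Sx.
rewrite powE ger0_norm ?powR_ge0// ge0_ler_powR//.
- by rewrite mulr_ge0// ltW.
- by rewrite nnegrE dotp_ge0.
- by rewrite nnegrE; apply: sumr_ge0 => k _; exact: sqr_ge0.
- apply: ler_sum => k _; rewrite -expr2 -real_normK ?num_real//.
  have hk := hB k Sx.
  by rewrite ler_sqr ?nnegrE//; exact: le_trans hk.
Qed.

Lemma Vh_Lp c s h (T : @discretization R n N) (adm : admissible D c s h T) i v :
  0 < s -> Vh T i v -> Lp_integrable (sub D i) s (fld v).
Proof.
move=> s0 Vv; have [vv _ _ _] := adm_V_Hdiv adm Vv.
apply: (bounded_Lp s0 (cst1_L2 adm i) vv).
move=> k; have [B hB] := piecewise_polynomial_bounded (adm_V_poly adm k Vv).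
have [_ _ _ null] := adm_vmesh adm i.
exists B; have hN : {ae vol, forall x : E, ~ (closure (sub D i) `\` mesh_set (vmesh T i)) x}.
  by have := outer_null_negligible null; apply: negligibleS => x /= /contrapT.
apply: vol_aeS (vol_aeI hB hN) => x [h1 h2] Sx; apply: h1.
by apply: contrapT => nx; apply: h2; split=> //; exact: subset_closure.
Qed.

(* The fields of one discretization serve as mesh-independent data, to be
   interpolated in all the others. *)
Lemma uniform_lift c s h0 (T0 : @discretization R n N) (adm0 : admissible D c s h0 T0) i j :
  0 < s -> interface D i j -> exists2 C, 0 <= C &
  forall h (T : @discretization R n N), admissible D c s h T ->
  exists v, [/\ Vh T i v,
    {ae area, forall x : E, Gamma_ D i x -> trc v x = face_fun i j x} &
    div_norm D i v <= C].
Proof.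
move=> s0 int; have [v0 Vv0 tv0] := face_fun_trace adm0 int.
have inH := adm_V_Hdiv adm0 Vv0; have Lpv := Vh_Lp adm0 s0 Vv0.
pose dv := nrm vol (sub D i) (dvg v0).
have dv0 : 0 <= dv by exact: sqrtr_ge0.
have Lp0 : 0 <= Lp_norm (sub D i) s (fld v0) by exact: powR_ge0.
(* The first summand bounds the interpolated field, the second its divergence. *)
exists (`|c| * (Lp_norm (sub D i) s (fld v0) + dv) + dv).
  by rewrite addr_ge0// mulr_ge0// addr_ge0.
move=> h T adm; have [v Vv [dE tE vB]] := adm_interpolation adm inH Lpv.
have L2v0 : L2 vol (sub D i) (dvg v0) by case: inH.
have L2v : L2 vol (sub D i) (dvg v) by case: (adm_V_Hdiv adm Vv).
have sI := L2_semi_inner D i; have sG := trace_semi_inner D i.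
exists v; split=> //.
  have [eta Veta teta] := face_fun_trace adm int.
  have sV := Vh_subspace adm i.
  have Ld := Vh_trace adm (subspaceB sV Vv Veta).
  have Lt := Vh_trace adm Vv; have Le := Vh_trace adm Veta; have Lt0 := Vh_trace adm0 Vv0.
  have Lf := face_fun_L2 adm int.
  have mG := measurable_Gamma_ D i.
  (* The trace of the interpolant is the projection of [face_fun D i j] onto the discrete traces,
     which already contain it up to a null set. *)
  have zero : ip area (Gamma_ D i) (trc (v - eta)) (trc (v - eta)) = 0.
    have linl := linear_on_sym sG Ld; have [sL _ _ _] := sG.
    rewrite [LHS](linear_onB linl Lt Le).
    have VG : VGamma T i (trc (v - eta)) by exists (v - eta) => //; exact: (subspaceB sV).
    rewrite (tE _ VG).
    rewrite (@ip_ae _ _ _ area _ mG _ _ _ Lt0 Lf Ld tv0).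
    by rewrite (@ip_ae _ _ _ area _ mG _ _ _ Le Lf Ld teta) subrr.
  have n0 : nrm area (Gamma_ D i) (trc (v - eta)) = 0 by rewrite /nrm zero sqrtr0.
  have ae0 := @nrm_eq0_ae _ _ _ area _ mG _ Ld n0.
  apply: area_aeS (area_aeI ae0 teta) => x [h1 h2] Gx.
  rewrite -h2//; apply/eqP; rewrite -subr_eq0; apply/eqP; exact: h1.
apply: le_trans (div_norm_le D i v) _; apply: lerD.
  apply: (le_trans vB); apply: ler_wpM2r; [exact: addr_ge0|exact: ler_norm].
have [w Ww dw] := adm_div adm Vv; have Lw := Wh_L2 adm Ww.
have mS := measurable_sub D i.
(* The divergence of the interpolant is the projection of that of [v0] onto [Wh T i], so its norm
   does not grow. *)
have e : ip vol (sub D i) (dvg v) (dvg v) = ip vol (sub D i) (dvg v0) (dvg v).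
  rewrite -[LHS](@ip_ae _ _ _ vol _ mS _ _ _ Lw L2v L2v); last first.
    by apply: vol_aeS dw => x h1 Sx; rewrite h1.
  rewrite ipC dE// ipC -(@ip_ae _ _ _ vol _ mS _ _ _ L2v Lw L2v0 dw).
  by rewrite ipC.
have [z|nz] := eqVneq (nrm vol (sub D i) (dvg v)) 0; first by rewrite z.
have pz : 0 < nrm vol (sub D i) (dvg v) by rewrite lt_neqAle eq_sym nz sqrtr_ge0.
rewrite -(ler_pM2r pz) -expr2 (semi_inner_sq sI L2v) e.
exact: le_trans (ler_norm _) (semi_inner_cs sI L2v0 L2v).
Qed.

End Lift.

Lemma ler_sum_term (R : realType) (I : finType) (F : I -> R) i :
  (forall l, 0 <= F l) -> F i <= \sum_l F l.
Proof. by move=> F0; rewrite (bigD1 i)//= lerDl sumr_ge0. Qed.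

(** * The flux problem on the adjacency graph and the fields realizing it *)

Section Coarse.
Context (R : realType) (n N : nat) (D : @decomposition R n N).
Local Notation E := 'rV[R]_n.
Local Notation area := (area R n).
Local Notation vol := (vol R n).
Local Notation hfield := (@hfield R n).
Implicit Types (i j : 'I_N).

(** The weight of an edge of the adjacency graph, as the inner product of constants that the traces
    of the coarse fields produce. *)
Definition face_area i j : R :=
  if `[< interface D i j >] then ip area (gamma D i j) (cst 1) (cst 1) else 0.

Lemma face_areaC i j : face_area i j = face_area j i.
Proof.
rewrite /face_area gammaC; congr (if _ then _ else _).
by apply/asboolP/asboolP => /interfaceC.
Qed.

Lemma face_area_ge0 i j : 0 <= face_area i j.
Proof. by rewrite /face_area; case: ifP => // _; exact: ip_ge0. Qed.

Lemma face_area_gt0 i j : interface D i j -> (area (gamma D i j) < +oo)%E -> 0 < face_area i j.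
Proof.
move=> int fin; rewrite /face_area; case: asboolP => // _; rewrite /ip.
rewrite (@eq_Rintegral _ _ _ area _ (cst 1)).
  rewrite (@Rintegral_cst _ _ _ area _ (measurable_gamma D i j)) mul1r.
  by apply: fine_gt0; rewrite fin andbT; case: int.
by move=> x _; rewrite mulr1.
Qed.

(* The fluxes [t i - t j] are governed by the Laplacian of the adjacency graph
   of the subdomains, with Dirichlet conditions on the non-interior ones. *)
Lemma coarse_flux (n23 : n = 2%N \/ n = 3%N)
    (fin : forall i j, interface D i j -> (area (gamma D i j) < +oo)%E) :
  exists2 C, 0 <= C & forall m : 'I_N -> R, exists t : 'I_N -> R,
    (forall i, is_interior D i -> \sum_j (t i - t j) * face_area i j = m i) /\
    forall i j, `|t i - t j| <= C * \sum_k `|m k|.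
Proof.
pose S : set ('I_N -> R^o) := [set t | forall i, SH D i (t i)].
have fS : finite_dim_subspace S by apply: fds_pi => i; exact: SH_fds.
pose B (t q : 'I_N -> R^o) : R := \sum_i q i * \sum_j (t i - t j) * face_area i j.
have linr t : S t -> linear_on S (B t).
  move=> _ a x y _ _; rewrite /B mulr_sumr -big_split/=; apply: eq_bigr => i _.
  by rewrite [(_ + y) i](_ : _ = a * x i + y i)//; ring.
have linl q : S q -> linear_on S (B^~ q).
  move=> _ a x y _ _; rewrite /B mulr_sumr -big_split/=; apply: eq_bigr => i _.
  rewrite mulrCA -mulrDr; congr (_ * _); rewrite mulr_sumr -big_split/=.
  apply: eq_bigr => j _.
  rewrite [(_ + y) i](_ : _ = a * x i + y i)// [(_ + y) j](_ : _ = a * x j + y j)//.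
  by ring.
(* Summation by parts: symmetrizing in [i] and [j] gives the Dirichlet energy of the graph. *)
have Bqq q : 2 * B q q = \sum_i \sum_j face_area i j * (q i - q j) ^+ 2.
  rewrite [in LHS](_ : 2 = 1 + 1)// mulrDl mul1r.
  have e1 : B q q = \sum_i \sum_j face_area i j * (q i * (q i - q j)).
    by apply: eq_bigr => i _; rewrite mulr_sumr; apply: eq_bigr => j _; ring.
  rewrite {2}e1 exchange_big/= e1 -big_split/=; apply: eq_bigr => i _.
  rewrite -big_split/=; apply: eq_bigr => j _.
  by rewrite (face_areaC j i); ring.
have ker q : S q -> B q q = 0 -> q = 0.
  move=> Sq Bq; have := Bqq q; rewrite Bq mulr0 => /esym/eqP.
  have ge0 i j : 0 <= face_area i j * (q i - q j) ^+ 2.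
    by rewrite mulr_ge0 ?sqr_ge0 ?face_area_ge0.
  rewrite psumr_eq0; last by move=> i _; apply: sumr_ge0.
  move=> /allP q0; apply/funext => i0.
  apply: contrapT => qi0.
  (* Zero energy makes [q] equal across every interface, so the indices with nonzero [q] would form
     a closed cluster of interior subdomains. *)
  apply: (no_closed_component n23 (A := [set i | q i <> 0]) qi0).
    by move=> i qi; apply: contrapT => /Sq.
  move=> i j qi int qj; apply: qi.
  have := q0 i (mem_index_enum _); rewrite psumr_eq0//.
  move=> /allP/(_ j (mem_index_enum _)); rewrite mulf_eq0 gt_eqF/= ?face_area_gt0//.
    by rewrite sqrf_eq0 subr_eq0 => /eqP ->.
  exact: fin.
have ex i0 : exists t : 'I_N -> R^o,
    forall i, is_interior D i -> \sum_j (t i - t j) * face_area i j = (i == i0)%:R.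
  have [|v Sv v0|t St tE] := fds_solvable (l := fun q : 'I_N -> R^o => q i0) fS linr linl.
  - by move=> a x y _ _.
  - by rewrite (ker v Sv (v0 v Sv)).
  - exists t => i int.
    pose q : 'I_N -> R^o := fun j => (j == i)%:R.
    have Sq : S q.
      by move=> j nj; rewrite /q; case: eqP => // ji; rewrite ji in nj.
    have := tE q Sq; rewrite /B (bigD1 i)//= [X in _ + X]big1 ?addr0.
      by rewrite /q eqxx mul1r eq_sym.
    by move=> j /negbTE ji; rewrite /q ji mul0r.
pose t i0 := projT1 (cid (ex i0)).
have tP i0 : forall i, is_interior D i ->
    \sum_j (t i0 i - t i0 j) * face_area i j = (i == i0)%:R by exact: projT2 (cid (ex i0)).
(* Superposing the responses [t k] to unit loads gives a bound linear in [m]; the constant is the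
   crude sum of all their differences. *)
exists (\sum_k \sum_i \sum_j `|t k i - t k j|).
  by do 3! (apply: sumr_ge0 => ? _).
move=> m; exists (fun i => \sum_k m k * t k i).
have dE i j : \sum_k m k * t k i - \sum_k m k * t k j = \sum_k m k * (t k i - t k j).
  by rewrite -sumrB; apply: eq_bigr => k _; rewrite mulrBr.
split=> [i int|i j].
  under eq_bigr do rewrite dE mulr_suml.
  rewrite exchange_big/= (bigD1 i)//= [X in _ + X]big1 ?addr0.
    under eq_bigr do rewrite -mulrA.
    by rewrite -mulr_sumr tP// eqxx mulr1.
  move=> k ki; under eq_bigr do rewrite -mulrA.
  by rewrite -mulr_sumr tP// eq_sym (negbTE ki) mulr0.
rewrite dE; apply: le_trans (ler_norm_sum _ _ _) _.
rewrite mulr_sumr; apply: ler_sum => k _; rewrite normrM mulrC ler_wpM2r//.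
apply: le_trans (ler_sum_term (F := fun l => `|t k i - t k l|) j _) _ => //.
apply: le_trans (ler_sum_term (F := fun i' => \sum_l `|t k i' - t k l|) i _) _.
  by move=> l; apply: sumr_ge0.
apply: (ler_sum_term (F := fun k' => \sum_l \sum_l' `|t k' l - t k' l'|) k) => l.
by do 2! (apply: sumr_ge0 => ? _).
Qed.

Variables (K : E -> 'M[R]_n) (kmin kmax : R) (tK : tensor_field (dom D) K kmin kmax).

Definition coarse_mu (t : 'I_N -> R) : E -> R :=
  \sum_(p : 'I_N * 'I_N) if `[< (p.1 < p.2)%N /\ interface D p.1 p.2 >]
    then (t p.1 - t p.2) *: face_fun D p.1 p.2 else 0.

Lemma coarse_mu_ae t : {ae area, forall x : E, forall i j, (i < j)%N -> face D i j x ->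
  coarse_mu t x = t i - t j}.
Proof.
apply: area_aeS (face_unique_ae D) => x un i j ij fij; have [int gij] := fij.
rewrite /coarse_mu fct_sumE (bigD1 (i, j))//= [X in _ + X]big1 ?addr0.
  case: asboolP => [_|[]//].
  by rewrite [LHS](_ : _ = (t i - t j) * face_fun D i j x)// face_funE mem_set// mulr1.
move=> [k l] klij /=; case: asboolP => // -[kl intkl].
rewrite [LHS](_ : _ = (t k - t l) * face_fun D k l x)// face_funE.
case: ifPn => [|_]; last by rewrite mulr0.
rewrite inE => gkl; have fkl : face D k l x by [].
by have [ik jl] := un _ _ _ _ ij kl fij fkl; rewrite ik jl eqxx in klij.
Qed.

Variables (c s h : R) (T : @discretization R n N) (adm : admissible D c s h T).
Variables (v : 'I_N -> 'I_N -> hfield).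
Hypothesis Vv : forall i j, interface D i j -> Vh T i (v i j).
Hypothesis tv : forall i j, interface D i j ->
  {ae area, forall x : E, Gamma_ D i x -> trc (v i j) x = face_fun D i j x}.

Definition coarse_field (t : 'I_N -> R) i : hfield :=
  \sum_j if `[< interface D i j >] then (t i - t j) *: v i j else 0.

Lemma coarse_field_Vh t i : Vh T i (coarse_field t i).
Proof.
have sV := Vh_subspace adm i; apply: (subspace_sum sV) => j _.
case: asboolP => [int|_]; last exact: sV.1.
by apply: (subspaceZ sV); exact: Vv.
Qed.

Lemma coarse_field_trace t i mu : L2 area (Gamma_ D i) mu ->
  ip area (Gamma_ D i) (trc (coarse_field t i)) mu =
  \sum_j (if `[< interface D i j >] then (t i - t j) * ip area (gamma D i j) (cst 1) mu else 0).
Proof.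
move=> Lmu; have sV := Vh_subspace adm i.
have lin : linear_on (Vh T i) (fun u => ip area (Gamma_ D i) (trc u) mu).
  move=> a u w Vu Vw; rewrite trc_comb.
  exact: (linear_on_sym (trace_semi_inner D i) Lmu a (Vh_trace adm Vu) (Vh_trace adm Vw)).
rewrite /coarse_field (linear_on_sum sV lin); last first.
  move=> j _; case: asboolP => [int|_]; last exact: sV.1.
  by apply: (subspaceZ sV); exact: Vv.
apply: eq_bigr => j _; case: asboolP => [int|_]; last exact: (linear_on0 sV lin).
rewrite (linear_onZ sV lin _ (Vv int)) -(ip_face_fun _ int); congr (_ * _).
exact: (@ip_ae _ _ _ area _ (measurable_Gamma_ D i) _ _ _
  (Vh_trace adm (Vv int)) (face_fun_L2 adm int) Lmu (tv int)).
Qed.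

Lemma trc_sum (I : finType) (F : I -> hfield) : trc (\sum_i F i) = \sum_i trc (F i).
Proof. by apply: (big_morph (@trc R n) (id1 := 0) (op1 := +%R)). Qed.

(** The flux [t i - t j] changes sign when the sides are exchanged, exactly as [sided] does, and
    almost every point of [Gamma_ D i] lies on a single face of [i]. *)
Lemma coarse_field_sided t i : {ae area, forall x : E, Gamma_ D i x ->
  trc (coarse_field t i) x = sided D i (coarse_mu t) x}.
Proof.
have tv' : {ae area, forall x : E, forall j, interface D i j -> Gamma_ D i x ->
    trc (v i j) x = face_fun D i j x}.
  apply: area_ae_forall => j; have [int|nint] := pselect (interface D i j).
    by apply: area_aeS (tv int) => x h1 _.
  exact: area_aeW.
have := area_aeI (area_aeI tv' (face_ae_split D)) (area_aeI (coarse_mu_ae t) (sided_neg_ae D)).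
apply: area_aeS => x [[tvx split] [cmu neg]] Gx.
have [j fij un] := split i Gx; have [int gij] := fij.
rewrite /coarse_field trc_sum fct_sumE (bigD1 j)//= [X in _ + X]big1 ?addr0; last first.
  move=> k kj; case: asboolP => // intk.
  rewrite [LHS](_ : _ = (t i - t k) * trc (v i k) x)// tvx// face_funE.
  case: ifPn => [|_]; last by rewrite mulr0.
  rewrite inE => gik; have fik : face D i k x by [].
  by rewrite (un k fik) eqxx in kj.
case: asboolP => [_|[]//].
rewrite [LHS](_ : _ = (t i - t j) * trc (v i j) x)// tvx// face_funE mem_set// mulr1.
have [ij|ji] := face_lt fij.
  by rewrite (sided_pos _ ij fij) (cmu _ _ ij fij).
by rewrite (neg _ _ _ ji fij) (cmu j i ji) ?opprB// faceC.
Qed.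

Lemma coarse_mu_Lambda t : Lambda_h D T (coarse_mu t).
Proof.
move=> i j ij int; have [mu Lmu mu1] := adm_L_cst adm ij int.
exists ((t i - t j) *: mu).
  exact: (subspaceZ (fds_subspace (adm_L adm ij int)) _ Lmu).
apply: area_aeS (area_aeI mu1 (coarse_mu_ae t)) => x [h1 h2] gx.
rewrite [RHS](_ : _ = (t i - t j) * mu x)// h1// mulr1.
by apply: h2 => //; split.
Qed.

(** The traces are already discrete and equal the sided mortar function, so they are their own flat
    projection. For the sharp one they must also satisfy the weak continuity constraint: the
    contributions of the two sides of each interface cancel. *)
Lemma coarse_field_projection b t :
  is_projection D b T (coarse_mu t) (fun i => trc (coarse_field t i)).
Proof.
have VG i : VGamma T i (trc (coarse_field t i)).
  by exists (coarse_field t i) => //; exact: coarse_field_Vh.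
have Lmu := coarse_mu_Lambda t.
have key i eta : VGamma T i eta ->
    ip area (Gamma_ D i) (trc (coarse_field t i)) eta =
    ip area (Gamma_ D i) (sided D i (coarse_mu t)) eta.
  move=> /(VGamma_L2 adm) Le.
  exact: (@ip_ae _ _ _ area _ (measurable_Gamma_ D i) _ _ _
    (VGamma_L2 adm (VG i)) (sided_Lambda_L2 adm i Lmu) Le (coarse_field_sided t i)).
case: b; first by move=> i; split=> //; exact: key.
split; last by move=> eta [Veta _]; apply: eq_bigr => i _; exact: key.
split=> // mu Lambda_mu.
have -> : \sum_i ip area (Gamma_ D i) (trc (coarse_field t i)) mu =
    \sum_i \sum_j (if `[< interface D i j >]
      then (t i - t j) * ip area (gamma D i j) (cst 1) mu else 0).
  by apply: eq_bigr => i _; apply: coarse_field_trace; exact: (Lambda_L2_ adm).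
(* Exchanging the two summation indices changes the sign of every term. *)
set X := (X in X = 0); suff : X = - X by lra.
rewrite {1}/X exchange_big/= -sumrN; apply: eq_bigr => i _; rewrite -sumrN.
apply: eq_bigr => j _.
have -> : `[< interface D j i >] = `[< interface D i j >].
  by apply/asboolP/asboolP => /interfaceC.
by case: asboolP => _; rewrite ?oppr0// gammaC; ring.
Qed.

Lemma coarse_field_Vspace b t : Vspace D K b T (coarse_field t).
Proof.
apply/(VspaceP tK adm); split=> [i|]; first exact: coarse_field_Vh.
exists (coarse_mu t), (fun i => trc (coarse_field t i)); split=> //.
- exact: coarse_mu_Lambda.
- exact: coarse_field_projection.
- by move=> i; exact: area_aeW.
Qed.


End Coarse.

(** * Stability *)

Lemma sqr_sum_le (R : realType) N (a : 'I_N -> R) :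
  (\sum_k a k) ^+ 2 <= N%:R * \sum_k a k ^+ 2.
Proof.
have -> : N%:R * \sum_k a k ^+ 2 = \sum_k \sum_l (a k ^+ 2 + a l ^+ 2) / 2.
  transitivity ((\sum_(k < N) \sum_(l < N) a k ^+ 2 + \sum_(k < N) \sum_(l < N) a l ^+ 2) / 2).
    rewrite [X in (_ + X) / 2]exchange_big/=; set S := (X in (X + _) / 2).
    have -> : (S + S) / 2 = S by field.
    rewrite /S.
    rewrite mulr_sumr; apply: eq_bigr => k _.
    by rewrite sumr_const card_ord mulr_natl.
  rewrite -big_split/= mulr_suml; apply: eq_bigr => k _.
  by rewrite -big_split/= mulr_suml.
rewrite expr2 mulr_suml; apply: ler_sum => k _; rewrite mulr_sumr; apply: ler_sum => l _.
by have := sqr_ge0 (a k - a l); rewrite sqrrB => h; lra.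
Qed.

(** * The inf-sup condition with a constant uniform in the mesh *)

Section InfSup.
Context (R : realType) (n N : nat) (D : @decomposition R n N).
Local Notation E := 'rV[R]_n.
Local Notation area := (area R n).
Local Notation vol := (vol R n).
Local Notation hfield := (@hfield R n).
Implicit Types (i j : 'I_N).
Variables (K : E -> 'M[R]_n) (kmin kmax : R) (tK : tensor_field (dom D) K kmin kmax).

Lemma cst1_trace_L2 c s h (T : @discretization R n N) (adm : admissible D c s h T) i :
  L2 area (Gamma_ D i) (cst 1).
Proof.
have L1 : L2 area (Gamma D) (cst 1).
  apply: (Gamma_L2 _).1 => k l kl int; have mg := measurable_gamma D k l.
  have L2g := L2_subset mg (measurable_Gamma_ D k) (gamma_Gamma_ int) (face_fun_L2 adm int).
  apply: (L2_ae mg (@area_complete R n) _ L2g).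
  by apply: area_aeW => x gx; rewrite face_funE mem_set.
by apply: L2_subset L1; [exact: measurable_Gamma_|exact: measurable_Gamma|exact: subIsetl].
Qed.

Lemma coarse_field_flux c s h (T : @discretization R n N) (adm : admissible D c s h T)
    (v : 'I_N -> 'I_N -> hfield)
    (Vv : forall i j, interface D i j -> Vh T i (v i j))
    (tv : forall i j, interface D i j ->
      {ae area, forall x : E, Gamma_ D i x -> trc (v i j) x = face_fun D i j x}) t i :
  is_interior D i -> ip vol (sub D i) (dvg (coarse_field D v t i)) (cst 1) =
    \sum_j (t i - t j) * face_area D i j.
Proof.
move=> int; rewrite (interior_flux int); last first.
  exact: (adm_V_Hdiv adm (coarse_field_Vh adm Vv t i)).
rewrite (coarse_field_trace adm Vv tv t (cst1_trace_L2 adm i)).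
by apply: eq_bigr => j _; rewrite /face_area; case: ifP; rewrite ?mulr0.
Qed.

Lemma div_norm0 i : div_norm D i 0 = 0.
Proof.
have [sH _ L _] := hdiv_semi_inner D i; have H0 := sH.1.
by rewrite div_normE// (linear_on0 sH (L _ H0)) sqrtr0.
Qed.

Lemma div_normZ i a v : Hdiv D i v -> div_norm D i (a *: v) = `|a| * div_norm D i v.
Proof.
move=> Hv; have sI := hdiv_semi_inner D i; have [sH _ _ _] := sI.
rewrite (div_normE Hv) (div_normE (subspaceZ sH a Hv)).
exact: (semi_inner_normZ sI).
Qed.

Lemma div_norm_sum i (I : finType) (F : I -> hfield) : (forall l, Hdiv D i (F l)) ->
  div_norm D i (\sum_l F l) <= \sum_l div_norm D i (F l).
Proof.
move=> HF; have sI := hdiv_semi_inner D i; have [sH _ _ _] := sI.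
have HS : Hdiv D i (\sum_l F l) by apply: (subspace_sum sH) => l _; exact: HF.
rewrite (div_normE HS).
under [leRHS]eq_bigr => l _ do rewrite (div_normE (HF l)).
exact: (semi_inner_triangle_sum sI HF).
Qed.

Lemma normW_ge0 (w : 'I_N -> E -> R) : 0 <= normW D w.
Proof. exact: sqrtr_ge0. Qed.

Lemma normV_ge0 (u : 'I_N -> hfield) : 0 <= normV D u.
Proof. by apply: sumr_ge0 => i _; exact: div_norm_ge0. Qed.

Lemma nrm_le_normW (w : 'I_N -> E -> R) i : nrm vol (sub D i) (w i) <= normW D w.
Proof.
rewrite -[leLHS]ger0_norm ?sqrtr_ge0// -sqrtr_sqr ler_wsqrtr//.
apply: (ler_sum_term (F := fun i => nrm vol (sub D i) (w i) ^+ 2)) => l; exact: sqr_ge0.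
Qed.

Lemma normW_le (w : 'I_N -> E -> R) : normW D w <= \sum_i nrm vol (sub D i) (w i).
Proof.
have ge0 i : 0 <= nrm vol (sub D i) (w i) by exact: sqrtr_ge0.
have S0 : 0 <= \sum_i nrm vol (sub D i) (w i) by apply: sumr_ge0.
rewrite -[leRHS]ger0_norm// -sqrtr_sqr ler_wsqrtr// expr2 mulr_suml.
apply: ler_sum => i _; rewrite expr2; apply: ler_wpM2l => //.
exact: (ler_sum_term (F := fun i => nrm vol (sub D i) (w i))).
Qed.

(** The pressure is split as [q + w], where [w] is its mean on interior subdomains and 0 elsewhere.
    Local test fields bound [q]; a coarse field whose fluxes are the integrals of [p] over interior
    subdomains pairs with [w] to the sum of its squared local norms. *)
Lemma infsup (n23 : n = 2%N \/ n = 3%N) (c s : R) h0 (T0 : @discretization R n N)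
    (adm0 : admissible D c s h0 T0) : 0 < s ->
  exists2 C, 0 <= C & forall h (T : @discretization R n N), admissible D c s h T ->
  forall b p G, Wspace T p -> 0 <= G ->
  (forall v, Vspace D K b T v -> form_b D v p <= G * normV D v) ->
  normW D p <= C * G.
Proof.
move=> s0.
have [Cf Cf0 flux] := coarse_flux n23 (fun i j int => area_gamma_fin adm0 int).
have exl i j : exists2 C, 0 <= C & interface D i j -> 
    forall h (T : @discretization R n N), admissible D c s h T ->
    exists v, [/\ Vh T i v,
      {ae area, forall x : E, Gamma_ D i x -> trc v x = face_fun D i j x} &
      div_norm D i v <= C].
  have [int|nint] := pselect (interface D i j); last by exists 0.
  by have [C C0 h] := uniform_lift adm0 s0 int; exists C.
pose Cl i j := projT1 (cid2 (exl i j)).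
have Cl0 i j : 0 <= Cl i j by rewrite /Cl; case: cid2.
have ClP i j : interface D i j -> forall h (T : @discretization R n N), admissible D c s h T ->
    exists v, [/\ Vh T i v,
      {ae area, forall x : E, Gamma_ D i x -> trc v x = face_fun D i j x} &
      div_norm D i v <= Cl i j].
  by rewrite /Cl; case: cid2.
pose nu i := ip vol (sub D i) (cst 1) (cst 1).
have nu0 i : 0 <= nu i by exact: ip_ge0.
pose Vm : R := \sum_i Num.sqrt (nu i).
have Vm0 : 0 <= Vm by apply: sumr_ge0 => i _; exact: sqrtr_ge0.
pose Cs : R := \sum_i \sum_j Cl i j.
have Cs0 : 0 <= Cs by do 2! (apply: sumr_ge0 => ? _).
pose X := (1 + `|c|) * (Cs * (Cf * Vm)).
have X0 : 0 <= X by rewrite !mulr_ge0// addr_ge0.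
exists (N%:R * `|c| + N%:R * X); first by rewrite addr_ge0// mulr_ge0.
move=> h T adm b p G Wp G0 pG.
have sI i := L2_semi_inner D i.
have sL i : subspace [set f | L2 vol (sub D i) f] by case: (sI i).
have L1 i := cst1_L2 adm i.
have Lp i : L2 vol (sub D i) (p i) by exact: (Wh_L2 adm).
(* No constant is split off on a non-interior subdomain, where [SH] is trivial and the local inf-sup
   condition holds for all of [Wh]. *)
pose beta i := if `[< is_interior D i >] then ip vol (sub D i) (p i) (cst 1) / nu i else 0.
have exw i : exists w, Wh T i w /\ {ae vol, forall x : E, sub D i x -> w x = beta i}.
  by have [w Ww we] := Wh_cst adm i (beta i); exists w.
pose w i := projT1 (cid (exw i)).
have Ww i : Wh T i (w i) by case: (projT2 (cid (exw i))).
have wE i : {ae vol, forall x : E, sub D i x -> w i x = (beta i *: (cst 1 : E -> R)) x}.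
  have [_ h1] := projT2 (cid (exw i)).
  by apply: vol_aeS h1 => x h2 Sx; rewrite [RHS]mulr1; exact: h2.
have Lw i : L2 vol (sub D i) (w i) by exact: (Wh_L2 adm).
have Lb i : L2 vol (sub D i) (beta i *: (cst 1 : E -> R)) by apply: (subspaceZ (sL i)); exact: L1.
have ipw i f : L2 vol (sub D i) f -> ip vol (sub D i) f (w i) = beta i * ip vol (sub D i) f (cst 1).
  move=> Lf; rewrite ipC (@ip_ae _ _ _ vol _ (measurable_sub D i) _ _ _ (Lw i) (Lb i) Lf (wE i)).
  by rewrite ipC (linear_onZ (sL i) (ip_linr Lf) _ (L1 i)).
pose q i := p i - w i.
have Wq i : Wh T i (q i) by exact: (subspaceB (Wh_subspace adm i)).
have Lq i : L2 vol (sub D i) (q i) by exact: (Wh_L2 adm).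
have ipq i f : L2 vol (sub D i) f ->
    ip vol (sub D i) f (q i) = ip vol (sub D i) f (p i) - beta i * ip vol (sub D i) f (cst 1).
  by move=> Lf; rewrite /q (linear_onB (ip_linr Lf) (Lp i) (Lw i)) ipw.
have m_ i : is_interior D i -> ip vol (sub D i) (p i) (cst 1) = beta i * nu i.
  move=> int; rewrite /beta; case: asboolP => // _.
  (* Zero volume is not excluded here: the quotient is then 0 by convention, and the integral of
     [p i] vanishes by Cauchy-Schwarz. *)
  have [z|nz] := eqVneq (nu i) 0; last by rewrite divfK.
  rewrite z mulr0 ipC; apply: (semi_inner_null (sI i) (L1 i) (Lp i)).
  by rewrite -/(nu i) z sqrtr0.
have qS i r : SH D i r -> ip vol (sub D i) (q i) (cst r) = 0.
  move=> Sr; rewrite ipC.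
  have -> : cst r = r *: (cst 1 : E -> R) by apply/funext => x; rewrite [RHS]mulr1.
  have [int|nint] := pselect (is_interior D i).
    rewrite ipC (linear_onZ (sL i) (ip_linr (Lq i)) _ (L1 i)) ipC ipq//.
    by rewrite ipC m_// subrr mulr0.
  by rewrite (Sr nint) scale0r ip0l.
have VHd i v : V0 D T i v -> Hdiv D i v by move=> /V0_Vh; exact: (Vh_Hdiv adm).
have single i v : V0 D T i v -> ip vol (sub D i) (dvg v) (p i) <= G * div_norm D i v.
  move=> V0v; have := pG _ (V0_Vspace tK adm b V0v).
  rewrite /form_b /normV (bigD1 i)//= eqxx [X in _ + X]big1; last first.
    by move=> j /negbTE ->; exact: ip0l.
  rewrite (bigD1 i)//= eqxx [X in _ * (_ + X)]big1 ?addr0//.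
  by move=> j /negbTE ->; exact: div_norm0.
have qB i : nrm vol (sub D i) (q i) <= `|c| * G.
  (* Fields of [V0] do not see [w]: they have no net flux on interior subdomains, and [beta] is 0 on
     the others. *)
  apply: (infsup0_bound adm (Wq i) (qS i) G0) => v V0v.
  have Hv := VHd _ _ V0v; have [_ Lv] := Hv.
  have -> : ip vol (sub D i) (dvg v) (q i) = ip vol (sub D i) (dvg v) (p i).
    rewrite ipq//; have [int|nint] := pselect (is_interior D i).
      by rewrite (V0_flux adm int V0v) mulr0 subr0.
    by rewrite /beta; case: asboolP => // _; rewrite mul0r subr0.
  rewrite ler_norml single// andbT lerNl.
  have := single _ _ (subspaceZ (V0_subspace adm i) (-1) V0v).
  rewrite div_normZ// normrN1 mul1r; apply: le_trans.
  have := linear_onZ (sL i) (ip_linl (Lp i)) (-1) Lv.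
  by rewrite mulN1r => <-.
(* The norm of the constant part on the [i]-th subdomain. *)
pose a i := `|beta i| * Num.sqrt (nu i).
have a0 i : 0 <= a i by rewrite mulr_ge0 ?sqrtr_ge0.
have a2 i : a i ^+ 2 = beta i * (beta i * nu i).
  by rewrite exprMn real_normK ?num_real// sqr_sqrtr//; ring.
pose m i := beta i * nu i.
have [t [tflux tB]] := flux m.
have exv i j : exists v, interface D i j -> [/\ Vh T i v,
      {ae area, forall x : E, Gamma_ D i x -> trc v x = face_fun D i j x} &
      div_norm D i v <= Cl i j].
  have [int|nint] := pselect (interface D i j); last by exists 0.
  by have [v vP] := ClP i j int h T adm; exists v.
pose v i j := projT1 (cid (exv i j)).
have vP i j : interface D i j -> [/\ Vh T i (v i j),
      {ae area, forall x : E, Gamma_ D i x -> trc (v i j) x = face_fun D i j x} &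
      div_norm D i (v i j) <= Cl i j] by exact: projT2 (cid (exv i j)).
have Vv i j (int : interface D i j) : Vh T i (v i j) by case: (vP i j int).
have tv i j (int : interface D i j) :
    {ae area, forall x : E, Gamma_ D i x -> trc (v i j) x = face_fun D i j x} by case: (vP i j int).
pose u := coarse_field D v t.
have Vu := coarse_field_Vspace tK adm Vv tv b t.
have Hu i : Hdiv D i (u i) by exact: (Vh_Hdiv adm (coarse_field_Vh adm Vv t i)).
have flux_u i : beta i * ip vol (sub D i) (dvg (u i)) (cst 1) = a i ^+ 2.
  have [int|nint] := pselect (is_interior D i).
    by rewrite (coarse_field_flux adm Vv tv t int) tflux// a2.
  by rewrite a2 /beta; case: asboolP => // _; rewrite !mul0r.
have Msum : \sum_k `|m k| <= Vm * \sum_k a k.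
  rewrite mulr_sumr; apply: ler_sum => k _.
  have -> : `|m k| = Num.sqrt (nu k) * a k.
    rewrite /m /a normrM (ger0_norm (nu0 k)) mulrCA; congr (_ * _).
    by rewrite -expr2 sqr_sqrtr.
  apply: ler_wpM2r => //.
  by apply: (ler_sum_term (F := fun k => Num.sqrt (nu k))) => l; exact: sqrtr_ge0.
have uB : normV D u <= Cs * (Cf * Vm) * \sum_k a k.
  apply: (@le_trans _ _ (\sum_i \sum_j (Cl i j * (Cf * \sum_k `|m k|)))).
    apply: ler_sum => i _; apply: le_trans (div_norm_sum _) _.
      move=> j; have [sH _ _ _] := hdiv_semi_inner D i.
      case: asboolP => [int|_]; last exact: sH.1.
      by apply: (subspaceZ sH); exact: (Vh_Hdiv adm (Vv i j int)).
    apply: ler_sum => j _; case: asboolP => [int|_]; last first.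
      by rewrite div_norm0 !mulr_ge0//; apply: sumr_ge0.
    rewrite div_normZ; last exact: (Vh_Hdiv adm (Vv i j int)).
    by rewrite mulrC; apply: ler_pM => //; [exact: div_norm_ge0|case: (vP i j int)].
  under eq_bigr do rewrite -mulr_suml.
  rewrite -mulr_suml -/Cs -!mulrA; apply: ler_wpM2l => //; apply: ler_wpM2l => //.
have main : \sum_i a i ^+ 2 <= X * G * \sum_k a k.
  have bE : form_b D u p = \sum_i ip vol (sub D i) (dvg (u i)) (q i) + \sum_i a i ^+ 2.
    rewrite -big_split/=; apply: eq_bigr => i _.
    rewrite ipq; last by case: (Hu i).
    by rewrite flux_u subrK.
  have h1 := pG _ Vu.
  have h2 : - \sum_i ip vol (sub D i) (dvg (u i)) (q i) <= `|c| * G * normV D u.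
    rewrite -sumrN mulr_sumr; apply: ler_sum => i _.
    apply: le_trans (ler_norm _) _; rewrite normrN.
    have [_ Ldu] := Hu i.
    apply: le_trans (semi_inner_cs (sI i) Ldu (Lq i)) _.
    rewrite mulrC; apply: ler_pM; [exact: sqrtr_ge0|exact: sqrtr_ge0|exact: qB|].
    exact: nrm_le_div_norm.
  have h3 : \sum_i a i ^+ 2 <= (1 + `|c|) * G * normV D u.
    rewrite bE in h1; have -> : (1 + `|c|) * G * normV D u = G * normV D u + `|c| * G * normV D u.
      by ring.
    move: h1 h2; set z := \sum_i ip _ _ _ _ => h1 h2.
    rewrite -[leLHS](addKr z) addrC; exact: lerD.
  apply: (le_trans h3).
  have -> : X * G * \sum_k a k = (1 + `|c|) * G * (Cs * (Cf * Vm) * \sum_k a k).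
    by rewrite /X; ring.
  by apply: ler_wpM2l => //; rewrite mulr_ge0// addr_ge0.
(* The estimate [main] is quadratic on the left and linear on the right; [sqr_sum_le] contributes
   the factor [N] and one power of the sum cancels. *)
have aB : \sum_k a k <= N%:R * X * G.
  have A0 : 0 <= \sum_k a k by apply: sumr_ge0.
  have [->|An0] := eqVneq (\sum_k a k) 0; first by rewrite !mulr_ge0.
  have Ap : 0 < \sum_k a k by rewrite lt_neqAle eq_sym An0.
  rewrite -(ler_pM2r Ap) -expr2; apply: le_trans (sqr_sum_le a) _.
  have -> : N%:R * X * G * \sum_k a k = N%:R * (X * G * \sum_k a k) by ring.
  exact: ler_wpM2l.
apply: le_trans (normW_le p) _.
apply: (@le_trans _ _ (\sum_i (`|c| * G + a i))).
  apply: ler_sum => i _.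
  have -> : p i = q i + w i by rewrite /q subrK.
  apply: le_trans (semi_inner_triangle (sI i) (Lq i) (Lw i)) _.
  apply: lerD; first exact: qB.
  have -> : Num.sqrt (ip vol (sub D i) (w i) (w i)) =
      nrm vol (sub D i) (beta i *: (cst 1 : E -> R)).
    exact: (@nrm_ae _ _ _ vol _ (measurable_sub D i) _ _ (Lw i) (Lb i) (wE i)).
  by rewrite /nrm (semi_inner_normZ (sI i) _ (L1 i)).
rewrite big_split/= sumr_const card_ord -mulr_natl; lra.
Qed.

End InfSup.

(** * Existence, uniqueness and the a priori bound, given the inf-sup condition *)

Section Stability.
Context (R : realType) (n N : nat) (D : @decomposition R n N).
Local Notation E := 'rV[R]_n.
Local Notation area := (area R n).
Local Notation vol := (vol R n).
Local Notation hfield := (@hfield R n).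
Implicit Types (i j : 'I_N).
Variables (K : E -> 'M[R]_n) (kmin kmax : R) (tK : tensor_field (dom D) K kmin kmax).
Variables (c s h : R) (T : @discretization R n N) (adm : admissible D c s h T).
Variables (b : flavour) (C0 : R).
Hypotheses (C00 : 0 <= C0)
  (infsup : forall p G, Wspace T p -> 0 <= G ->
     (forall v, Vspace D K b T v -> form_b D v p <= G * normV D v) -> normW D p <= C0 * G).
Local Notation Vsp := (Vspace D K b T).

Let kmin0 : 0 < kmin. Proof. by case: tK. Qed.
Let kmax0 : 0 < kmax. Proof. by case: tK => h0 /(lt_trans h0). Qed.

Let VH u i : Vsp u -> Hdiv D i (u i).
Proof. by move=> /(Vspace_Vh tK adm i); exact: (Vh_Hdiv adm). Qed.

Let VL u i : Vsp u -> L2 vol (sub D i) (dvg (u i)).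
Proof. by move=> /(VH i)[]. Qed.

Let WL p i : Wspace T p -> L2 vol (sub D i) (p i).
Proof. by move=> Wp; exact: (Wh_L2 adm). Qed.

Lemma form_a_linr u : Vsp u -> linear_on Vsp (form_a D K u).
Proof.
move=> Vu; apply: (linear_onS (S' := [set v | forall i, Hdiv D i (v i)])).
  by move=> v Vv i; exact: VH.
exact: (@linear_on_pi R _ _ (Hdiv D) (fun i => aform D K i (u i))
  (fun i => aform_linearr tK (VH i Vu))).
Qed.

Lemma form_a_linl u : Vsp u -> linear_on Vsp ((form_a D K)^~ u).
Proof.
move=> Vu; apply: (linear_onS (S' := [set v | forall i, Hdiv D i (v i)])).
  by move=> v Vv i; exact: VH.
exact: (@linear_on_pi R _ _ (Hdiv D) (fun i => (aform D K i)^~ (u i))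
  (fun i => aform_linearl tK (VH i Vu))).
Qed.

Lemma form_b_linl p : Wspace T p -> linear_on Vsp ((form_b D)^~ p).
Proof.
move=> Wp a u v Vu Vv; rewrite /form_b mulr_sumr -big_split/=; apply: eq_bigr => i _.
exact: (ip_linl (WL i Wp) a (VL i Vu) (VL i Vv)).
Qed.

Lemma form_b_linr u : Vsp u -> linear_on (Wspace T) (form_b D u).
Proof.
move=> Vu a p q Wp Wq; rewrite /form_b mulr_sumr -big_split/=; apply: eq_bigr => i _.
exact: (ip_linr (VL i Vu) a (WL i Wp) (WL i Wq)).
Qed.

Lemma load_lin (f : E -> R) : (forall i, L2 vol (sub D i) f) ->
  linear_on (Wspace T) (fun w => \sum_i ip vol (sub D i) f (w i)).
Proof.
move=> Lf a p q Wp Wq; rewrite mulr_sumr -big_split/=; apply: eq_bigr => i _.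
exact: (ip_linr (Lf i) a (WL i Wp) (WL i Wq)).
Qed.

(** The part of [normV] that [form_a] controls; divergences are estimated separately. *)
Definition fld_norm (u : 'I_N -> hfield) : R := \sum_i vnrm (sub D i) (fld (u i)).

Lemma fld_norm_ge0 u : 0 <= fld_norm u.
Proof. by apply: sumr_ge0 => i _; exact: sqrtr_ge0. Qed.

Lemma form_a_coercive u : Vsp u -> fld_norm u ^+ 2 <= N%:R * kmax * form_a D K u u.
Proof.
move=> Vu; apply: le_trans (sqr_sum_le _) _; rewrite -mulrA; apply: ler_wpM2l => //.
by rewrite mulr_sumr; apply: ler_sum => i _; exact: (aform_coercive tK (VH i Vu)).
Qed.

Lemma form_a_bound u v : Vsp u -> Vsp v -> form_a D K u v <= kmin^-1 * fld_norm u * normV D v.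
Proof.
move=> Vu Vv; rewrite mulr_sumr; apply: ler_sum => i _.
apply: le_trans (ler_norm _) _; apply: le_trans (aform_bound tK (VH i Vu) (VH i Vv)) _.
apply: ler_pM; rewrite ?mulr_ge0 ?sqrtr_ge0 ?invr_ge0 ?(ltW kmin0)//.
  apply: ler_wpM2l; first by rewrite invr_ge0 ltW.
  by apply: (ler_sum_term (F := fun i => vnrm (sub D i) (fld (u i)))) => l; exact: sqrtr_ge0.
exact: vnrm_le_div_norm.
Qed.

(** The first equation and the inf-sup condition bound [p] by the field; testing with [u] then
    bounds the energy by the load times [p], and coercivity closes the loop. *)
Lemma solution_bound (f : E -> R) (F : R) u p : (forall i, L2 vol (sub D i) f) ->
  (forall i, nrm vol (sub D i) f <= F) -> 0 <= F -> solution D K b T f u p ->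
  normV D u + normW D p <=
    (N%:R ^+ 2 * kmax * (C0 / kmin) + N%:R + (C0 / kmin) * (N%:R ^+ 2 * kmax * (C0 / kmin))) * F.
Proof.
move=> Lf fF F0 [Vu Wp e1 e2].
have U0 := fld_norm_ge0 u.
have pB : normW D p <= C0 / kmin * fld_norm u.
  rewrite -mulrA; apply: infsup => //; first by rewrite mulr_ge0// invr_ge0 ltW.
  move=> v Vv; have := e1 v Vv => /eqP; rewrite subr_eq0 => /eqP <-.
  exact: form_a_bound.
have k0 : 0 <= C0 / kmin by rewrite divr_ge0// ltW.
have aB : form_a D K u u <= N%:R * F * normW D p.
  have := e1 u Vu => /eqP; rewrite subr_eq0 => /eqP ->; rewrite e2//.
  apply: (@le_trans _ _ (\sum_(i < N) F * normW D p)).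
    apply: ler_sum => i _; apply: le_trans (ler_norm _) _.
    apply: le_trans (semi_inner_cs (L2_semi_inner D i) (Lf i) (WL i Wp)) _.
    apply: ler_pM; [exact: sqrtr_ge0|exact: sqrtr_ge0|exact: fF|exact: nrm_le_normW].
  by rewrite sumr_const card_ord -[(F * _) *+ _]mulr_natl mulrA.
(* One factor [N] comes from coercivity and one from the load; a power of [fld_norm u] cancels. *)
have uB : fld_norm u <= N%:R ^+ 2 * kmax * (C0 / kmin) * F.
  have [->|Un0] := eqVneq (fld_norm u) 0; first
    by rewrite !mulr_ge0 ?exprn_ge0 ?(ltW kmax0) ?invr_ge0 ?(ltW kmin0).
  have Up : 0 < fld_norm u by rewrite lt_neqAle eq_sym Un0.
  rewrite -(ler_pM2r Up) -expr2; apply: le_trans (form_a_coercive Vu) _.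
  apply: (@le_trans _ _ (N%:R * kmax * (N%:R * F * (C0 / kmin * fld_norm u)))).
    apply: ler_wpM2l; first by rewrite mulr_ge0// ltW.
    by apply: (le_trans aB); apply: ler_wpM2l => //; rewrite mulr_ge0.
  by rewrite le_eqVlt; apply/orP; left; apply/eqP; ring.
(* The divergence of [u i] is itself a discrete pressure up to a null set, so it may be used as the
   test function on this subdomain. *)
have dB i : nrm vol (sub D i) (dvg (u i)) <= F.
  have [w Ww dw] := adm_div adm (Vspace_Vh tK adm i Vu).
  have Lw := Wh_L2 adm Ww; have Ld := VL i Vu; have mS := measurable_sub D i.
  have sI := L2_semi_inner D i.
  pose q : 'I_N -> E -> R := fun j => if j == i then w else 0.
  have Wq : Wspace T q.
    by move=> j; rewrite /q; case: eqP => [->//|_]; exact: (Wh_subspace adm j).1.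
  have := e2 q Wq; rewrite /form_b (bigD1 i)//= [X in _ + X]big1 ?addr0; last first.
    by move=> j /negbTE ji; rewrite /q ji; apply: ip0r; exact: VL.
  rewrite [RHS](bigD1 i)//= [X in _ = _ + X]big1 ?addr0; last first.
    by move=> j /negbTE ji; rewrite /q ji; apply: ip0r; exact: Lf.
  rewrite /q eqxx ipC -(@ip_ae _ _ _ vol _ mS _ _ _ Ld Lw Ld dw) => e.
  rewrite ipC -(@ip_ae _ _ _ vol _ mS _ _ _ Ld Lw (Lf i) dw) ipC in e.
  have [z|nz] := eqVneq (nrm vol (sub D i) (dvg (u i))) 0; first by rewrite z.
  have pz : 0 < nrm vol (sub D i) (dvg (u i)) by rewrite lt_neqAle eq_sym nz sqrtr_ge0.
  rewrite -(ler_pM2r pz) -expr2 (semi_inner_sq sI Ld) e.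
  apply: le_trans (ler_norm _) _; apply: le_trans (semi_inner_cs sI (Lf i) Ld) _.
  by apply: ler_wpM2r; [exact: sqrtr_ge0|exact: fF].
have uV : normV D u <= fld_norm u + N%:R * F.
  apply: (@le_trans _ _ (\sum_i (vnrm (sub D i) (fld (u i)) + F))).
    apply: ler_sum => i _; apply: le_trans (div_norm_le D i _) _.
    by rewrite lerD2l; exact: dB.
  by rewrite big_split/= sumr_const card_ord -[F *+ _]mulr_natl.
rewrite !mulrDl; apply: lerD; first by apply: (le_trans uV); rewrite lerD2r.
by apply: (le_trans pB); rewrite -[leRHS](mulrA (C0 / kmin)); apply: ler_wpM2l.
Qed.

Lemma solutionB (f : E -> R) u p u' p' :
  solution D K b T f u p -> solution D K b T f u' p' -> solution D K b T 0 (u - u') (p - p').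
Proof.
move=> [Vu Wp e1 e2] [Vu' Wp' e1' e2'].
have sV := Vspace_subspace tK adm b; have sW := fds_subspace (Wspace_fds adm).
split; [exact: (subspaceB sV Vu Vu')|exact: (subspaceB sW Wp Wp')| |].
- move=> v Vv; rewrite (linear_onB (form_a_linl Vv) Vu Vu').
  rewrite (linear_onB (form_b_linr Vv) Wp Wp').
  by have := e1 v Vv; have := e1' v Vv => h1 h2; lra.
- move=> w Ww; rewrite (linear_onB (form_b_linl Ww) Vu Vu') e2// e2'// subrr.
  by rewrite big1// => i _; apply: ip0l; exact: WL.
Qed.

(** The difference solves the problem with zero load, to which the a priori bound applies with
    [F = 0]. *)
Lemma solution_unique (f : E -> R) u p u' p' :
  solution D K b T f u p -> solution D K b T f u' p' ->
  normV D (fun i => u i - u' i) = 0 /\ normW D (fun i => p i - p' i) = 0.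
Proof.
move=> S S'; have := solution_bound _ _ (lexx 0) (solutionB S S').
have L0 i : L2 vol (sub D i) 0 by have [sL _ _ _] := L2_semi_inner D i; exact: sL.1.
move=> /(_ L0) h0; rewrite mulr0 in h0.
have {}h0 : normV D (u - u') + normW D (p - p') <= 0.
  by apply: h0 => i; rewrite /nrm ip0l ?sqrtr0.
have := normV_ge0 D (u - u'); have := normW_ge0 D (p - p') => h1 h2.
by split; apply/eqP; rewrite eq_le; apply/andP; split=> //; lra.
Qed.

(** For a kernel vector [(v, w)] the pressure tests give [form_b D v p = 0] for all [p], so [v] has
    zero energy. What remains is [form_b D u w = 0] for all [u], so [w] is null by inf-sup, and the
    load sees only [w]. *)
Lemma solution_exists (f : E -> R) : (forall i, L2 vol (sub D i) f) ->
  exists u p, solution D K b T f u p.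
Proof.
move=> Lf; pose X : lmodType R := (('I_N -> hfield) * ('I_N -> E -> R))%type.
pose S : set X := Vsp `*` Wspace T.
pose B (x y : X) : R := form_a D K x.1 y.1 - form_b D y.1 x.2 + form_b D x.1 y.2.
pose L (y : X) : R := \sum_i ip vol (sub D i) f (y.2 i).
have BE u p v w : B (u, p) (v, w) = form_a D K u v - form_b D v p + form_b D u w by reflexivity.
have LE v w : L (v, w) = \sum_i ip vol (sub D i) f (w i) by reflexivity.
have Xcomb a (v v' : 'I_N -> hfield) (w w' : 'I_N -> E -> R) :
  a *: (v, w) + (v', w') = (a *: v + v', a *: w + w') :> X by reflexivity.
have sV := Vspace_subspace tK adm b; have sW := fds_subspace (Wspace_fds adm).
have V0 := sV.1; have W0 := sW.1.
have fS : finite_dim_subspace S.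
  by apply: fds_prod; [exact: (Vspace_fds tK adm b)|exact: (Wspace_fds adm)].
have linr x : S x -> linear_on S (B x).
  move: x => [u p] [Vu Wp] a [v w] [v' w'] [Vv Ww] [Vv' Ww'].
  rewrite Xcomb !BE (form_a_linr Vu a Vv Vv') (form_b_linl Wp a Vv Vv').
  by rewrite (form_b_linr Vu a Ww Ww'); ring.
have linl y : S y -> linear_on S (B^~ y).
  move: y => [u p] [Vu Wp] a [v w] [v' w'] [Vv Ww] [Vv' Ww'].
  rewrite Xcomb !BE (form_a_linl Vu a Vv Vv') (form_b_linl Wp a Vv Vv').
  by rewrite (form_b_linr Vu a Ww Ww'); ring.
have ll : linear_on S L.
  move=> a [v w] [v' w'] [Vv Ww] [Vv' Ww'].
  by rewrite Xcomb !LE (load_lin Lf a Ww Ww').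
have a0l v : Vsp v -> form_a D K 0 v = 0 by move=> Vv; exact: (linear_on0 sV (form_a_linl Vv)).
have a0r v : Vsp v -> form_a D K v 0 = 0 by move=> Vv; exact: (linear_on0 sV (form_a_linr Vv)).
have b0l p : Wspace T p -> form_b D 0 p = 0 by move=> Wp; exact: (linear_on0 sV (form_b_linl Wp)).
have b0r v : Vsp v -> form_b D v 0 = 0 by move=> Vv; exact: (linear_on0 sW (form_b_linr Vv)).
have ker y : S y -> (forall x, S x -> B x y = 0) -> L y = 0.
  move: y => [v w] [Vv Ww] By.
  have k1 p : Wspace T p -> form_b D v p = 0.
    move=> Wp; have := By (0, p) (conj V0 Wp).
    by rewrite BE (a0l _ Vv) (b0l _ Ww) => h1; lra.
  have k2 u : Vsp u -> form_a D K u v + form_b D u w = 0.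
    move=> Vu; have := By (u, 0) (conj Vu W0).
    by rewrite BE (b0r _ Vv) subr0.
  have v0 : fld_norm v = 0.
    apply/eqP; rewrite -sqrf_eq0 eq_le sqr_ge0 andbT.
    apply: le_trans (form_a_coercive Vv) _.
    by have := k2 v Vv; rewrite k1// addr0 => ->; rewrite mulr0.
  have vi i : vnrm (sub D i) (fld (v i)) = 0.
    apply/eqP; rewrite eq_le sqrtr_ge0 andbT -v0.
    by apply: (ler_sum_term (F := fun i => vnrm (sub D i) (fld (v i)))) => l; exact: sqrtr_ge0.
  have av0 u : Vsp u -> form_a D K u v = 0.
    move=> Vu; apply: big1 => i _.
    exact: (aform_null tK (VH i Vu) (VH i Vv) (vi i)).
  have w0 : normW D w = 0.
    apply/eqP; rewrite eq_le normW_ge0 andbT -[leRHS](mulr0 C0).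
    apply: infsup => // u Vu; have := k2 u Vu; rewrite av0// add0r => ->.
    by rewrite mul0r.
  rewrite LE big1// => i _; rewrite ipC.
  apply: (semi_inner_null (L2_semi_inner D i) (WL i Ww) (Lf i)).
  by apply/eqP; rewrite eq_le sqrtr_ge0 andbT -w0; exact: nrm_le_normW.
have [y Sy sol] := fds_solvable fS linr linl ll ker.
move: y Sy sol => [u p] [Vu Wp] sol; exists u, p; split=> //.
- move=> v Vv; have := sol (v, 0) (conj Vv W0); rewrite BE LE (b0r _ Vu) addr0 => ->.
  by rewrite big1// => i _; apply: ip0r.
- move=> w Ww; have := sol (0, w) (conj V0 Ww).
  by rewrite BE LE (a0r _ Vu) (b0l _ Wp) subr0 add0r.
Qed.

End Stability.

(** * Bound and uniqueness of the mortar variable *)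

Section Mortar.
Context (R : realType) (n N : nat) (D : @decomposition R n N).
Local Notation E := 'rV[R]_n.
Local Notation area := (area R n).
Local Notation hfield := (@hfield R n).
Implicit Types (i j : 'I_N).
Variables (K : E -> 'M[R]_n) (kmin kmax : R) (tK : tensor_field (dom D) K kmin kmax).
Variables (c s h : R) (T : @discretization R n N) (adm : admissible D c s h T).
Variables (b : flavour).
Hypothesis mortar : mortar_condition D b c T.

(** On each interface the mortar condition passes from [lam] to its projections, which are the
    traces of [u]; the discrete trace inequality then costs the negative half power of [h]. Only
    traces enter, so differences of solutions can be inserted. *)
Lemma mortar_bound lam xi (u : 'I_N -> hfield) : Lambda_h D T lam ->
  is_projection D b T lam xi -> (forall i, Vh T i (u i)) ->
  (forall i, {ae area, forall x : E, Gamma_ D i x -> trc (u i) x = xi i x}) ->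
  norm_Lambda D lam <= N%:R ^+ 2 * (2 * c ^+ 2) * (Num.sqrt h)^-1 * normV D u.
Proof.
move=> Llam P Vu tu.
have hs : 0 <= (Num.sqrt h)^-1 by rewrite invr_ge0 sqrtr_ge0.
have nV0 := normV_ge0 D u.
have tB i j : interface D i j ->
    nrm area (gamma D i j) (xi i) <= `|c| * (Num.sqrt h)^-1 * normV D u.
  move=> int; have Lxi := VGamma_L2 adm (projection_VGamma i P).
  have mg := measurable_gamma D i j; have mG := measurable_Gamma_ D i.
  apply: le_trans (nrm_subset mg mG (gamma_Gamma_ int) Lxi) _.
  rewrite -(@nrm_ae _ _ _ area _ mG _ _ (Vh_trace adm (Vu i)) Lxi (tu i)).
  apply: le_trans (adm_trace_ineq adm (Vu i)) _.
  apply: (@le_trans _ _ (`|c| * (Num.sqrt h)^-1 * vnrm (sub D i) (fld (u i)))).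
    apply: ler_wpM2r; first exact: sqrtr_ge0.
    by apply: ler_wpM2r => //; exact: ler_norm.
  apply: ler_wpM2l; first exact: mulr_ge0.
  apply: le_trans (vnrm_le_div_norm D i (u i)) _.
  by apply: (ler_sum_term (F := fun i => div_norm D i (u i))) => l; exact: div_norm_ge0.
have L2lam i j : (i < j)%N -> interface D i j -> L2 area (gamma D i j) lam.
  move=> ij int; have mg := measurable_gamma D i j.
  apply: (L2_subset mg (measurable_Gamma_ D i) (gamma_Gamma_ int)).
  exact: (Lambda_L2_ adm).
apply: le_trans (Gamma_L2 L2lam).2 _.
(* There are at most [N ^+ 2] interfaces with two sides each; one factor [c] is due to the mortar
   condition and one to the trace inequality. *)
have e : N%:R ^+ 2 * (2 * c ^+ 2) * (Num.sqrt h)^-1 * normV D u =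
  \sum_(i < N) \sum_(j < N) (`|c| * (2 * (`|c| * (Num.sqrt h)^-1 * normV D u))).
  have -> : c ^+ 2 = `|c| ^+ 2 by rewrite real_normK ?num_real.
  rewrite !sumr_const !card_ord; set Y := `|c| * _.
  by rewrite -[Y *+ N]mulr_natl -[(_ * Y) *+ N]mulr_natl /Y; ring.
rewrite e; apply: ler_sum => i _; apply: ler_sum => j _.
case: asboolP => [[ij int]|_]; last by rewrite !mulr_ge0.
apply: le_trans (mortar Llam P ij int) _.
apply: (@le_trans _ _ (`|c| * (nrm area (gamma D i j) (xi i) + nrm area (gamma D i j) (xi j)))).
  apply: ler_wpM2r; last exact: ler_norm.
  by apply: addr_ge0; exact: sqrtr_ge0.
apply: ler_wpM2l => //.
have h1 := tB i j int.
have h2 : nrm area (gamma D i j) (xi j) <= `|c| * (Num.sqrt h)^-1 * normV D u.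
  by rewrite gammaC; apply: tB; apply/interfaceC.
by rewrite mulr_natl mulr2n; exact: lerD.
Qed.

Lemma mortar_of_bound u lam : mortar_of D K b T u lam ->
  norm_Lambda D lam <= N%:R ^+ 2 * (2 * c ^+ 2) * (Num.sqrt h)^-1 * normV D u.
Proof. by move=> /(mortar_of_trace adm)[Ll [xi [P Vu tu]]]; exact: (mortar_bound Ll P). Qed.

(** Projections and traces are linear, so [mortar_bound] applies to the difference of the two mortar
    functions and of the two fields. *)
Lemma mortar_of_unique u u' lam lam' : mortar_of D K b T u lam -> mortar_of D K b T u' lam' ->
  normV D (fun i => u i - u' i) = 0 -> norm_Lambda D (fun x => lam x - lam' x) = 0.
Proof.
move=> /(mortar_of_trace adm)[Ll [xi [P Vu tu]]] /(mortar_of_trace adm)[Ll' [xi' [P' Vu' tu']]] uu'.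
apply/eqP; rewrite eq_le sqrtr_ge0 andbT.
have <- : N%:R ^+ 2 * (2 * c ^+ 2) * (Num.sqrt h)^-1 * normV D (fun i => u i - u' i) = 0.
  by rewrite uu' mulr0.
have -> : (fun x => lam x - lam' x) = -1 *: lam' + lam.
  by apply/funext => x; rewrite scaleN1r addrC.
apply: (mortar_bound (xi := -1 *: xi' + xi)).
- exact: (Lambda_subspace adm).2.
- exact: (projection_comb adm).
- by move=> i; exact: (subspaceB (Vh_subspace adm i)).
- move=> i; apply: area_aeS (area_aeI (tu i) (tu' i)) => x [h1 h2] Gx.
  by rewrite [LHS](_ : _ = trc (u i) x - trc (u' i) x)// h1// h2// scaleN1r addrC.
Qed.

End Mortar.

Theorem theorem4p3 (R : realType) (n N : nat) (n23 : n = 2%N \/ n = 3%N)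
    (D : @decomposition R n N) (K : 'rV[R]_n -> 'M[R]_n) (kmin kmax : R)
    (K_tensor : tensor_field (dom D) K kmin kmax)
    (c s : R) (s_gt2 : 2 < s) :
  exists C : R, 0 < C /\
  forall (h : R) (T : @discretization R n N), 0 < h -> admissible D c s h T ->
  [/\ forall f : 'rV[R]_n -> R, L2 (vol R n) (dom D) f ->
        well_posed D K flat T f /\
        forall u p, solution D K flat T f u p ->
          normV D u + normW D p <= C * nrm (vol R n) (dom D) f,
      mortar_condition D flat c T ->
      forall f : 'rV[R]_n -> R, L2 (vol R n) (dom D) f ->
        well_posed D K sharp T f /\
        forall u p, solution D K sharp T f u p ->
          normV D u + normW D p <= C * nrm (vol R n) (dom D) f &
      forall b : flavour, mortar_condition D b c T ->
      forall (f : 'rV[R]_n -> R) u p, L2 (vol R n) (dom D) f -> solution D K b T f u p ->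
        (exists lam, mortar_of D K b T u lam) /\
        (forall lam, mortar_of D K b T u lam ->
          norm_Lambda D lam <= C * (Num.sqrt h)^-1 * normV D u) /\
        (forall u' p' lam lam', solution D K b T f u' p' ->
          mortar_of D K b T u lam -> mortar_of D K b T u' lam' ->
          norm_Lambda D (fun x => lam x - lam' x) = 0)].
Proof.
have s0 : 0 < s by apply: lt_trans s_gt2.
have [[h0 [T0 adm0]]|none] := pselect (exists h0 T0, admissible D c s h0 T0); last first.
  exists 1; split=> // h T _ adm; case: none; by exists h, T.
have kmin0 : 0 < kmin by case: K_tensor.
have kmax0 : 0 < kmax by case: K_tensor => h1 /(lt_trans h1).
(* The constant is extracted from [T0] before [h] and [T] are introduced, and it serves both
   flavours. *)
have [C0 C00 is_] := infsup K_tensor n23 adm0 s0.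
pose Cs := N%:R ^+ 2 * kmax * (C0 / kmin) + N%:R + (C0 / kmin) * (N%:R ^+ 2 * kmax * (C0 / kmin)).
pose Cm := N%:R ^+ 2 * (2 * c ^+ 2).
have k0 : 0 <= C0 / kmin by rewrite divr_ge0// ltW.
have z0 : 0 <= N%:R ^+ 2 * kmax * (C0 / kmin).
  by rewrite !mulr_ge0 ?exprn_ge0 ?(ltW kmax0) ?invr_ge0 ?(ltW kmin0).
have Cs0 : 0 <= Cs by rewrite !addr_ge0// mulr_ge0.
have Cm0 : 0 <= Cm by apply: mulr_ge0; [exact: sqr_ge0|apply: mulr_ge0 => //; exact: sqr_ge0].
(* One constant for both estimates; the summand 1 makes it positive. *)
exists (1 + Cs + Cm); split; first by rewrite ltr_wpDr// ltr_wpDr.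
move=> h T h_gt0 adm.
have Lsub f i : L2 (vol R n) (dom D) f -> L2 (vol R n) (sub D i) f.
  by apply: L2_subset; [exact: measurable_sub|exact: measurable_dom|exact: sub_in_dom].
have nsub f i : L2 (vol R n) (dom D) f -> nrm (vol R n) (sub D i) f <= nrm (vol R n) (dom D) f.
  by apply: nrm_subset; [exact: measurable_sub|exact: measurable_dom|exact: sub_in_dom].
have stable b f : L2 (vol R n) (dom D) f -> well_posed D K b T f /\
    forall u p, solution D K b T f u p ->
      normV D u + normW D p <= (1 + Cs + Cm) * nrm (vol R n) (dom D) f.
  move=> Lf; have isb := is_ h T adm b; split; first split.
  - by apply: (solution_exists K_tensor adm isb) => i; exact: Lsub.
  - move=> u p u' p' S S'.
    exact: (solution_unique K_tensor adm C00 isb S S').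
  - move=> u p S; have F0 : 0 <= nrm (vol R n) (dom D) f by exact: sqrtr_ge0.
    apply: le_trans (solution_bound K_tensor adm C00 isb (fun i => Lsub f i Lf)
      (fun i => nsub f i Lf) F0 S) _.
    by apply: ler_wpM2r => //; rewrite -/Cs; lra.
split; [exact: stable|by move=> _; exact: stable|].
move=> b mortar f u p Lf S; have [[lam ulam] _ _ _] := S.
split; first by exists lam.
split.
  move=> lam' ulam'; apply: le_trans (mortar_of_bound adm mortar ulam') _.
  apply: ler_wpM2r; first exact: normV_ge0.
  apply: ler_wpM2r; first by rewrite invr_ge0 sqrtr_ge0.
  by rewrite -/Cm; lra.
move=> u' p' lam1 lam2 S' h1 h2; apply: (mortar_of_unique adm mortar h1 h2).
by have [[_ uniq] _] := stable b f Lf; have [] := uniq _ _ _ _ S S'.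
Qed.
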